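(* Let $W\subset\mathbb Z^+$. For any nonnegative integers $l$ and $b$ and any composition $\nu$ with $|\nu|+b=2n$, $$\{T^{S}_l(M):M\in\mathcal M^{S}_W(\nu;b),\ \ell^-_{WW}(M)\le2l\}$$ is a basis of $\Pi^{S}(\nu;b)F_{2n}(Sp(2l))$ (i.e. the elements $T^S_l(M)$ indexed by these multisets are linearly independent and span).
   Context: A composition $\nu=(\nu_1,\nu_2,\ldots)$ is a finite sequence of nonnegative integers, $|\nu|=\sum\nu_i$; its blocks are $S(\nu)_i=\{j:\sum_{k<i}\nu_k<j\le\sum_{k\le i}\nu_k\}$. For $S\subset\{1,\ldots,N\}$, in $\mathbb C[S_N]$ put $E_S=\sum_\pi\mathrm{sgn}(\pi)\pi$, $H_S=\sum_\pi\pi$, sums over $\pi\in S_N$ fixing every $x\notin S$. With $N=2n=|\nu|+b$, set $\Pi(\nu)=\prod_{i\in W}E_{S(\nu)_i}\prod_{i\notin W}H_{S(\nu)_i}$ and $\Pi^S(\nu;b)=\Pi(\nu)H_{\{|\nu|+1,\ldots,|\nu|+b\}}$. $F_{2n}(Sp(2l))$ is the space of vectors in $(\mathbb C^{2l})^{\otimes2n}$ fixed by $U^{\otimes2n}$ for all $U\in Sp(2l)$. $\mathbb C[S_{2n}]$ acts through $T_{2l}(\pi)(v_1\otimes\cdots\otimes v_{2n})=v_{\pi(1)}\otimes\cdots\otimes v_{\pi(2n)}$ (extended linearly), and $\Pi^S(\nu;b)F_{2n}(Sp(2l))$ is the image of $F_{2n}(Sp(2l))$ under $T_{2l}(\Pi^S(\nu;b))$.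 Let $e_{\pm1},\ldots,e_{\pm l}$ be a symplectic basis of $\mathbb C^{2l}$ and let $\omega(i,-i)=1$, $\omega(-i,i)=-1$ for $1\le i\le l$ and $\omega(i,j)=0$ otherwise. For a fixed-point-free involution $\tau\in S_{2n}$, $T^S_l(\tau)=\sum_w\prod_{k<\tau(k)}\omega(w_k,w_{\tau(k)})\,e_{w_1}\otimes\cdots\otimes e_{w_{2n}}$, the sum over $w\in\{\pm1,\ldots,\pm l\}^{2n}$; these span $F_{2n}(Sp(2l))$. A multiset $M$ on $\mathbb Z^+\times\mathbb Z^+$ is symmetric if invariant under $(x,y)\mapsto(y,x)$, and $(\overline W,\overline W)$-compatible (where $\overline W=\mathbb Z^+\setminus W$) if $(i,j)$ has multiplicity at most $1$ whenever exactly one of $i,j$ lies in $W$. The fixed points of $M$ (relative to $\overline W$) are the elements $(i,i)$ with $i\notin W$ (counted with multiplicity), together with, for each $i\in W$ such that $(i,i)$ has odd multiplicity, one copy of $(i,i)$. $\mathcal M^S_W(\nu;b)$ is the set of symmetric $(\overline W,\overline W)$-compatible finite multisets in which each $i$ appears $\nu_i$ times as a first coordinate, with exactly $b$ fixed points. For $M\in\mathcal M^S_W(\nu;b)$, let $\hat M$ be the multiset on $(\mathbb Z^+\cup\{\infty\})^2$ obtained by replacing each fixed point $(i,i)$ by the pair of elements $(i,\infty)$ and $(\infty,i)$. Put $c(k)=i$ if $k\in S(\nu)_i$ and $c(k)=\infty$ if $|\nu|<k\le|\nu|+b$. Choose a fixed-point-free involution $\tau\in S_{2n}$ such that $\hat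 M=\{(c(k),c(\tau(k))):1\le k\le2n\}$ as multisets, and define $T^S_l(M):=T_{2l}(\Pi^S(\nu;b))T^S_l(\tau)$, well-defined up to sign (fix any choice). A $(W,W)$-decreasing sequence is a sequence $(x_i,y_i)$ with $x_i\le x_{i+1}$, $y_i\ge y_{i+1}$, where $x_i=x_{i+1}$ only if $x_i\in W$ and $y_i=y_{i+1}$ only if $y_i\in W$. $\ell^-_{WW}(M)$ is the length of the longest $(W,W)$-decreasing sequence of elements of $M$ (the original multiset, not $\hat M$), each used at most as often as its multiplicity. *)

(* Defs.v *)
From HB Require Import structures.
From mathcomp Require Import all_boot all_order all_algebra all_fingroup.
From mathcomp Require Import finmap multiset.
From mathcomp Require Import boolp classical_sets reals.
From mathcomp Require Import complex.

Set Implicit Arguments.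
Unset Strict Implicit.
Unset Printing Implicit Defensive.

Import GRing.Theory.
Local Open Scope ring_scope.
Local Open Scope mset_scope.

(* Conventions: positions 1, ..., N are rendered as 'I_N and Z^+ as nat, both
   shifted by one; so block i of nu has size nth 0 nu i, starting at i = 0.
   A composition is a seq nat, and |nu| is sumn nu. *)

Definition gralg (K : fieldType) (N : nat) : Type := {ffun 'S_N -> K^o}.

Definition gr_of (K : fieldType) (N : nat) (s : 'S_N) : gralg K N :=
  [ffun p => (p == s)%:R].

(* Here s * t is the product of MathComp permutations: (s * t) k = t (s k). *)
Definition gr_mul (K : fieldType) (N : nat) (a b : gralg K N) : gralg K N :=
  \sum_(s : 'S_N) \sum_(t : 'S_N) (a s * b t) *: gr_of K (s * t)%g.

(* perm_on S s says that s fixes every x outside S; s : bool is its parity. *)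
Definition E_ (K : fieldType) (N : nat) (S : {set 'I_N}) : gralg K N :=
  \sum_(s : 'S_N | perm_on S s) (-1) ^+ s *: gr_of K s.

Definition H_ (K : fieldType) (N : nat) (S : {set 'I_N}) : gralg K N :=
  \sum_(s : 'S_N | perm_on S s) gr_of K s.

Definition block (N : nat) (nu : seq nat) (i : nat) : {set 'I_N} :=
  [set k : 'I_N | (sumn (take i nu) <= k < sumn (take i.+1 nu))%N].

Definition tail_block (N : nat) (nu : seq nat) (b : nat) : {set 'I_N} :=
  [set k : 'I_N | (sumn nu <= k < sumn nu + b)%N].

(* Indices i >= size nu have an empty block, hence contribute the factor 1. *)
Definition Pi_ (K : fieldType) (N : nat) (W : set nat) (nu : seq nat) :
  gralg K N :=
  gr_mul
    (\big[@gr_mul K N/gr_of K 1%g]_(0 <= i < size nu | i \in W)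
       E_ K (block N nu i))
    (\big[@gr_mul K N/gr_of K 1%g]_(0 <= i < size nu | i \notin W)
       H_ K (block N nu i)).

Definition PiS (K : fieldType) (N : nat) (W : set nat) (nu : seq nat)
  (b : nat) : gralg K N :=
  gr_mul (Pi_ K N W nu) (H_ K (tail_block N nu b)).

(* Basis vectors of K^{2l} are indexed by 'I_(l + l): lshift l i stands for
   e_i and rshift l i for e_{-i}.  A tensor is the family of its coordinates
   on the basis vectors e_{w_1} (x) ... (x) e_{w_N}. *)
Definition word (N l : nat) := {ffun 'I_N -> 'I_(l + l)}.

Definition tensor (K : fieldType) (N l : nat) : Type :=
  {ffun word N l -> K^o}.

Definition pure (K : fieldType) (N l : nat) (v : 'I_N -> 'cV[K]_(l + l)) :
  tensor K N l :=
  [ffun w : word N l => \prod_(k < N) v k (w k) 0].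

Definition basis_vec (K : fieldType) (l : nat) (j : 'I_(l + l)) :
  'cV[K]_(l + l) := delta_mx j 0.

Definition basis_tensor (K : fieldType) (N l : nat) (w : word N l) :
  tensor K N l := pure (fun k => basis_vec K (w k)).

(* v_1 (x) ... (x) v_N |-> v_{s 1} (x) ... (x) v_{s N} *)
Definition perm_act (K : fieldType) (N l : nat) (s : 'S_N)
  (t : tensor K N l) : tensor K N l :=
  \sum_(w : word N l) t w *: pure (fun k => basis_vec K (w (s k))).

Definition gr_act (K : fieldType) (N l : nat) (a : gralg K N)
  (t : tensor K N l) : tensor K N l :=
  \sum_(s : 'S_N) a s *: perm_act s t.

(* U^{(x) N} *)
Definition tensor_pow (K : fieldType) (N l : nat) (U : 'M[K]_(l + l))
  (t : tensor K N l) : tensor K N l :=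
  \sum_(w : word N l) t w *: pure (fun k => U *m basis_vec K (w k)).

Definition omega (K : fieldType) (l : nat) : 'M[K]_(l + l) :=
  block_mx 0 1%:M (- 1%:M) 0.

Definition Sp (K : fieldType) (l : nat) : set 'M[K]_(l + l) :=
  [set U | U^T *m omega K l *m U = omega K l]%classic.
Arguments Sp : clear implicits.

Definition invariants (K : fieldType) (N l : nat) : set (tensor K N l) :=
  [set t | forall U, Sp K l U -> tensor_pow U t = t]%classic.

Arguments invariants : clear implicits.

Definition fpf_involution (N : nat) (tau : 'S_N) : Prop :=
  forall k, tau (tau k) = k /\ tau k <> k.

Definition T_inv (K : fieldType) (N l : nat) (tau : 'S_N) : tensor K N l :=
  \sum_(w : word N l)
    (\prod_(k < N | (k < tau k)%N) omega K l (w k) (w (tau k)))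
      *: basis_tensor K w.

Definition msymmetric (M : {mset nat * nat}) : Prop :=
  forall x y, M (x, y) = M (y, x).

Definition mcompatible (W : set nat) (M : {mset nat * nat}) : Prop :=
  forall i j, (i \in W) != (j \in W) -> (M (i, j) <= 1)%N.

Definition fixed_points (W : set nat) (M : {mset nat * nat}) :
  {mset nat * nat} :=
  [fsfun p in finsupp M =>
     if p.1 == p.2 then (if p.1 \in W then nat_of_bool (odd (M p)) else M p)
     else 0%N].

Definition MSW (W : set nat) (nu : seq nat) (b : nat) :
  set {mset nat * nat} :=
  [set M | [/\ msymmetric M, mcompatible W M,
    forall i, count (fun p => p.1 == i) M = nth 0%N nu i
    & size (fixed_points W M) = b]]%classic.

(* The point at infinity is None. *)
Definition mhat (W : set nat) (M : {mset nat * nat}) :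
  {mset option nat * option nat} :=
  let F := fixed_points W M in
  seq_mset [seq (Some p.1, Some p.2) | p <- M `\` F]
  `+` seq_mset [seq (Some p.1, None) | p <- F]
  `+` seq_mset [seq (None, Some p.2) | p <- F].

(* The blocks partition the first |nu| positions; the others get None. *)
Definition color (N : nat) (nu : seq nat) (k : 'I_N) : option nat :=
  omap (@nat_of_ord (size nu)) [pick i : 'I_(size nu) | k \in block N nu i].

Definition realizes (N : nat) (W : set nat) (nu : seq nat) (tau : 'S_N)
  (M : {mset nat * nat}) : Prop :=
  fpf_involution tau /\
  mhat W M = seq_mset [seq (color nu k, color nu (tau k)) | k <- enum 'I_N].

Definition T_mset (K : fieldType) (N l : nat) (W : set nat) (nu : seq nat)
  (b : nat) (tau : 'S_N) : tensor K N l :=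
  gr_act (PiS K N W nu b) (T_inv K l tau).

Definition dec_step (W : set nat) (p q : nat * nat) : bool :=
  [&& (p.1 <= q.1)%N, (q.2 <= p.2)%N,
      (p.1 == q.1) ==> (p.1 \in W) & (p.2 == q.2) ==> (p.2 \in W)].

Definition decreasing_in (W : set nat) (M : {mset nat * nat})
  (s : seq (nat * nat)) : Prop :=
  sorted (dec_step W) s /\ seq_mset s `<=` M.

Definition has_decreasing (W : set nat) (M : {mset nat * nat}) : pred nat :=
  fun m => `[< exists s, decreasing_in W M s /\ size s = m >].

Fact has_decreasing_ex (W : set nat) (M : {mset nat * nat}) :
  exists m, has_decreasing W M m.
Proof.
exists 0%N; apply/asboolP; exists [::]; split=> //; split=> //.
by apply/forallP => x; rewrite mset_seqE.
Qed.

Fact has_decreasing_ub (W : set nat) (M : {mset nat * nat}) (m : nat) :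
  has_decreasing W M m -> (m <= size M)%N.
Proof.
move=> /asboolP[s [[_ /msubsetP sM] <-]].
have /count_subseqP[s' s'M /perm_size ->] :
    forall x, (count_mem x s <= count_mem x (enum_mset M))%N.
  by move=> x; have := sM x; rewrite mset_seqE count_mem_mset.
exact: size_subseq.
Qed.

Definition ell_dec (W : set nat) (M : {mset nat * nat}) : nat :=
  ex_maxn (has_decreasing_ex W M) (@has_decreasing_ub W M).

(* The family f, indexed by the set A, is a basis of V; A is listed by s. *)
Definition basis_family (K : fieldType) (vT : vectType K) (I : eqType)
  (A : set I) (f : I -> vT) (V : set vT) : Prop :=
  exists s : seq I,
    [/\ uniq s, forall i, i \in s <-> A i, free [seq f i | i <- s]
      & forall x, x \in <<[seq f i | i <- s]>>%VS <-> V x].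

(* Main.v *)
(* Spanning of the matching tensors (first fundamental theorem): for an invariant
   tensor t, the Casimir of Sp(2l) equates sum_(k <> j) (k j) t + (2l + 1) N t with
   minus the sum over k <> j of the form inserted at the positions k and j of the
   contraction of t at k and j.  The operator on the left is positive definite,
   and the contractions are invariants of lower degree.

   Straightening: Pi^S is a signed sum over the Young subgroup, so up to sign the
   image of a matching only depends on its multiset M of colored pairs.  If M
   has a decreasing sequence of length > 2l, it has a symmetric one; antisymmetrizing
   over the > 2l positions below it gives 0, all terms with multiset M add up without
   cancellation, and every other nonzero term has a larger value of sum (x + 1)(y + 1)
   by the rearrangement inequality.

   Independence: when no decreasing sequence of M is longer than 2l, the nesting
   height of the chords of tau is below l, which yields a word w pairing the two ends
   of a chord of height h by e_h and e_(-h).  The coordinate of T(M) on w does not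
   vanish, and among the T(M') only those with M' smaller in a suitable order have a
   nonzero coordinate on w. *)
From HB Require Import structures.
Require Import Defs.
From mathcomp Require Import finmap multiset.
From mathcomp Require Import boolp classical_sets reals.
From mathcomp Require Import complex.
From mathcomp Require Import all_boot all_order all_algebra all_fingroup.
From mathcomp Require Import zify.

Set Implicit Arguments.
Unset Strict Implicit.
Unset Printing Implicit Defensive.

Import Order.TTheory GRing.Theory Num.Theory.
Local Open Scope ring_scope.


(** The obstacle that shapes the proof is sign. The form is antisymmetric, so a permutation
    commuting with [tau] multiplies its tensor by its signature, while the symmetrizer sees only the
    signature on the blocks in W. Where the two disagree on a Young element commuting with [tau],
    the symmetrized tensor is 0; excluding two such configurations is what compatibility and the
    fixed points of M record, the tail being one more even block. Where they agree nothing cancels: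
    permutations yielding the same multiset differ by a commuting factor and a Young factor, both of
    known sign.

    In straightening, the antisymmetrized positions must contain both ends of each chord they touch,
    or points off the chain would move; hence the chain is made symmetric and partners in the tail
    are added. This keeps the signs right because a chain contains at most one fixed point.

    Contractions do not lower the number of tensor factors here: the induction runs on the set of
    positions where invariance is still known. *)

Definition wperm N l (w : word N l) (s : 'S_N) : word N l :=
  [ffun k => w (s k)].

(** * Permutation actions on tensors, in coordinates *)

Section Tensors.
Variables (K : fieldType) (N l : nat).
Implicit Types (s u : 'S_N) (w : word N l) (t : tensor K N l).

Lemma wperm1 w : wperm w 1%g = w.
Proof. by apply/ffunP => k; rewrite ffunE perm1. Qed.

Lemma wpermM w s u : wperm w (s * u)%g = wperm (wperm w u) s.
Proof. by apply/ffunP => k; rewrite !ffunE permM. Qed.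

Lemma prod_eq_word w w' : \prod_(k < N) (w k == w' k)%:R = (w == w')%:R :> K.
Proof.
case: eqVneq => [->|neq]; first by rewrite big1 // => k _; rewrite eqxx.
have [k wk] : exists k, w k != w' k.
  apply/existsP; rewrite -negb_forall; apply: contraNN neq => /forallP eqw.
  by apply/eqP/ffunP => k; apply/eqP.
by rewrite (bigD1 k) //= (negbTE wk) mul0r.
Qed.

Lemma pure_basisE (f : 'I_N -> 'I_(l + l)) w :
  pure (fun k => basis_vec K (f k)) w = (w == [ffun k => f k])%:R.
Proof.
rewrite ffunE -prod_eq_word; apply: eq_bigr => k _.
by rewrite mxE eqxx andbT ffunE.
Qed.

Lemma T_invE (tau : 'S_N) w :
  T_inv K l tau w =
  \prod_(k < N | (k < tau k)%N) omega K l (w k) (w (tau k)).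
Proof.
rewrite /T_inv sum_ffunE (bigD1 w) //= [X in _ + X]big1 => [|w' neq].
  rewrite addr0 ffunE pure_basisE.
  have -> : [ffun k => w k] = w by apply/ffunP => k; rewrite ffunE.
  by rewrite eqxx; apply: mulr1.
rewrite ffunE pure_basisE; case: eqP => [def_w|]; last by move=> _; apply: mulr0.
by case/eqP: neq; rewrite def_w; apply/ffunP => k; rewrite ffunE.
Qed.

Lemma perm_actE s t w : perm_act s t w = t (wperm w s^-1).
Proof.
rewrite /perm_act sum_ffunE (bigD1 (wperm w s^-1)) //= big1 => [|w' neq].
  rewrite addr0 ffunE (pure_basisE (fun k => _ (s k))).
  have -> : [ffun k => wperm w s^-1 (s k)] = w.
    by apply/ffunP => k; rewrite !ffunE permK.
  by rewrite eqxx; apply: mulr1.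
rewrite ffunE (pure_basisE (fun k => w' (s k))).
case: eqP => [def_w|]; last by move=> _; apply: mulr0.
by case/eqP: neq; rewrite def_w; apply/ffunP => k; rewrite !ffunE permKV.
Qed.

Lemma perm_act_is_linear s : linear (@perm_act K N l s).
Proof. by move=> a t t'; apply/ffunP => w; rewrite !(perm_actE, ffunE). Qed.
HB.instance Definition _ s := GRing.isLinear.Build K (tensor K N l)
  (tensor K N l) _ (@perm_act K N l s) (@perm_act_is_linear s).

Lemma perm_actZ s (a : K) t : perm_act s (a *: t) = a *: perm_act s t.
Proof. exact: linearZ. Qed.

Lemma perm_act1 t : perm_act 1%g t = t.
Proof. by apply/ffunP => w; rewrite perm_actE invg1 wperm1. Qed.

(** The product of permutations applies its left factor first; together with v_1, v_2, ... being
    sent to v_{s 1}, v_{s 2}, ... this makes [perm_act] a left action. *)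
Lemma perm_actM s u t : perm_act (s * u)%g t = perm_act s (perm_act u t).
Proof. by apply/ffunP => w; rewrite !perm_actE invMg wpermM. Qed.

Lemma gr_act_linearl t : linear (fun a : {ffun 'S_N -> K^o} => gr_act a t).
Proof.
move=> c a a'; rewrite /gr_act scaler_sumr -big_split /=.
by apply: eq_bigr => s _; rewrite !ffunE scalerDl scalerA.
Qed.

Lemma gr_act_of s t : gr_act (gr_of K s) t = perm_act s t.
Proof.
rewrite /gr_act (bigD1 s) //= big1 => [|u neq]; last first.
  by rewrite ffunE (negbTE neq) scale0r.
by rewrite ffunE eqxx scale1r addr0.
Qed.

End Tensors.

Section GroupAlgebra.
Variables (K : fieldType) (N l : nat).

HB.instance Definition _ := GRing.Lmodule.on (gralg K N).

Definition gr_actr (t : tensor K N l) (a : gralg K N) := gr_act a t.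

HB.instance Definition _ t := GRing.isLinear.Build K (gralg K N)
  (tensor K N l) _ (gr_actr t) (@gr_act_linearl K N l t).

Lemma gr_sumE (P : pred 'S_N) (x : 'S_N -> K) u :
  (\sum_(s | P s) x s *: gr_of K s) u = if P u then x u else 0.
Proof.
rewrite sum_ffunE; case: ifP => [Pu|nPu].
  rewrite (bigD1 u) //= big1 => [|s /andP[_ neq]].
    by rewrite addr0 !ffunE eqxx; apply: mulr1.
  by rewrite !ffunE eq_sym (negbTE neq); apply: mulr0.
rewrite big1 // => s Ps; rewrite !ffunE.
by case: eqP => [us|_]; [rewrite us Ps in nPu | apply: mulr0].
Qed.

End GroupAlgebra.

(** * Young subgroups and their symmetrizers *)

Section Young.
Variables (K : fieldType) (N : nat) (T : eqType) (e : 'I_N -> T) (od : pred T).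
Implicit Types (s u : 'S_N) (D B : {set 'I_N}).

Definition young s := [forall k, e (s k) == e k].
Definition oddset := [set k | od (e k)].
(** On the Young subgroup this is the product of the signs on the color classes satisfying [od]. If
    s does not preserve [oddset], [restr_perm] returns the identity, so multiplicativity is claimed
    for Young elements only. *)
Definition chi s : K := (-1) ^+ restr_perm oddset s.

Lemma youngP s : reflect (forall k, e (s k) = e k) (young s).
Proof. by apply: (iffP forallP) => H k; apply/eqP. Qed.

Lemma young1 : young 1%g.
Proof. by apply/youngP => k; rewrite perm1. Qed.

Lemma youngM s u : young s -> young u -> young (s * u)%g.
Proof.
by move=> /youngP Ys /youngP Yu; apply/youngP => k; rewrite permM Yu Ys.
Qed.

Lemma youngV s : young s -> young s^-1%g.
Proof. by move=> /youngP Ys; apply/youngP => k; rewrite -{2}(permKV s k) Ys. Qed.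

Lemma stabP D s : reflect (forall k, (s k \in D) = (k \in D)) (s \in 'N(D | 'P)%g).
Proof. exact: (@astabsP _ _ 'P%act). Qed.

Lemma young_stab s : young s -> s \in 'N(oddset | 'P)%g.
Proof. by move=> /youngP Ys; apply/stabP => k; rewrite !inE Ys. Qed.

Lemma chi1 : chi 1%g = 1.
Proof. by rewrite /chi morph1 odd_perm1. Qed.

Lemma chiM s u : young s -> young u -> chi (s * u)%g = chi s * chi u.
Proof.
move=> Ys Yu; rewrite /chi morphM ?young_stab //.
by rewrite odd_permM signr_addb.
Qed.

Lemma chi_sq s : chi s * chi s = 1.
Proof. by rewrite /chi -signr_addb addbb. Qed.

Lemma chi_on_odd D s : D \subset oddset -> perm_on D s -> chi s = (-1) ^+ s.
Proof.
move=> DO Ds; suff E : restr_perm oddset s = s by rewrite /chi E.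
have Os := subset_trans Ds DO : perm_on oddset s.
have sN : s \in 'N(oddset | 'P)%g by apply/stabP => k; rewrite perm_closed.
apply/permP => k; have [kO|kO] := boolP (k \in oddset).
  exact: restr_permE.
by rewrite (out_perm Os kO) (out_perm (restr_perm_on _ _) kO).
Qed.

Lemma chi_fix s : {in oddset, forall k, s k = k} -> chi s = 1.
Proof.
move=> fs; suff E : restr_perm oddset s = 1%g by rewrite /chi E odd_perm1.
have sN : s \in 'N(oddset | 'P)%g.
  apply/stabP => k; apply/idP/idP => [skO|kO]; last by rewrite fs.
  by rewrite -(perm_inj (fs _ skO)).
apply/permP => k; rewrite perm1; have [kO|kO] := boolP (k \in oddset).
  by rewrite restr_permE // fs.
by rewrite (out_perm (restr_perm_on _ _) kO).
Qed.

(** Such a D is a union of color classes, so that restricting a Young element to it gives a Young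
    element again. *)
Definition saturated D := forall j k, e j = e k -> (j \in D) = (k \in D).

Definition youngsum D : gralg K N :=
  \sum_(s | perm_on D s && young s) chi s *: gr_of K s.

Lemma gr_mul_sum (P Q : pred 'S_N) (x y : 'S_N -> K) :
  gr_mul (\sum_(s | P s) x s *: gr_of K s) (\sum_(s | Q s) y s *: gr_of K s) =
  \sum_(p | P p.1 && Q p.2) (x p.1 * y p.2) *: gr_of K (p.1 * p.2)%g.
Proof.
rewrite /gr_mul -(pair_big P Q (fun s u => (x s * y u) *: gr_of K (s * u)%g)) /=.
rewrite [RHS]big_mkcond /=; apply: eq_bigr => s _.
rewrite [X in _ = if _ then X else _]big_mkcond /=.
case: ifP => Ps; last first.
  by rewrite big1 // => u _; rewrite gr_sumE Ps mul0r scale0r.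
apply: eq_bigr => u _; rewrite !gr_sumE Ps.
by case: ifP => Qu; rewrite ?mulr0 ?scale0r.
Qed.

Lemma restr_young D s : saturated D -> young s ->
  [/\ s \in 'N(D | 'P)%g, perm_on D (restr_perm D s) & young (restr_perm D s)].
Proof.
move=> satD Ys; have sN : s \in 'N(D | 'P)%g.
  by apply/stabP => k; apply: satD; apply/youngP.
split=> //; first exact: restr_perm_on.
apply/youngP => k; have [kD|kD] := boolP (k \in D).
  by rewrite restr_permE //; apply/youngP.
by rewrite (out_perm (restr_perm_on _ _) kD).
Qed.

(** A Young element supported on the union is uniquely the product of its restrictions to D and to
    B, and [chi] is multiplicative; this is the bijection behind the reindexing. *)
Lemma youngsumU D B : saturated D -> saturated B -> [disjoint D & B] ->
  gr_mul (youngsum D) (youngsum B) = youngsum (D :|: B).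
Proof.
move=> satD satB dis; rewrite gr_mul_sum.
rewrite [RHS](reindex_onto (fun p : 'S_N * 'S_N => (p.1 * p.2)%g)
  (fun s => (restr_perm D s, restr_perm B s))) /=; last first.
  move=> s /andP[DBs Ys]; have [sD _ _] := restr_young satD Ys.
  have [sB _ _] := restr_young satB Ys.
  apply/permP => k; rewrite permM; have [kD|kD] := boolP (k \in D).
    rewrite (restr_permE sD kD) (out_perm (restr_perm_on _ _)) //.
    by rewrite (disjointFr dis) // (stabP _ _ sD).
  rewrite (out_perm (restr_perm_on _ _) kD).
  have [kB|kB] := boolP (k \in B); first by rewrite restr_permE.
  rewrite (out_perm (restr_perm_on _ _) kB) (out_perm DBs) //.
  by rewrite inE negb_or kD.
apply: eq_big => [[s u]|[s u] /=]; last first.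
  by case/andP => /andP[_ Ys] /andP[_ Yu]; rewrite chiM.
rewrite /=; apply/andP/andP => [[/andP[Ds Ys] /andP[Bu Yu]]|].
  have Ysu := youngM Ys Yu; have [suD _ _] := restr_young satD Ysu.
  have [suB _ _] := restr_young satB Ysu.
  split; first by rewrite Ysu andbT perm_onM //;
    [apply: subset_trans Ds _ | apply: subset_trans Bu _]; rewrite (subsetUl, subsetUr).
  apply/eqP; congr pair; apply/permP => k.
    have [kD|kD] := boolP (k \in D); last first.
      by rewrite (out_perm (restr_perm_on _ _)) // (out_perm Ds).
    rewrite restr_permE // permM (out_perm Bu) // (disjointFr dis) //.
    by rewrite perm_closed.
  have [kB|kB] := boolP (k \in B); last first.
    by rewrite (out_perm (restr_perm_on _ _)) // (out_perm Bu).
  by rewrite restr_permE // permM (out_perm Ds) // (disjointFl dis).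
case=> /andP[DBsu Ysu] /eqP[eqs equ].
have [_ Ds Ys] := restr_young satD Ysu; have [_ Bu Yu] := restr_young satB Ysu.
by rewrite eqs in Ds Ys; rewrite equ in Bu Yu; rewrite Ds Ys Bu Yu.
Qed.

End Young.

(** * Block colors of positions *)

Section Colors.
Variables (N : nat) (nu : seq nat).
Implicit Types (k : 'I_N) (i j : nat).

Lemma leq_sumn_take i j : (i <= j)%N -> (sumn (take i nu) <= sumn (take j nu))%N.
Proof.
move=> ij; rewrite -(subnKC ij) takeD sumn_cat.
exact: leq_addr.
Qed.

Lemma block_inj i j k : k \in block N nu i -> k \in block N nu j -> i = j.
Proof.
rewrite !inE => /andP[ik ki] /andP[jk kj]; case: (ltngtP i j) => // lt.
  by have := leq_trans ki (leq_trans (leq_sumn_take lt) jk); rewrite ltnn.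
by have := leq_trans kj (leq_trans (leq_sumn_take lt) ik); rewrite ltnn.
Qed.

Lemma block_ex k : (k < sumn nu)%N -> exists2 i, (i < size nu)%N & k \in block N nu i.
Proof.
move=> k_lt; have ex : exists i, (k < sumn (take i nu))%N.
  by exists (size nu); rewrite take_size.
case: (ex_minnP ex) => [[|i]] ki min_i; first by rewrite take0 in ki.
exists i; first by rewrite min_i // take_size.
by rewrite inE ki andbT leqNgt; apply/negP => /min_i; rewrite ltnn.
Qed.

Lemma block_lt i k : k \in block N nu i -> (k < sumn nu)%N /\ (i < size nu)%N.
Proof.
rewrite inE => /andP[ik ki]; split.
  apply: leq_trans ki _; rewrite -[X in (_ <= sumn X)%N](cat_take_drop i.+1).
  by rewrite sumn_cat leq_addr.
rewrite ltnNge; apply/negP => le; have := leq_ltn_trans ik ki.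
by rewrite !take_oversize ?ltnn // ltnW.
Qed.

Lemma colorP i k : (color nu k == Some i) = (k \in block N nu i).
Proof.
rewrite /color; case: pickP => [j kj|none] /=; last first.
  apply/esym/negP => ki; have [_ lt] := block_lt ki.
  by have := none (Ordinal lt); rewrite ki.
apply/eqP/idP => [[<-] //|ki]; congr Some.
exact: block_inj kj ki.
Qed.

Lemma color_None k : (color nu k == None) = (sumn nu <= k)%N.
Proof.
rewrite leqNgt; case E: (color nu k) => [i|].
  by move/eqP: E; rewrite colorP => /block_lt[->].
apply/esym/negP => /block_ex[i _].
by rewrite -colorP E.
Qed.

Lemma color_block i k : k \in block N nu i -> color nu k = Some i.
Proof. by rewrite -colorP => /eqP. Qed.

Lemma card_block b i : (sumn nu + b = N)%N -> #|block N nu i| = nth 0%N nu i.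
Proof.
move=> sN; have [le|lt] := leqP (size nu) i.
  rewrite nth_default //; apply/eqP; rewrite cards_eq0; apply/eqP/setP => k.
  rewrite [RHS]inE; apply/negP => /block_lt[_]; by rewrite ltnNge le.
set a := sumn (take i nu); set d := nth 0%N nu i.
have def_d : sumn (take i.+1 nu) = (a + d)%N.
  by rewrite (take_nth 0%N lt) sumn_rcons.
have le_N : (a + d <= N)%N.
  by rewrite -def_d -sN -{2}[nu](cat_take_drop i.+1) sumn_cat -addnA leq_addr.
have lt_N (j : 'I_d) : (a + j < N)%N by rewrite (leq_trans _ le_N) // ltn_add2l.
pose h (j : 'I_d) := Ordinal (lt_N j).
have h_inj : injective h.
  by move=> x y /(congr1 val) /= /addnI; apply: val_inj.
rewrite -[RHS]card_ord -(card_imset _ h_inj); apply: eq_card => k.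
rewrite inE -/a def_d; apply/andP/imsetP => [[ak kd]|[j _ ->] /=]; last first.
  by rewrite leq_addr ltn_add2l ltn_ord.
have lt' : (k - a < d)%N by rewrite ltn_subLR.
by exists (Ordinal lt') => //; apply/val_inj => /=; rewrite subnKC.
Qed.

End Colors.

Definition odd_color (W : set nat) (c : option nat) : bool :=
  if c is Some i then i \in W else false.

(** * The symmetrizer as a signed sum over the Young subgroup *)

Section PiS.
Variables (K : fieldType) (N : nat) (W : set nat) (nu : seq nat).
Local Notation e := (@color N nu).
Local Notation od := (odd_color W).

Lemma saturated_block i : saturated e (block N nu i).
Proof. by move=> j k ejk; rewrite -!colorP ejk. Qed.

Lemma saturated_tail : saturated e [set k : 'I_N | (sumn nu <= k)%N].
Proof. by move=> j k ejk; rewrite !inE -!color_None ejk. Qed.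

Lemma young_on (D : {set 'I_N}) (c : option nat) s :
  (forall k, k \in D -> e k = c) -> perm_on D s -> young e s.
Proof.
move=> eD Ds; apply/youngP => k; have [kD|kD] := boolP (k \in D).
  by rewrite !eD // perm_closed.
by rewrite (out_perm Ds).
Qed.

Lemma E_youngsum i : i \in W -> E_ K (block N nu i) = youngsum K e od (block N nu i).
Proof.
move=> iW; apply: eq_big => s.
  case Ds: (perm_on _ s) => //=; apply/esym.
  by apply: (young_on (c := Some i)) Ds => k; apply: color_block.
move=> Ds; rewrite (chi_on_odd _ _ Ds) //.
by apply/subsetP => k /color_block ek; rewrite inE ek.
Qed.

Lemma H_youngsum (D : {set 'I_N}) (c : option nat) : (forall k, k \in D -> e k = c) -> ~~ od c ->
  H_ K D = youngsum K e od D.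
Proof.
move=> eD nc; apply: eq_big => s.
  by case Ds: (perm_on _ s) => //=; rewrite (young_on eD Ds).
move=> Ds; rewrite chi_fix ?scale1r // => k; rewrite inE => ok.
by rewrite (out_perm Ds) //; apply: contra nc => /eD <-.
Qed.

Lemma youngsum0 : gr_of K 1%g = youngsum K e od set0.
Proof.
rewrite /youngsum (bigD1 1%g) /=; last by rewrite perm_on1 young1.
rewrite big1 => [|s /andP[/andP[s0 _] neq]].
  by rewrite chi1 scale1r addr0.
case/eqP: neq; apply/permP => k; rewrite perm1 (out_perm s0) //.
by rewrite inE.
Qed.

Lemma big_youngsum (r : seq nat) (P : pred nat) (F : nat -> gralg K N) :
  uniq r -> (forall i, P i -> F i = youngsum K e od (block N nu i)) ->
  \big[@gr_mul K N/gr_of K 1%g]_(i <- r | P i) F i =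
  youngsum K e od [set k | has (fun i => P i && (k \in block N nu i)) r].
Proof.
move=> + FE; elim: r => [_|i r IH /= /andP[ir ur]].
  rewrite big_nil youngsum0.
  by congr (youngsum _ _ _ _); apply/setP => k; rewrite !inE.
rewrite big_cons; case: ifP => Pi; last first.
  by rewrite IH //; congr (youngsum _ _ _ _); apply/setP => k; rewrite !inE ?Pi.
rewrite IH // FE // youngsumU.
- by congr (youngsum _ _ _ _); apply/setP => k; rewrite !inE ?Pi.
- exact: saturated_block.
- move=> j k ejk; rewrite !inE; apply: eq_has => i'.
  by rewrite (saturated_block _ ejk).
apply/pred0P => k /=; apply/negP => /andP[ki]; rewrite inE => /hasP[j jr /andP[_ kj]].
by case/negP: ir; rewrite (block_inj ki kj).
Qed.

(** The blocks in W, the other blocks and the tail partition the positions, and each factor is a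
    [youngsum], the tail counting as an even color; [youngsumU] then merges them. *)
Lemma PiSE b : (sumn nu + b = N)%N -> PiS K N W nu b = youngsum K e od [set: 'I_N].
Proof.
move=> sN; rewrite /PiS /Pi_ !big_youngsum ?iota_uniq //; last 2 first.
- move=> i iW; apply: (@H_youngsum _ (Some i)) => // k; exact: color_block.
- by move=> i iW; apply: E_youngsum.
have -> : tail_block N nu b = [set k : 'I_N | (sumn nu <= k)%N].
  by apply/setP => k; rewrite !inE sN ltn_ord andbT.
rewrite (@H_youngsum _ None) //; last first.
  by move=> k; rewrite inE -color_None => /eqP.
have satH (P : pred nat) r : saturated e [set k | has (fun i => P i && (k \in block N nu i)) r].
  by move=> j k ejk; rewrite !inE; apply: eq_has => i; rewrite (saturated_block _ ejk).
rewrite youngsumU //; last first.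
  apply/pred0P => k /=; apply/negP; rewrite !inE.
  case/andP => /hasP[i _ /andP[iW ki]] /hasP[j _ /andP[jW kj]].
  by rewrite -(block_inj ki kj) iW in jW.
rewrite youngsumU //; last 3 first.
- by move=> j k ejk; rewrite !(in_setU, satH _ _ _ _ ejk).
- exact: saturated_tail.
- apply/pred0P => k /=; apply/negP; rewrite !inE leqNgt => /andP[+ /negP[]].
  by case/orP => /hasP[i _ /andP[_ /block_lt[]]].
congr (youngsum _ _ _ _); apply/setP => k; rewrite !inE; apply/idP.
have [//|lt] := leqP (sumn nu) k; first by rewrite orbT.
have [i i_lt ki] := block_ex lt.
have ir : i \in index_iota 0 (size nu) by rewrite mem_index_iota.
by case iW: (i \in W); apply/orP; left; apply/orP; [left|right];
  apply/hasP; exists i => //; rewrite ki iW.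
Qed.

End PiS.

Section Symmetrizer.
Variables (K : fieldType) (N l : nat) (T : eqType) (e : 'I_N -> T) (od : pred T).

Definition symm (t : tensor K N l) : tensor K N l :=
  \sum_(s | young e s) chi K e od s *: perm_act s t.

Lemma symm_is_linear : linear symm.
Proof.
move=> a t t'; rewrite /symm scaler_sumr -big_split /=.
by apply: eq_bigr => s _; rewrite linearP scalerDr !scalerA mulrC.
Qed.
HB.instance Definition _ := GRing.isLinear.Build K (tensor K N l)
  (tensor K N l) _ symm symm_is_linear.

Lemma gr_act_youngsum t : gr_act (youngsum K e od [set: 'I_N]) t = symm t.
Proof.
rewrite -[LHS]/(gr_actr t _) linear_sum; apply: eq_big => s.
  by case: young; rewrite ?andbF // andbT; apply/subsetP => k; rewrite inE.
by move=> _; rewrite linearZ /= /gr_actr gr_act_of.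
Qed.

Lemma symm_perm u t : young e u -> symm (perm_act u t) = chi K e od u *: symm t.
Proof.
move=> Yu; rewrite /symm scaler_sumr (reindex_inj (mulIg u^-1%g)) /=.
have Yui := youngV Yu; apply: eq_big => s.
  apply/idP/idP => [Ysu|Ys]; last exact: youngM.
  by rewrite -(mulgKV u s) youngM.
move=> Ysu; rewrite -perm_actM mulgKV scalerA; congr (_ *: _).
have -> : chi K e od s = chi K e od (s * u^-1)%g * chi K e od u.
  by rewrite -chiM // mulgKV.
by rewrite mulrCA chi_sq mulr1.
Qed.

End Symmetrizer.

(** * Fixed-point-free involutions *)

Section Matchings.
Variable (N : nat).
Implicit Types (s tau : 'S_N) (S A : {set 'I_N}) (k : 'I_N).

Lemma conj_permE tau s k : (tau ^ s)%g (s k) = s (tau k).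
Proof. exact: permJ. Qed.

(** Identity outside S, so that a matching of a subset of the positions is still an element of the
    full symmetric group. *)
Definition matching S tau :=
  perm_on S tau && [forall k in S, (tau (tau k) == k) && (tau k != k)].

Lemma matchingP S tau :
  reflect [/\ perm_on S tau, {in S, involutive tau} & {in S, forall k, tau k != k}]
          (matching S tau).
Proof.
apply: (iffP andP) => [[on_S /forall_inP H]|[on_S inv fpf]].
  by split=> // k /H /andP[/eqP].
by split=> //; apply/forall_inP => k kS; rewrite inv // eqxx fpf.
Qed.

Lemma matchingT tau : matching setT tau <-> fpf_involution tau.
Proof.
split=> [/matchingP[_ inv fpf] k|H].
  by split; [apply: inv|apply/eqP/fpf]; rewrite inE.
apply/matchingP; split=> [|k _|k _]; first by apply/subsetP => k; rewrite inE.
- by case: (H k).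
- by apply/eqP; case: (H k).
Qed.

Lemma matchingK S tau : matching S tau -> involutive tau.
Proof.
move=> /matchingP[on_S inv _] k; have [kS|kS] := boolP (k \in S); first exact: inv.
by rewrite !(out_perm on_S).
Qed.

Lemma matchingJ S tau s : perm_on S s -> matching S tau -> matching S (tau ^ s)%g.
Proof.
move=> Ss mt; have inv := matchingK mt; case/matchingP: mt => on_S _ fpf.
have Ssi : perm_on S s^-1%g by rewrite perm_onV.
apply/matchingP; split=> [|k kS|k kS].
- by rewrite !perm_onM // perm_onV.
- by rewrite !permM permK inv permKV.
rewrite !permM; apply: contraTneq (fpf (s^-1 k)%g _) => [eqk|].
  by rewrite -{2}eqk permK negbK.
by rewrite perm_closed.
Qed.

(** A transversal of the chords inside S. Matching tensors are defined with the left ends of chords,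
    but conjugation carries these to arbitrary ends, so signs are tracked through general
    transversals. *)
Definition orbit_reps S tau A :=
  [/\ A \subset S, [disjoint A & tau @: A] & forall k, k \in S -> (k \in A) || (tau k \in A)].

Lemma orbit_reps_tau S tau A k : matching S tau -> orbit_reps S tau A -> k \in S ->
  (tau k \in A) = (k \notin A).
Proof.
move=> mt [_ dis cov] kS; have inv := matchingK mt.
apply/idP/idP => [tkA|kA]; last by have := cov k kS; rewrite (negbTE kA).
by apply/negP => kA; have := disjointFr dis tkA; rewrite imset_f.
Qed.

Lemma orbit_reps_lt S tau : matching S tau -> orbit_reps S tau [set k in S | k < tau k]%N.
Proof.
move=> mt; have inv := matchingK mt; case/matchingP: mt => on_S _ fpf; split.
- by apply/subsetP => k; rewrite inE => /andP[].
- apply/pred0P => k /=; apply/negP; rewrite inE => /andP[/andP[kS lt]].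
  case/imsetP => j; rewrite inE => /andP[jS ltj] def_k.
  by move: lt; rewrite def_k inv ltnNge ltnW.
move=> k kS; rewrite !inE kS perm_closed // kS inv /=.
by have := fpf k kS; rewrite -(inj_eq val_inj) neq_ltn orbC.
Qed.

Lemma orbit_repsJ S tau A s : perm_on S s ->
  orbit_reps S tau A -> orbit_reps S (tau ^ s)%g (s @: A).
Proof.
move=> Ss [AS dis cov]; have sS k : (s k \in S) = (k \in S) by rewrite perm_closed.
split.
- by apply/subsetP => k /imsetP[j jA ->]; rewrite sS (subsetP AS).
- apply/pred0P => k /=; apply/negP => /andP[/imsetP[j jA ->] /imsetP[k' /imsetP[i iA ->]]].
  rewrite conj_permE => /perm_inj def_j; have := disjointFr dis jA.
  by rewrite def_j imset_f.
move=> k kS; have := cov (s^-1 k)%g; rewrite -sS permKV => /(_ kS).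
case/orP => /(imset_f s); first by rewrite permKV => ->.
by rewrite -conj_permE permKV => ->; rewrite orbT.
Qed.

(* s is the product of its restriction to A and of the conjugate of that
   restriction by tau. *)
Lemma even_commuting S tau A s :
    involutive tau -> [disjoint A & tau @: A] ->
    (forall k, (s k \in A) = (k \in A)) -> (forall k, s (tau k) = tau (s k)) ->
    (forall k, k \notin A -> tau k \notin A -> s k = k) ->
  odd_perm s = false.
Proof.
move=> inv dis sA com fix_s; pose a := restr_perm A s.
have sN : s \in 'N(A | 'P)%g by apply/stabP.
have aE k : k \in A -> a k = s k by move=> kA; rewrite /a restr_permE.
have aO k : k \notin A -> a k = k.
  by move=> kA; rewrite (out_perm (restr_perm_on _ _)).
have tV : tau^-1%g = tau.
  by apply/permP => k; apply: (@perm_inj _ tau); rewrite permKV inv.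
suff -> : s = (a * (a ^ tau))%g by rewrite odd_permM odd_permJ addbb.
apply/permP => k; rewrite conjgE tV !permM.
have tA j : j \in A -> tau j \notin A.
  by move=> jA; apply/negP => tjA; have := disjointFr dis tjA; rewrite imset_f.
have [kA|kA] := boolP (k \in A).
  by rewrite (aE k kA) (aO (tau _)) ?inv // tA // sA.
rewrite (aO k) //; have [tkA|tkA] := boolP (tau k \in A).
  by rewrite aE // com inv.
by rewrite (aO (tau _)) // inv fix_s.
Qed.

(** Following s by the transposition of k and [tau k], which also commutes with [tau], flips the
    sign and brings one missing representative back; once s preserves A it is even by
    [even_commuting]. *)
Lemma odd_commuting S tau A s : matching S tau -> orbit_reps S tau A ->
  perm_on S s -> (forall k, s (tau k) = tau (s k)) ->
  odd_perm s = odd #|A :\: s @: A|.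
Proof.
move=> mt tA; have inv := matchingK mt.
have [on_S _ fpf] := matchingP _ _ mt.
move: {2}#|_| (erefl #|A :\: s @: A|) => n.
elim: n s => [|n IH] s cardA Ss com.
  have AsA : A \subset s @: A by rewrite -setD_eq0 -cards_eq0 cardA.
  have sAA : s @: A = A.
    by apply/esym/eqP; rewrite eqEcard AsA (card_imset _ (@perm_inj _ s)) leqnn.
  rewrite cardA; case: tA => AS dis cov.
  apply: (even_commuting S inv dis) => // [k|k kA tkA].
    by rewrite -{1}sAA (mem_imset _ _ (@perm_inj _ s)).
  apply: (out_perm Ss); apply/negP => /cov; by rewrite (negbTE kA) (negbTE tkA).
have [k] : exists k, k \in A :\: s @: A by apply/card_gt0P; rewrite cardA.
rewrite inE => /andP[ksA kA].
have kS : k \in S by case: tA => /subsetP AS _ _; apply: AS.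
have neq : k != tau k by rewrite eq_sym fpf.
have com' j : tperm k (tau k) (tau j) = tau (tperm k (tau k) j).
  by rewrite (inj_tperm _ _ _ (@perm_inj _ tau)) inv tpermC.
have tauJ : (tau ^ s)%g = tau by apply/permP => j; rewrite conjgE !permM com permKV.
have tksA : tau k \in s @: A.
  have := orbit_repsJ Ss tA; rewrite tauJ => /(orbit_reps_tau mt)/(_ kS).
  by rewrite ksA.
have mem_tp j : (j \in (s * tperm k (tau k))%g @: A) = (tperm k (tau k) j \in s @: A).
  apply/imsetP/imsetP => [[i iA ->]|[i iA eqi]]; exists i => //.
    by rewrite permM tpermK.
  by rewrite permM -eqi tpermK.
have E : A :\: (s * tperm k (tau k))%g @: A = (A :\: s @: A) :\ k.
  apply/setP => j; rewrite !inE mem_tp; have [->|njk] := eqVneq j k.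
    by rewrite tpermL tksA.
  have [->|njt] := eqVneq j (tau k).
    by rewrite (orbit_reps_tau mt tA kS) kA !andbF.
  by rewrite tpermD // eq_sym.
have := cardsD1 k (A :\: s @: A); rewrite cardA inE ksA kA add1n => -[cardE].
have tpS : perm_on S (tperm k (tau k)).
  apply/subsetP => j; rewrite inE; apply: contraR => jS; rewrite tpermD //.
    by apply: contraNneq jS => <-.
  by apply: contraNneq jS => <-; rewrite perm_closed.
have := IH (s * tperm k (tau k))%g; rewrite E -cardE => /(_ erefl).
rewrite perm_onM // odd_permM odd_tperm neq addbT.
have com2 j : (s * tperm k (tau k))%g (tau j) = tau ((s * tperm k (tau k))%g j).
  by rewrite !permM com com'.
by move=> /(_ isT com2) /= <-; rewrite negbK.
Qed.

End Matchings.

(** * Matching tensors and their signs under permutations *)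

Section MatchingTensors.
Variables (K : fieldType) (N l : nat).
Implicit Types (s tau : 'S_N) (S A : {set 'I_N}) (k : 'I_N).
Local Notation J := (omega K l).

Lemma tr_omega : J^T = - J.
Proof. by rewrite /omega tr_block_mx !linearN /= trmx1 !trmx0 opp_block_mx !oppr0 opprK. Qed.

Lemma omegaC x y : J x y = - J y x.
Proof. by have /matrixP/(_ y x) := tr_omega; rewrite !mxE. Qed.

Definition TA A tau : tensor K N l :=
  [ffun w : word N l => \prod_(k in A) J (w k) (w (tau k))].

Definition TS S tau := TA [set k in S | k < tau k]%N tau.

Lemma T_inv_TS tau : T_inv K l tau = TS setT tau.
Proof.
by apply/ffunP => w; rewrite T_invE ffunE; apply: eq_bigl => k; rewrite !inE.
Qed.

(** Each chord whose representative end changes contributes a factor -1, by antisymmetry of the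
    form. *)
Lemma TA_change S tau A A' : matching S tau -> orbit_reps S tau A ->
  orbit_reps S tau A' -> TA A' tau = (-1) ^+ #|A :\: A'| *: TA A tau.
Proof.
move=> mt tA tA'; have inv := matchingK mt; apply/ffunP => w; rewrite !ffunE.
have AS := subsetP (let: And3 AS _ _ := tA in AS).
have AS' := subsetP (let: And3 AS _ _ := tA' in AS).
rewrite [LHS](big_setID A) [X in _ = _ *: X](big_setID A') /= [A' :&: A]setIC.
rewrite -[RHS]/((-1) ^+ _ * (_ * _)) mulrCA; congr (_ * _).
have -> : A' :\: A = tau @: (A :\: A').
  apply/setP => k; apply/idP/imsetP => [|[j]]; rewrite !inE => /andP[].
    move=> kA kA'; exists (tau k); last by rewrite inv.
    rewrite inE; have kS := AS' k kA'.
    by rewrite (orbit_reps_tau mt tA) // (orbit_reps_tau mt tA') // kA kA'.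
  move=> jA' jA ->; have jS := AS j jA.
  by rewrite (orbit_reps_tau mt tA) // (orbit_reps_tau mt tA') // jA jA'.
rewrite big_imset; last by move=> x y _ _; apply: perm_inj.
rewrite -prodr_const -big_split /=.
by apply: eq_bigr => k _; rewrite inv omegaC mulN1r.
Qed.

Lemma TA_perm A tau s : perm_act s^-1%g (TA A tau) = TA (s @: A) (tau ^ s)%g.
Proof.
apply/ffunP => w; rewrite perm_actE invgK !ffunE big_imset; last first.
  by move=> x y _ _; apply: perm_inj.
by apply: eq_bigr => k _; rewrite !ffunE conj_permE.
Qed.

(** The action of s only replaces A by its preimage under s, and the number of representatives
    changed has the parity of s by [odd_commuting]. *)
Lemma TA_commuting S A tau s : matching S tau -> orbit_reps S tau A ->
  perm_on S s -> (forall k, s (tau k) = tau (s k)) ->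
  perm_act s (TA A tau) = (-1) ^+ s *: TA A tau.
Proof.
move=> mt tA Ss com; have com' k : s^-1%g (tau k) = tau (s^-1%g k).
  by apply: (@perm_inj _ s); rewrite permKV com permKV.
have tauJ : (tau ^ s^-1)%g = tau.
  by apply/permP => k; rewrite conjgE !permM invgK -com permK.
have Ssi := perm_onV Ss; have := orbit_repsJ Ssi tA; rewrite tauJ => tsA.
rewrite -{1}(invgK s) TA_perm tauJ (TA_change mt tA tsA).
by rewrite -signr_odd -(odd_commuting mt tA Ssi com') odd_permV.
Qed.

Lemma T_inv_perm tau s : fpf_involution tau ->
  exists b : bool, perm_act s^-1%g (T_inv K l tau) = (-1) ^+ b *: T_inv K l (tau ^ s)%g.
Proof.
move=> /matchingT mt; have sT : perm_on setT s by apply/subsetP => k; rewrite inE.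
have mts := matchingJ sT mt; have tA := orbit_repsJ sT (orbit_reps_lt mt).
rewrite !T_inv_TS /TS TA_perm (TA_change mts (orbit_reps_lt mts) tA).
by rewrite -signr_odd; eexists.
Qed.

Lemma T_inv_commuting tau s : fpf_involution tau -> (forall k, s (tau k) = tau (s k)) ->
  perm_act s (T_inv K l tau) = (-1) ^+ s *: T_inv K l tau.
Proof.
move=> /matchingT mt com; rewrite T_inv_TS; apply: (TA_commuting mt (orbit_reps_lt mt)) com.
by apply/subsetP => k; rewrite inE.
Qed.

End MatchingTensors.

(** * The first fundamental theorem for Sp(2l) *)

Definition upd N l (w : word N l) (k : 'I_N) (c : 'I_(l + l)) : word N l :=
  [ffun j => if j == k then c else w j].

Section Updates.
Variables (N l : nat).
Implicit Types (w : word N l) (k j : 'I_N) (c d : 'I_(l + l)).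

Lemma updE w k c : upd w k c k = c.
Proof. by rewrite ffunE eqxx. Qed.

Lemma updO w k c j : j != k -> upd w k c j = w j.
Proof. by rewrite ffunE => /negbTE ->. Qed.

Lemma upd_upd w k c d : upd (upd w k c) k d = upd w k d.
Proof. by apply/ffunP => j; rewrite !ffunE; case: eqP. Qed.

Lemma upd_id w k : upd w k (w k) = w.
Proof. by apply/ffunP => j; rewrite !ffunE; case: eqP => [->|]. Qed.

Lemma updC w k j c d : k != j -> upd (upd w k c) j d = upd (upd w j d) k c.
Proof.
by move=> kj; apply/ffunP => i; rewrite !ffunE; case: eqP => // ->; rewrite eq_sym (negbTE kj).
Qed.

Lemma upd_eqP w w' k : reflect (w' = upd w k (w' k)) [forall j, (j != k) ==> (w' j == w j)].
Proof.
apply: (iffP forallP) => [eqw|-> j]; last by apply/implyP => jk; rewrite updO.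
apply/ffunP => j; rewrite ffunE; case: eqP => [->//|/eqP jk].
by have /implyP/(_ jk)/eqP := eqw j.
Qed.

Lemma sum_upd (R : nmodType) (F : word N l -> R) w k :
  \sum_(w' : word N l | [forall j, (j != k) ==> (w' j == w j)]) F w' =
  \sum_c F (upd w k c).
Proof.
rewrite (reindex_onto (fun c => upd w k c) (fun w' : word N l => w' k)) /=.
  apply: eq_bigl => c; rewrite updE eqxx andbT.
  by apply/upd_eqP; rewrite updE.
by move=> w' /upd_eqP.
Qed.

End Updates.

(** * Infinitesimal invariance from symplectic transvections *)

Section Infinitesimal.
Variables (K : numFieldType) (N l : nat).
Local Notation J := (omega K l).
Implicit Types (t : tensor K N l) (w : word N l).

(** In characteristic 0 the natural numbers already give more roots than the degree allows. *)
Lemma poly_const (p : {poly K}) (c : K) : (forall x, p.[x] = c) -> p = c%:P.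
Proof.
move=> pc; apply/eqP; rewrite -subr_eq0; apply/negPn/negP => nz.
set q := p - c%:P in nz.
have : (size [seq i%:R : K | i <- iota 0 (size q)] < size q)%N.
  apply: max_poly_roots => //.
    by apply/allP => x _; rewrite /root /q !hornerE pc subrr.
  rewrite map_inj_uniq ?iota_uniq // => i j /eqP; by rewrite eqr_nat => /eqP.
by rewrite size_map size_iota ltnn.
Qed.

Lemma deriv_prod_at0 (I : eqType) (r : seq I) (a b : I -> K) : uniq r ->
  (\prod_(i <- r) ((a i)%:P + b i *: 'X))^`().[0] =
  \sum_(i <- r) b i * \prod_(j <- r | j != i) a j.
Proof.
elim: r => [_|i r IH /= /andP[ir ur]]; first by rewrite !big_nil derivC horner0.
rewrite !big_cons derivM !hornerE IH // eqxx /= derivD derivC derivZ derivX !hornerE.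
congr (_ + _).
  congr (_ * _); rewrite horner_prod big_seq [RHS]big_seq_cond.
  apply: eq_big => [j|j _]; last by rewrite !hornerE.
  by case jr: (j \in r) => //=; apply/esym; apply: contraNneq ir => <-.
rewrite big_distrr /= big_seq [in RHS]big_seq; apply: eq_bigr => j jr.
rewrite big_cons; have -> : i != j by apply: contraNneq ir => ->.
by rewrite mulrCA.
Qed.

(** The derivation of the tensor space induced by the matrix X, in coordinates. *)
Definition dact (X : 'M[K]_(l + l)) t w : K :=
  \sum_k \sum_c X (w k) c * t (upd w k c).

Lemma sum_word_fix (F : word N l -> K) w k :
  \sum_(w' : word N l) F w' * \prod_(j < N | j != k) (w j == w' j)%:R =
  \sum_c F (upd w k c).
Proof.
rewrite -sum_upd [RHS]big_mkcond; apply: eq_bigr => w' _.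
case: ifP => [/forallP eqw|/negbT].
  rewrite big1 ?mulr1 // => j jk.
  by have := implyP (eqw j) jk; rewrite eq_sym => ->.
rewrite negb_forall => /existsP[j]; rewrite negb_imply => /andP[jk wj].
by rewrite (bigD1 j) //= eq_sym (negbTE wj) mul0r mulr0.
Qed.

(** Y = v v^T J squares to 0 because v^T J v = 0, so 1 + xY is the exponential of xY and is affine
    in x: a polynomial identity can replace differentiation along a one-parameter group. *)
Lemma transvection_Sp (v : 'cV[K]_(l + l)) (x : K) :
  Sp K l (1%:M + x *: (v *m v^T *m J)).
Proof.
have vJv : v^T *m J *m v = 0.
  have E : (v^T *m J *m v)^T = - (v^T *m J *m v).
    by rewrite !trmx_mul trmxK tr_omega !mulNmx !mulmxN mulmxA.
  move: E; rewrite [v^T *m J *m v]mx11_scalar tr_scalar_mx => /matrixP/(_ 0 0).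
  rewrite !mxE eqxx !mulr1n => /eqP; rewrite -addr_eq0 -mulr2n mulrn_eq0 /= => /eqP->.
  by rewrite raddf0.
set Y := v *m v^T *m J.
have YT : Y^T *m J = - (J *m Y).
  by rewrite /Y !trmx_mul trmxK tr_omega !mulNmx !mulmxA.
have YY : Y^T *m J *m Y = 0.
  rewrite YT mulNmx /Y !mulmxA -(mulmxA (J *m v) v^T J) -(mulmxA (J *m v) (v^T *m J) v).
  by rewrite vJv mulmx0 !mul0mx oppr0.
have trE : (1%:M + x *: Y)^T = 1%:M + x *: Y^T.
  by apply/matrixP => i j; rewrite !mxE eq_sym.
rewrite /Sp /mkset trE.
rewrite mulmxDl mul1mx mulmxDr mulmx1 mulmxDl -!scalemxAl -!scalemxAr YY !scaler0.
by rewrite addr0 YT scalerN addrNK.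
Qed.

(** The w-coordinate of the image of t under 1 + xY is a polynomial in x; invariance makes it
    constant, and [dact] is its derivative at 0. *)
Lemma invariants_dact t (v : 'cV_(l + l)) w :
  invariants K N l t -> dact (v *m v^T *m J) t w = 0.
Proof.
move=> inv_t; pose Y := v *m v^T *m J.
pose p := \sum_(w' : word N l) t w' *:
  \prod_(k < N) (((w k == w' k)%:R)%:P + Y (w k) (w' k) *: 'X) : {poly K}.
have pE : p = (t w)%:P.
  apply: poly_const => x; have /(congr1 (fun u : tensor K N l => u w)) := inv_t _ (transvection_Sp v x).
  rewrite /tensor_pow sum_ffunE => <-; rewrite /p horner_sum.
  apply: eq_bigr => w' _; rewrite !ffunE hornerZ horner_prod; congr (_ * _).
  apply: eq_bigr => k _; rewrite !hornerE [RHS]mxE.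
  rewrite (bigD1 (w' k)) //= [X in _ = _ + X]big1 => [|c ck]; last first.
    by rewrite [X in _ * X]mxE (negbTE ck) mulr0.
  rewrite addr0 [X in _ = _ * X]mxE !eqxx mulr1 [RHS]mxE.
  by rewrite [X in _ = X + _]mxE [X in _ = _ + X]mxE mulrC.
have := congr1 (fun q => q^`().[0]) pE; rewrite derivC horner0 /p.
rewrite raddf_sum horner_sum => E; rewrite -[RHS]E {E}.
under eq_bigr => w' _ do rewrite /= derivZ hornerZ deriv_prod_at0 ?index_enum_uniq // mulr_sumr.
rewrite exchange_big; apply: eq_bigr => k _ /=.
transitivity (\sum_c Y (w k) (upd w k c k) * t (upd w k c)).
  by apply: eq_bigr => c _; rewrite updE.
rewrite -(sum_word_fix (fun w' => Y (w k) (w' k) * t w')).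
by apply: eq_bigr => w' _; rewrite mulrA [t w' * _]mulrC.
Qed.

End Infinitesimal.

(** * The Casimir identity *)

Section Casimir.
Variables (K : numFieldType) (N l : nat).
Local Notation J := (omega K l).
Implicit Types (t : tensor K N l) (w : word N l) (S : {set 'I_N}) (k j : 'I_N).

Lemma omega_orth x y : \sum_b J b x * J b y = (x == y)%:R.
Proof.
have E : J^T *m J = 1%:M.
  rewrite tr_omega mulNmx /omega mulmx_block !mul0mx !mulmx0 !mul1mx !mulmx1.
  by rewrite !addr0 !add0r opp_block_mx oppr0 opprK -scalar_mx_block.
have /matrixP/(_ x y) := E; rewrite !mxE => <-.
by apply: eq_bigr => b _; rewrite !mxE.
Qed.

Lemma sum_delta (I : finType) (a : I) (F : I -> K) : \sum_x (x == a)%:R * F x = F a.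
Proof.
rewrite (bigD1 a) //= big1 => [|x /negbTE ->]; last by rewrite mul0r.
by rewrite eqxx mul1r addr0.
Qed.

Lemma sum_delta' (I : finType) (a : I) (F : I -> K) : \sum_x (a == x)%:R * F x = F a.
Proof. by rewrite -[RHS]sum_delta; apply: eq_bigr => x _; rewrite eq_sym. Qed.

(** The factor at k is transformed by J; as J is orthogonal, [sum_cJ] undoes this. *)
Definition cJ t k b w : K := \sum_c J b c * t (upd w k c).

Lemma cJ_upd t k b w c : cJ t k b (upd w k c) = cJ t k b w.
Proof. by apply: eq_bigr => d _; rewrite upd_upd. Qed.

Lemma sum_cJ t k c w : \sum_b J b c * cJ t k b w = t (upd w k c).
Proof.
under eq_bigr do rewrite mulr_sumr; rewrite exchange_big /=.
rewrite -(sum_delta' c (fun d => t (upd w k d))); apply: eq_bigr => d _.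
by rewrite -omega_orth mulr_suml; apply: eq_bigr => b _; rewrite mulrA.
Qed.

(* The infinitesimal form of invariance, restricted to the tensor factors in S:
   the symmetric matrices (E_ab + E_ba) J span the Lie algebra of Sp(2l). *)
Definition inv_on S t := forall a b w,
  \sum_(k in S) ((w k == a)%:R * cJ t k b w + (w k == b)%:R * cJ t k a w) = 0.

(** Polarization: the transvections show that the quadratic form with coefficients [Q x y] vanishes
    at every v, and its values at the vectors e_c + e_d leave Q a b + Q b a = 0. *)
Lemma inv_on_invariants t : invariants K N l t -> inv_on setT t.
Proof.
move=> inv_t a b w; pose Q x y := \sum_k (w k == x)%:R * cJ t k y w.
have Qv (v : 'cV_(l + l)) : \sum_x \sum_y v x 0 * (v y 0 * Q x y) = 0.
  rewrite -[RHS](invariants_dact v w inv_t) /dact.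
  transitivity (\sum_k v (w k) 0 * \sum_y v y 0 * cJ t k y w).
    transitivity (\sum_x \sum_k (w k == x)%:R * (v x 0 * \sum_y v y 0 * cJ t k y w)).
      apply: eq_bigr => x _; under [RHS]eq_bigr do rewrite !mulr_sumr.
      rewrite exchange_big /=; apply: eq_bigr => y _; rewrite /Q !mulr_sumr.
      by apply: eq_bigr => k _; rewrite (mulrCA (v y 0)) (mulrCA (v x 0)).
    by rewrite exchange_big /=; apply: eq_bigr => k _; rewrite /= sum_delta'.
  apply: eq_bigr => k _; rewrite mulr_sumr.
  under eq_bigr => y _ do rewrite mulr_sumr mulr_sumr.
  rewrite exchange_big; apply: eq_bigr => c _ /=.
  rewrite mxE mulr_suml; apply: eq_bigr => y _.
  rewrite [in RHS]mxE big_ord1 !mxE; rewrite !mulrA; congr (_ * _).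
have Qd (c d : 'I_(l + l)) : Q c c + Q c d + (Q d c + Q d d) = 0.
  rewrite -[RHS](Qv (\col_i ((i == c)%:R + (i == d)%:R))).
  transitivity (\sum_x ((x == c)%:R + (x == d)%:R) * (Q x c + Q x d)).
    under eq_bigr do rewrite mulrDl; rewrite big_split /= !sum_delta.
    by [].
  apply: eq_bigr => x _; rewrite mxE -mulr_sumr; congr (_ * _).
  under eq_bigr do rewrite mxE mulrDl; rewrite big_split /= !sum_delta.
  by [].
have Q0 c : Q c c = 0.
  have := Qd c c; rewrite -!mulr2n => /eqP.
  by rewrite !mulrn_eq0 /= => /eqP.
have := Qd a b; rewrite !Q0 add0r addr0 => E; rewrite -[RHS]E /Q -big_split /=.
by apply: eq_bigl => k; rewrite inE.
Qed.

(** Contraction with the form inside the same tensor space: the result is constant in the letters at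
    k and j ([con_upd]), and only the set of positions with known invariance shrinks. *)
Definition con k j t : tensor K N l :=
  [ffun w : word N l => \sum_a \sum_c J a c * t (upd (upd w k a) j c)].

(* On inv_on S the quadratic Casimir of Sp(2l) expresses cas S by contractions
   (casE); moreover cas S is |S| plus a sum of operators A^*A, hence injective
   (cas_inj). *)
Definition cas S t : tensor K N l :=
  [ffun w : word N l => ((l + l).+1 * #|S|)%:R * t w +
    \sum_(k in S) \sum_(j in S | j != k) t (wperm w (tperm k j))].

Lemma wperm_tperm w k j : k != j ->
  wperm w (tperm k j) = upd (upd w k (w j)) j (w k).
Proof.
move=> kj; apply/ffunP => i; rewrite !ffunE; case: tpermP => [->|->|/eqP ik /eqP ij].
- by rewrite (negbTE kj) eqxx.
- by rewrite eqxx.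
- by rewrite (negbTE ik) (negbTE ij).
Qed.

(** For each k the relation [inv_on] is taken at w with letter a put at k, weighted by [J b (w k)]
    and summed over a and b. The terms j = k give multiples of t, the others a transposition and a
    contraction. *)
Lemma casE S t w : inv_on S t ->
  cas S t w = - \sum_(k in S) \sum_(j in S | j != k) J (w j) (w k) * con k j t w.
Proof.
move=> inv_t; apply/eqP; rewrite -addr_eq0 ffunE; apply/eqP.
pose I k j := \sum_a \sum_b J b (w k) * ((upd w k a j == a)%:R * cJ t j b (upd w k a)
  + (upd w k a j == b)%:R * cJ t j a (upd w k a)).
transitivity (\sum_(k in S) \sum_(j in S) I k j); last first.
  apply: big1 => k kS; rewrite /I exchange_big big1 //= => a _.
  by rewrite exchange_big big1 //= => b _; rewrite -mulr_sumr inv_t mulr0.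
(* The first summand returns [t w] once for each of the 2l letters a, the second once in all; hence
   2l + 1. *)
have Idiag k : I k k = (l + l).+1%:R * t w.
  rewrite /I; transitivity (\sum_(a < l + l) (t w + J a (w k) * cJ t k a w)).
    apply: eq_bigr => a _; under eq_bigr => b _ do rewrite updE eqxx mul1r !cJ_upd mulrDr.
    rewrite big_split /= sum_cJ upd_id; congr (_ + _).
    rewrite -(sum_delta' a (fun b => J b (w k) * cJ t k a w)).
    by apply: eq_bigr => b _; rewrite mulrCA.
  rewrite big_split /= sumr_const card_ord sum_cJ upd_id.
  by rewrite -natr1 mulrDl mul1r mulr_natl.
have Ioff k j : j != k -> I k j =
    t (wperm w (tperm k j)) + J (w j) (w k) * con k j t w.
  move=> jk; rewrite /I.
  under eq_bigr => a _ do under eq_bigr => b _ do rewrite !(updO _ _ jk) mulrDr.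
  under eq_bigr => a _ do rewrite big_split /=; rewrite big_split /=; congr (_ + _).
    transitivity (\sum_a (w j == a)%:R * \sum_b J b (w k) * cJ t j b (upd w k a)).
      apply: eq_bigr => a _; rewrite mulr_sumr; apply: eq_bigr => b _; exact: mulrCA.
    by rewrite sum_delta' sum_cJ wperm_tperm // eq_sym.
  rewrite ffunE mulr_sumr; apply: eq_bigr => a _.
  rewrite -(sum_delta' (w j) (fun b => J b (w k) * cJ t j a (upd w k a))).
  by apply: eq_bigr => b _; rewrite mulrCA.
transitivity (\sum_(k in S) ((l + l).+1%:R * t w +
  \sum_(j in S | j != k) (t (wperm w (tperm k j)) + J (w j) (w k) * con k j t w))).
  rewrite big_split /= sumr_const -mulrnAl -mulrnA -addrA; congr (_ + _).
  by rewrite -big_split /=; apply: eq_bigr => k _; rewrite -big_split.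
apply: eq_bigr => k kS; rewrite [RHS](bigD1 k) //= Idiag; congr (_ + _).
by apply: eq_bigr => j /andP[_ jk]; rewrite Ioff.
Qed.

(** When the relation for S is contracted at k and j, the summands of k and j cancel because J is
    antisymmetric, and the others form the relation for the contraction. *)
Lemma inv_on_con S t k j : inv_on S t -> k \in S -> j \in S -> j != k ->
  inv_on (S :\ k :\ j) (con k j t).
Proof.
move=> inv_t kS jS jk a b w.
pose G i w' := (w' i == a)%:R * cJ t i b w' + (w' i == b)%:R * cJ t i a w'.
pose V x y := t (upd (upd w k x) j y).
pose H i := \sum_x \sum_y J x y * G i (upd (upd w k x) j y).
have sumH : \sum_(i in S) H i = 0.
  rewrite /H exchange_big big1 //= => x _; rewrite exchange_big big1 //= => y _.
  by rewrite -mulr_sumr [X in _ * X]inv_t mulr0.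
have Hk : H k = \sum_x \sum_y (J a y * J b x + J b y * J a x) * V x y.
  rewrite /H exchange_big [RHS]exchange_big /=; apply: eq_bigr => y _.
  have kj : k != j by rewrite eq_sym.
  have cE c x : cJ t k c (upd (upd w k x) j y) = \sum_d J c d * V d y.
    by apply: eq_bigr => d _; rewrite (updC _ _ _ (jk : j != k)) upd_upd.
  transitivity (\sum_x ((x == a)%:R * (J x y * \sum_d J b d * V d y)
     + (x == b)%:R * (J x y * \sum_d J a d * V d y))).
    apply: eq_bigr => x _; rewrite /G !cE (updO _ _ kj) updE mulrDr.
    by congr (_ + _); rewrite mulrCA.
  rewrite big_split /= !sum_delta !mulr_sumr -big_split.
  by apply: eq_bigr => d _; rewrite !mulrA mulrDl.
have Hj : H j = - H k.
  rewrite Hk -sumrN /H; apply: eq_bigr => x _.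
  have cE c y : cJ t j c (upd (upd w k x) j y) = \sum_d J c d * V x d.
    by apply: eq_bigr => d _; rewrite upd_upd.
  transitivity (\sum_y ((y == a)%:R * (J x y * \sum_d J b d * V x d)
     + (y == b)%:R * (J x y * \sum_d J a d * V x d))).
    apply: eq_bigr => y _; rewrite /G !cE updE mulrDr.
    by congr (_ + _); rewrite mulrCA.
  rewrite big_split /= !sum_delta !mulr_sumr -big_split -sumrN /=.
  apply: eq_bigr => d _; rewrite [J x a]omegaC [J x b]omegaC.
  by rewrite !mulNr -opprD mulrDl addrC; congr (- (_ + _)); rewrite mulrCA mulrA.
rewrite (big_setD1 k) //= (big_setD1 j) /= in sumH; last by rewrite !inE jk.
rewrite Hj addrA subrr add0r in sumH; rewrite -[RHS]sumH.
apply: eq_bigr => i; rewrite !inE => /and3P[ij ik iS].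
have cE c : cJ (con k j t) i c w = \sum_x \sum_y J x y * cJ t i c (upd (upd w k x) j y).
  rewrite /cJ; under eq_bigr do rewrite ffunE mulr_sumr; rewrite exchange_big.
  apply: eq_bigr => x _; under eq_bigr do rewrite mulr_sumr; rewrite exchange_big.
  apply: eq_bigr => y _; rewrite mulr_sumr; apply: eq_bigr => d _.
  have ji : j != i by rewrite eq_sym.
  have ki : k != i by rewrite eq_sym.
  by rewrite mulrCA (updC _ _ _ ji) (updC w x d ki).
rewrite !cE /H !mulr_sumr -big_split; apply: eq_bigr => x _ /=.
rewrite !mulr_sumr -big_split; apply: eq_bigr => y _ /=.
by rewrite /G !(updO _ _ ij) !(updO _ _ ik) mulrDr; congr (_ + _); rewrite mulrCA.
Qed.

End Casimir.

(** * Positivity of the Casimir operator *)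

Section Positivity.
Variables (K : numClosedFieldType) (N l : nat).
Implicit Types (t : tensor K N l) (w : word N l) (S : {set 'I_N}) (k j : 'I_N).

Lemma sum_word_swap (F : word N l -> 'I_(l + l) -> K) k :
  \sum_(w : word N l) \sum_c F w c = \sum_(w : word N l) \sum_c F (upd w k c) (w k).
Proof.
rewrite !pair_bigA /=.
rewrite (reindex_inj (h := fun p : word N l * 'I_(l + l) => (upd p.1 k p.2, p.1 k))) //.
apply: (can_inj (g := fun p => (upd p.1 k p.2, p.1 k))) => -[w c] /=.
by rewrite upd_upd upd_id updE.
Qed.

(** The derivation induced by the matrix unit E_ab on the factors in S. *)
Definition mode_sum S t a b w : K := \sum_(k in S) (w k == a)%:R * t (upd w k b).

Lemma mode_sum_sqr S t a b w : `|mode_sum S t a b w| ^+ 2 =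
  \sum_(k in S) \sum_(j in S) (w k == a)%:R *
    ((w j == a)%:R * (t (upd w k b) * (t (upd w j b))^*)).
Proof.
rewrite normCK /mode_sum mulr_suml; apply: eq_bigr => k _.
rewrite rmorph_sum mulr_sumr; apply: eq_bigr => j _ /=.
by rewrite rmorphM /= conjC_nat mulrACA -mulrA.
Qed.

(** This is the Casimir of gl(2l): terms k = j give 2l per factor, and for k != j summing over a
    imposes equal letters at k and j, which exchanges with the running letter b into a
    transposition. It falls short of [cas] by |S| times t, and this gap makes [cas] strictly
    positive. *)
Lemma mode_sum_norm S t :
  \sum_a \sum_b \sum_(w : word N l) `|mode_sum S t a b w| ^+ 2 =
  \sum_(w : word N l) (((l + l) * #|S|)%:R * t w +
    \sum_(k in S) \sum_(j in S | j != k) t (wperm w (tperm k j))) * (t w)^*.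
Proof.
pose I k j := \sum_(w : word N l) \sum_b (w k == w j)%:R * (t (upd w k b) * (t (upd w j b))^*).
transitivity (\sum_(k in S) \sum_(j in S) I k j).
  transitivity (\sum_(w : word N l) \sum_b \sum_(k in S) \sum_(j in S)
    (w k == w j)%:R * (t (upd w k b) * (t (upd w j b))^*)).
    under eq_bigr do rewrite exchange_big; rewrite exchange_big /=.
    apply: eq_bigr => w _; rewrite exchange_big; apply: eq_bigr => b _ /=.
    under eq_bigr do rewrite mode_sum_sqr.
    rewrite exchange_big; apply: eq_bigr => k _ /=.
    rewrite exchange_big; apply: eq_bigr => j _ /=.
    by rewrite sum_delta' eq_sym.
  rewrite /I; under eq_bigr do rewrite exchange_big /=.
  rewrite exchange_big; apply: eq_bigr => k _ /=.
  under eq_bigr do rewrite exchange_big /=.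
  by rewrite exchange_big.
have Idiag k : I k k = (l + l)%:R * \sum_(w : word N l) t w * (t w)^*.
  rewrite /I (sum_word_swap _ k) mulr_sumr; apply: eq_bigr => w _.
  under eq_bigr do rewrite eqxx mul1r upd_upd upd_id.
  by rewrite sumr_const card_ord mulr_natl.
have Ioff k j : j != k -> I k j = \sum_(w : word N l) t (wperm w (tperm k j)) * (t w)^*.
  move=> jk; have kj : k != j by rewrite eq_sym.
  rewrite /I (sum_word_swap _ j); apply: eq_bigr => w _.
  under eq_bigr => c _ do rewrite updE (updO _ _ kj) upd_upd upd_id.
  by rewrite sum_delta' wperm_tperm // updC.
transitivity (\sum_(k in S) ((l + l)%:R * (\sum_(w : word N l) t w * (t w)^*) +
  \sum_(j in S | j != k) \sum_(w : word N l) t (wperm w (tperm k j)) * (t w)^*)).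
  apply: eq_bigr => k kS; rewrite (bigD1 k) //= Idiag; congr (_ + _).
  by apply: eq_bigr => j /andP[_ jk]; rewrite Ioff.
under [RHS]eq_bigr do rewrite mulrDl.
rewrite !big_split /= sumr_const; congr (_ + _).
  rewrite -mulrnAl -mulrnA mulr_sumr.
  by apply: eq_bigr => w _; rewrite mulrA.
under [RHS]eq_bigr do rewrite mulr_suml.
rewrite exchange_big; apply: eq_bigr => k _ /=.
under [RHS]eq_bigr do rewrite mulr_suml.
by rewrite exchange_big.
Qed.

Lemma cas_inj S t : S != set0 -> cas S t = 0 -> t = 0.
Proof.
move=> S0 cas0; have S_gt0 : (0 < #|S|)%N by rewrite card_gt0.
have E : \sum_(w : word N l) cas S t w * (t w)^* = 0.
  by rewrite big1 // => w _; rewrite cas0 ffunE mul0r.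
have E2 : #|S|%:R * (\sum_(w : word N l) `|t w| ^+ 2) +
    \sum_a \sum_b \sum_(w : word N l) `|mode_sum S t a b w| ^+ 2 = 0.
  rewrite -[RHS]E mode_sum_norm mulr_sumr -big_split; apply: eq_bigr => w _ /=.
  rewrite normCK ffunE mulrA -mulrDl addrA -mulrDl; congr ((_ * _ + _) * _).
  by rewrite -natrD mulSn.
have pos1 : 0 <= \sum_(w : word N l) `|t w| ^+ 2.
  by apply: sumr_ge0 => w _; rewrite exprn_ge0.
have pos2 : 0 <= \sum_a \sum_b \sum_(w : word N l) `|mode_sum S t a b w| ^+ 2.
  by do 3!apply: sumr_ge0 => ? _; rewrite exprn_ge0.
move/eqP: E2; rewrite paddr_eq0 ?mulr_ge0 // => /andP[+ _].
rewrite mulf_eq0 pnatr_eq0 -leqn0 leqNgt S_gt0 /= psumr_eq0 => [/allP t0|w _]; last first.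
  by rewrite exprn_ge0.
apply/ffunP => w; rewrite ffunE; have := t0 w (mem_index_enum _).
by rewrite expf_eq0 normr_eq0 /= => /eqP.
Qed.

End Positivity.

Lemma span_preserved (K : fieldType) (vT wT : vectType K) (f : {linear vT -> wT})
    (X : seq vT) (U : {vspace wT}) :
  (forall x, x \in X -> f x \in U) -> forall x, x \in <<X>>%VS -> f x \in U.
Proof.
move=> fX x xX; pose g := linfun f.
have /subvP sub : (<<X>> <= g @^-1: U)%VS.
  by apply/span_subvP => y yX; rewrite -memv_preim lfunE fX.
by have := sub x xX; rewrite -memv_preim lfunE.
Qed.

(** By dimension f maps U onto U, so f x has a preimage in U, which injectivity identifies with
    x. *)
Lemma memv_linear_inj (K : fieldType) (vT : vectType K) (f : {linear vT -> vT})
    (U : {vspace vT}) :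
  (forall x, f x = 0 -> x = 0) -> (forall x, x \in U -> f x \in U) ->
  forall x, f x \in U -> x \in U.
Proof.
move=> f_inj fU x fxU; pose g := linfun f.
have ker0 : lker g = 0%VS.
  apply/eqP; rewrite -subv0; apply/subvP => y; rewrite memv_ker lfunE memv0.
  by move=> /eqP/f_inj ->.
have imU : (g @: U)%VS = U.
  apply/eqP; rewrite eqEdim limg_dim_eq ?ker0 ?capv0 // leqnn andbT.
  by apply/subvP => _ /memv_imgP[y yU ->]; rewrite lfunE fU.
have : f x \in (g @: U)%VS by rewrite imU.
case/memv_imgP => y yU; rewrite lfunE => /eqP; rewrite -subr_eq0 -linearB.
by move=> /eqP/f_inj/eqP; rewrite subr_eq0 => /eqP ->.
Qed.

(** * Spans of partial matching tensors *)

Section MatchingSpans.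
Variables (K : numFieldType) (N l : nat).
Implicit Types (t : tensor K N l) (w u : word N l) (S : {set 'I_N}) (k j : 'I_N).
Implicit Types (tau s : 'S_N).

(* The matching tensor of tau on the factors in S, tensored with the basis vectors
   e_(u k) on the other factors. *)
Definition partial_T S tau u : tensor K N l :=
  [ffun w : word N l => TS K l S tau w * [forall j, (j \notin S) ==> (w j == u j)]%:R].

Lemma partial_TE S tau u w : partial_T S tau u w =
  TS K l S tau w * [forall j, (j \notin S) ==> (w j == u j)]%:R.
Proof. exact: ffunE. Qed.

Definition partial_span S : {vspace tensor K N l} :=
  <<[seq partial_T S p.1 p.2 | p <- enum [pred p : 'S_N * word N l | matching S p.1]]>>%VS.

Lemma partial_T_mem S tau u : matching S tau -> partial_T S tau u \in partial_span S.
Proof.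
move=> mt; apply: memv_span; apply/mapP; exists (tau, u) => //.
by rewrite mem_enum inE.
Qed.

Lemma partial_span_ind S (f : {linear tensor K N l -> tensor K N l}) (U : {vspace tensor K N l}) :
  (forall tau u, matching S tau -> f (partial_T S tau u) \in U) ->
  forall t, t \in partial_span S -> f t \in U.
Proof.
move=> fU t; apply: span_preserved => x /mapP[[tau u]].
by rewrite mem_enum inE /= => mt ->; apply: fU.
Qed.

Lemma partial_T_perm S tau u s : matching S tau -> perm_on S s ->
  perm_act s^-1%g (partial_T S tau u) \in partial_span S.
Proof.
move=> mt Ss; have mts := matchingJ Ss mt.
have tA := orbit_repsJ Ss (orbit_reps_lt mt).
suff [n ->] : exists n, perm_act s^-1%g (partial_T S tau u) =
    (-1) ^+ n *: partial_T S (tau ^ s)%g u.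
  by rewrite memvZ // partial_T_mem.
have := TA_perm K l [set k in S | k < tau k]%N tau s.
rewrite (TA_change K l mts (orbit_reps_lt mts) tA).
move=> E; eexists; apply/ffunP => w; rewrite perm_actE invgK [RHS]ffunE !partial_TE.
have -> : [forall j, (j \notin S) ==> (wperm w s j == u j)] =
          [forall j, (j \notin S) ==> (w j == u j)].
  apply: eq_forallb => j; case jS: (j \in S) => //=.
  by rewrite ffunE (out_perm Ss) // jS.
have := congr1 (fun t : tensor K N l => t w) E.
rewrite perm_actE invgK [RHS]ffunE => ->; apply/esym; exact: scalerAl.
Qed.

Lemma cas_sum S t : cas S t = ((l + l).+1 * #|S|)%:R *: t +
  \sum_(k in S) \sum_(j in S | j != k) perm_act (tperm k j) t.
Proof.
apply/ffunP => w; rewrite !ffunE; congr (_ + _).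
rewrite sum_ffunE; apply: eq_bigr => k _; rewrite sum_ffunE; apply: eq_bigr => j _.
by rewrite perm_actE tpermV.
Qed.

Lemma cas_is_linear S : linear (@cas K N l S).
Proof.
move=> a t t'; rewrite !cas_sum scalerDr scalerDr scalerA mulrC -scalerA addrACA.
congr (_ + _); rewrite scaler_sumr -big_split; apply: eq_bigr => k _ /=.
rewrite scaler_sumr -big_split; apply: eq_bigr => j _ /=.
by rewrite linearP.
Qed.
HB.instance Definition _ S := GRing.isLinear.Build K (tensor K N l)
  (tensor K N l) _ (@cas K N l S) (@cas_is_linear S).

Lemma cas_partial_span S t : t \in partial_span S -> cas S t \in partial_span S.
Proof.
apply: partial_span_ind => tau u mt; rewrite /= cas_sum memvD //.
  by rewrite memvZ // partial_T_mem.
apply: memv_suml => k kS; apply: memv_suml => j /andP[jS _].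
rewrite -tpermV; apply: partial_T_perm => //.
apply/subsetP => i; rewrite inE; apply: contraR => iS.
by rewrite tpermD //; apply: contraNneq iS => <-.
Qed.

(** On a contraction, which ignores the letters at k and j, freezing them at [a0] changes nothing.
    On a [partial_T] for the smaller set it frees the two letters prescribed by u, so that the
    result is a multiple of a partial matching tensor for the larger set. *)
Definition insert (k j : 'I_N) (a0 : 'I_(l + l)) t : tensor K N l :=
  [ffun w : word N l => omega K l (w j) (w k) * t (upd (upd w k a0) j a0)].

Lemma insert_is_linear k j a0 : linear (insert k j a0).
Proof.
move=> a t t'; apply/ffunP => w; rewrite !ffunE mulrDr; congr (_ + _).
exact: mulrCA.
Qed.
HB.instance Definition _ k j a0 := GRing.isLinear.Build K (tensor K N l)
  (tensor K N l) _ (insert k j a0) (insert_is_linear k j a0).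

(** The chord between k and j is added to [tau]; if u does not carry [a0] at both positions, the
    result is 0. *)
Lemma insert_partial_T S k j a0 tau u : k \in S -> j \in S -> j != k ->
  matching (S :\ k :\ j) tau ->
  insert k j a0 (partial_T (S :\ k :\ j) tau u) \in partial_span S.
Proof.
move=> kS jS jk mt; have kj : k != j by rewrite eq_sym.
set S' := S :\ k :\ j in mt *; have [on_S' _ fpf] := matchingP _ _ mt.
have inv := matchingK mt; have kS' : k \notin S' by rewrite !inE eqxx andbF.
have jS' : j \notin S' by rewrite !inE eqxx.
have [tk tj] : tau k = k /\ tau j = j by rewrite !(out_perm on_S').
pose tau' := (tau * tperm k j)%g.
have t'k : tau' k = j by rewrite permM tk tpermL.
have t'j : tau' j = k by rewrite permM tj tpermR.
have t'S' i : i \in S' -> tau' i = tau i.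
  move=> iS'; rewrite permM tpermD //.
    by apply: contraNneq kS' => ->; rewrite perm_closed.
  by apply: contraNneq jS' => ->; rewrite perm_closed.
have SE i : (i \in S) = [|| i == k, i == j | i \in S'].
  rewrite !inE; have [->|ik] := eqVneq i k; first by rewrite kS.
  by have [->|ij] := eqVneq i j; first by rewrite jS.
have mt' : matching S tau'.
  apply/matchingP; split.
  - apply/subsetP => i; rewrite inE; apply: contraR => iS.
    have iS' : i \notin S' by apply: contra iS => iS'; rewrite SE iS' !orbT.
    rewrite permM (out_perm on_S' iS') tpermD //.
      by apply: contraNneq iS => <-.
    by apply: contraNneq iS => <-.
  - move=> i; rewrite SE => /or3P[/eqP->|/eqP->|iS'].
    + by rewrite t'k t'j.
    + by rewrite t'j t'k.
    + by rewrite (t'S' i) // t'S' ?inv // perm_closed.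
  move=> i; rewrite SE => /or3P[/eqP->|/eqP->|iS'].
  - by rewrite t'k.
  - by rewrite t'j.
  - by rewrite t'S' // fpf.
pose A' := [set i in S' | i < tau i]%N.
have tA' := orbit_reps_lt mt; rewrite -/A' in tA'.
have A'S' i : i \in A' -> i \in S' by rewrite inE => /andP[].
have tA : orbit_reps S tau' (k |: A').
  split.
  - by apply/subsetP => i; rewrite !inE => /orP[/eqP->//|/andP[/andP[_ /andP[]]]].
  - apply/pred0P => i /=; apply/negP => /andP[+ /imsetP[i' + def_i]].
    rewrite !in_setU1 => /orP[/eqP ik|iA] /orP[/eqP i'k|i'A].
    + by move: jk; rewrite -t'k -i'k -def_i ik i'k eqxx.
    + have i'S := A'S' _ i'A; case/negP: kS'; by rewrite -[k]ik def_i t'S' // perm_closed.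
    + by move: jS'; rewrite -t'k -i'k -def_i A'S'.
    + have i'S := A'S' _ i'A; move: iA; rewrite def_i t'S' //.
      by rewrite (orbit_reps_tau mt tA') // i'A.
  move=> i; rewrite SE !in_setU1 => /or3P[->//|/eqP->|iS'].
    by rewrite t'j eqxx orbT.
  have [_ _ /(_ i iS')] := tA'; rewrite t'S' // => /orP[->|->]; by rewrite !orbT.
have E w : TA K l (k |: A') tau' w = omega K l (w k) (w j) * TS K l S' tau w.
  rewrite ffunE big_setU1 /=; last by apply: contra kS' => /A'S'.
  rewrite t'k ffunE; congr (_ * _); apply: eq_bigr => i /A'S' iS'.
  by rewrite t'S'.
have [/andP[/eqP uk /eqP uj]|neq] := boolP ((u k == a0) && (u j == a0)); last first.
  rewrite (_ : insert _ _ _ _ = 0) ?mem0v //; apply/ffunP => w; rewrite [LHS]ffunE [RHS]ffunE partial_TE.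
  case: forallP => [eqw|_]; last by rewrite mulr0 mulr0.
  case/negP: neq; have /implyP/(_ kS') := eqw k; have /implyP/(_ jS') := eqw j.
  by rewrite updE (updO _ _ kj) updE ![a0 == _]eq_sym => -> ->.
have -> : insert k j a0 (partial_T S' tau u) =
    - ((-1) ^+ #|(k |: A') :\: [set i in S | i < tau' i]%N| *: partial_T S tau' u).
  apply/ffunP => w; rewrite [LHS]ffunE [RHS]ffunE [X in - X]ffunE !partial_TE.
  have -> : [forall i, (i \notin S') ==> (upd (upd w k a0) j a0 i == u i)] =
            [forall i, (i \notin S) ==> (w i == u i)].
    apply: eq_forallb => i; rewrite SE; have [->|ij] := eqVneq i j.
      by rewrite updE uj eqxx orbT implybT.
    rewrite (updO _ _ ij); have [->|ik] := eqVneq i k.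
      by rewrite updE uk eqxx implybT.
    by rewrite (updO _ _ ik).
  have := congr1 (fun t : tensor K N l => t w)
    (TA_change K l mt' tA (orbit_reps_lt mt')).
  rewrite -/(TS K l S tau') [X in _ = X]ffunE E => ->.
  have -> : TS K l S' tau (upd (upd w k a0) j a0) = TS K l S' tau w.
    rewrite [LHS]ffunE [RHS]ffunE; apply: eq_bigr => i; rewrite inE => /andP[iS' _].
    have neq h : h \in S' -> (h != j) && (h != k).
      by move=> hS'; apply/andP; split; apply: contraTneq hS' => ->.
    have /andP[ij ik] := neq i iS'.
    have /andP[tij tik] : (tau i != j) && (tau i != k) by rewrite neq // perm_closed.
    by rewrite !(updO _ _ ij) !(updO _ _ ik) !(updO _ _ tij) !(updO _ _ tik).
  rewrite omegaC -[_ *: (_ * _)]/(_ * (_ * _)) -[X in _ * (X * _)]/(_ * _).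
  by rewrite -mulrA -signr_odd signrMK !mulNr mulrA.
by rewrite memvN memvZ // partial_T_mem.
Qed.

Lemma con_upd k j t w a c : j != k ->
  con k j t (upd (upd w k a) j c) = con k j t w.
Proof.
move=> jk; rewrite !ffunE; apply: eq_bigr => x _; apply: eq_bigr => y _.
by rewrite (updC _ _ _ jk) !upd_upd.
Qed.

End MatchingSpans.

Section FirstFundamentalTheorem.
Variables (K : numClosedFieldType) (N l : nat).

Lemma inv_on_partial_span (S : {set 'I_N}) (t : tensor K N l) :
  inv_on S t -> t \in partial_span K l S.
Proof.
have [n] := ubnP #|S|; elim: n => // n IH in S t * => ltS inv_t.
have [S0|S0] := eqVneq S set0.
  have mt1 : matching S 1%g.
    by rewrite S0; apply/matchingP; split=> [|k|k]; rewrite ?perm_on1 ?inE.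
  have -> : t = \sum_(u : word N l) t u *: partial_T K S 1%g u.
    apply/ffunP => w; rewrite sum_ffunE (bigD1 w) //= [X in _ + X]big1 => [|u neq].
      rewrite addr0 ffunE partial_TE [TS _ _ _ _ _]ffunE big1 ?mul1r; last first.
        by move=> k; rewrite inE S0 inE.
      rewrite (_ : [forall j, _] = true); first by apply/esym/mulr1.
      by apply/forallP => j; rewrite eqxx implybT.
    rewrite ffunE partial_TE; case: forallP => [eqw|_]; last first.
      by rewrite mulr0; apply: mulr0.
    case/eqP: neq; apply/ffunP => j; apply/esym/eqP.
    by apply: (implyP (eqw j)); rewrite S0 inE.
  by apply: memv_suml => u _; rewrite memvZ // partial_T_mem.
apply: (memv_linear_inj (f := @cas K N l S)) => [x|x|].
- exact: cas_inj.
- exact: cas_partial_span.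
(* [w0] only supplies letters to freeze; if there is no word at all, the tensor space is 0. *)
rewrite /=; case: (pickP (predT : pred (word N l))) => [w0 _|none]; last first.
  by rewrite (_ : cas S t = 0) ?mem0v //; apply/ffunP => w; have := none w.
have -> : cas S t =
    - \sum_(k in S) \sum_(j in S | j != k) insert k j (w0 k) (con k j t).
  apply/ffunP => w; rewrite (casE w inv_t) [RHS]ffunE sum_ffunE; congr (- _).
  apply: eq_bigr => k _; rewrite sum_ffunE; apply: eq_bigr => j /andP[_ jk].
  by rewrite [RHS]ffunE con_upd.
rewrite memvN; apply: memv_suml => k kS; apply: memv_suml => j /andP[jS jk].
apply: (@partial_span_ind K N l (S :\ k :\ j) (insert k j (w0 k))) => [tau u mt|].
  exact: insert_partial_T.
apply: IH; last exact: inv_on_con.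
have := cardsD1 k S; rewrite kS add1n => cardS; rewrite cardS in ltS.
have := cardsD1 j (S :\ k); rewrite !inE jk jS add1n => cardSk.
by rewrite cardSk ltnS in ltS; apply: ltnW.
Qed.

Lemma invariants_span (t : tensor K N l) : invariants K N l t ->
  t \in <<[seq T_inv K l tau | tau <- enum (matching [set: 'I_N])]>>%VS.
Proof.
move=> /inv_on_invariants/inv_on_partial_span; move: t.
apply/subvP/span_subvP => x /mapP[[tau u]]; rewrite mem_enum inE /= => mt ->.
apply: memv_span.
apply/mapP; exists tau; first by rewrite mem_enum.
apply/ffunP => w; rewrite partial_TE -T_inv_TS (_ : [forall j, _] = true) ?mulr1 //.
by apply/forallP => j; rewrite inE.
Qed.

End FirstFundamentalTheorem.

(** * Invariance of matching tensors *)

Section Invariance.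
Variables (K : numFieldType) (N l : nat).

(** Over each chord the action of U produces an entry of U J U^T; distributing the product over the
    chords across the sums over pairs of letters gives the sum over words. *)
Lemma T_inv_invariant tau : fpf_involution tau -> invariants K N l (T_inv K l tau).
Proof.
move=> tau_inv U UJU; apply/ffunP => w; rewrite T_invE.
rewrite /tensor_pow sum_ffunE.
transitivity (\sum_(w' : word N l)
  (\prod_(k < N | (k < tau k)%N) omega K l (w' k) (w' (tau k))) * \prod_(k < N) U (w k) (w' k)).
  apply: eq_bigr => w' _; rewrite [LHS]ffunE T_invE; congr (_ * _).
  rewrite ffunE; apply: eq_bigr => k _; rewrite mxE (bigD1 (w' k)) //= big1 => [|c ck].
    by rewrite mxE !eqxx addr0 mulr1.
  by rewrite [X in _ * X]mxE (negbTE ck) mulr0.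
have mt : matching setT tau by apply/matchingT.
have inv := matchingK mt; have tA := orbit_reps_lt mt.
pose A := [set k : 'I_N in setT | (k < tau k)%N]; rewrite -/A in tA.
have AE (k : 'I_N) : (k < tau k)%N = (k \in A) by rewrite !inE.
have tau_A k : (tau k \in A) = (k \notin A) by rewrite (orbit_reps_tau mt tA) ?inE.
(* [Sp] is defined by U^T J U = J; the transposed identity holds because a left inverse of a square
   matrix is a right inverse. *)
have UJU' : U *m omega K l *m U^T = omega K l.
  have JJ : omega K l *m omega K l = - 1%:M.
    apply/matrixP => x y; rewrite !mxE -omega_orth -sumrN; apply: eq_bigr => b _.
    by rewrite [omega K l x b]omegaC mulNr.
  have LU : (- (omega K l *m U^T *m omega K l)) *m U = 1%:M.
    by rewrite mulNmx -!mulmxA (mulmxA U^T) UJU JJ opprK.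
  have := congr1 (fun X => X *m omega K l) (mulmx1C LU).
  rewrite mul1mx mulmxN mulNmx !mulmxA -(mulmxA _ (omega K l) (omega K l)) JJ.
  by rewrite mulmxN mulmx1 opprK.
(* N = 0 is set apart because a letter is needed below as default value off A. *)
case: (pickP 'I_N) => [k0 _|none]; last first.
  rewrite (big_pred1 w) => [|w'].
    by rewrite [RHS](_ : _ = 1) ?[X in X * _](_ : _ = 1) ?mul1r;
      rewrite big1 // => k; have := none k.
  by apply/esym/eqP/ffunP => k; have := none k.
pose c0 := w k0.
pose G k (p : 'I_(l + l) * 'I_(l + l)) := U (w k) p.1 * omega K l p.1 p.2 * U (w (tau k)) p.2.
transitivity (\prod_(k in A) \sum_p G k p); last first.
  apply: eq_big => [k|k _]; first by rewrite AE.
  have /matrixP/(_ (w k) (w (tau k))) := UJU'; rewrite !mxE => <-.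
  rewrite -(pair_bigA _ (fun a c => G k (a, c))) /= exchange_big /=.
  apply: eq_bigr => c _; rewrite !mxE mulr_suml; apply: eq_bigr => a _.
  by [].
rewrite (big_distr_big (c0, c0)).
pose h (f : {ffun 'I_N -> 'I_(l + l) * 'I_(l + l)}) : word N l :=
  [ffun k => if k \in A then (f k).1 else (f (tau k)).2].
pose h' (w' : word N l) := [ffun k => if k \in A then (w' k, w' (tau k)) else (c0, c0)].
rewrite (reindex_onto h h') /=; last first.
  move=> w' _; apply/ffunP => k; rewrite !ffunE tau_A.
  by case: (boolP (k \in A)) => // kA; rewrite inv.
apply: eq_big => [f|f _].
  apply/eqP/pffun_onP => [<-|[/supportP f0 _]].
    split=> [|? _]; last by [].
    by apply/supportP => k kA; rewrite ffunE (negbTE kA).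
  apply/ffunP => k; rewrite !ffunE tau_A; case: (boolP (k \in A)) => kA.
    by rewrite /= inv; case: (f k).
  by rewrite f0.
rewrite (eq_bigl _ _ AE) [X in _ * X](bigID (mem A)) /=.
rewrite [X in _ * (_ * X)](reindex_inj (@perm_inj _ tau)) /=.
rewrite [X in _ * (_ * X)](eq_bigl (mem A)) => [|k]; last by rewrite tau_A negbK.
rewrite -!big_split; apply: eq_bigr => k kA /=.
by rewrite !ffunE tau_A kA /= inv mulrA [omega K l _ _ * _]mulrC.
Qed.

End Invariance.

(** * Colored matchings and multisets *)

Section ColoredMatchings.
Variables (N : nat) (T : eqType) (c : 'I_N -> T).
Implicit Types (S : {set 'I_N}) (k j : 'I_N) (s : 'S_N) (f : 'I_N -> 'I_N).

Definition matching_on S f :=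
  [/\ {in S, forall k, f k \in S}, {in S, forall k, f (f k) = k}
    & {in S, forall k, f k != k}].

Definition pair_count S f x y := #|[set k in S | (c k == x) && (c (f k) == y)]|.

Lemma matching_on_fpf S tau : fpf_involution tau -> {in S, forall k, tau k \in S} ->
  matching_on S tau.
Proof. by move=> H tS; split=> // k _; case: (H k) => // _ /eqP. Qed.

Lemma pair_count_conj S f s : perm_on S s -> (forall k, c (s k) = c k) ->
  forall x y, pair_count S (fun k => s (f (s^-1 k)%g)) x y = pair_count S f x y.
Proof.
move=> Ss cs x y; rewrite /pair_count -[RHS](card_imset _ (@perm_inj _ s)).
apply: eq_card => k; rewrite -[k in RHS](permKV s) mem_imset; last exact: perm_inj.
rewrite !inE cs -[in LHS](permKV s k) (perm_closed _ Ss) cs.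
by rewrite permK.
Qed.

Lemma pair_countD1 S f k x y : k \in S -> pair_count S f x y =
  (((c k == x) && (c (f k) == y)) + pair_count (S :\ k) f x y)%N.
Proof.
move=> kS; rewrite /pair_count (cardsD1 k) inE kS /=; congr (_ + _)%N.
by apply: eq_card => j; rewrite !inE andbA.
Qed.

Lemma matching_onD S f k : matching_on S f -> k \in S -> matching_on (S :\ k :\ f k) f.
Proof.
move=> [fS inv fpf] kS; split=> j; rewrite !inE => /and3P[jf jk jS].
- rewrite fS // andbT; apply/andP; split.
    by apply: contra_neq jk => e; rewrite -(inv j jS) e inv.
  by apply: contra_neq jf => e; rewrite -(inv j jS) e.
- exact: inv.
- exact: fpf.
Qed.

(** Two transpositions within color classes carry a chord of f' with the colors of the chord from k
    to f k onto that chord, which is then removed from both matchings. The color type is left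
    general: it is used with block colors and also with pairs of a color and a letter. *)
Lemma matching_conj S f f' : matching_on S f -> matching_on S f' ->
    (forall x y, pair_count S f x y = pair_count S f' x y) ->
  exists s, [/\ perm_on S s, forall k, c (s k) = c k & {in S, forall k, f' (s k) = s (f k)}].
Proof.
have [n] := ubnP #|S|; elim: n => // n IH in S f' * => ltS mf mf' eq_count.
have [S0|[k kS]] := set_0Vmem S.
  by exists 1%g; split=> [|k|k]; rewrite ?perm_on1 ?perm1 // S0 inE.
have [fS inv fpf] := mf; have [fS' inv' fpf'] := mf'.
have jS := fS k kS; set j := f k in jS *.
have kj : k != j by rewrite eq_sym fpf.
have [k2] : exists k2, k2 \in [set i in S | (c i == c k) && (c (f' i) == c j)].
  apply/card_gt0P; rewrite -[#|_|]/(pair_count S f' (c k) (c j)) -eq_count.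
  by apply/card_gt0P; exists k; rewrite inE kS !eqxx.
rewrite inE => /and3P[k2S /eqP ck2 /eqP cfk2].
(* The partner of [k2] after the first transposition; it differs from [f' k2] only if that partner
   is k. *)
pose x := tperm k2 k (f' k2); pose s0 := (tperm k2 k * tperm x j)%g.
have tperm_on a b : a \in S -> b \in S -> perm_on S (tperm a b).
  move=> aS bS; apply/subsetP => i; rewrite inE; apply: contraR => iS.
  by rewrite tpermD //; apply: contraNneq iS => <-.
have c_tperm a b i : c a = c b -> c (tperm a b i) = c i.
  by move=> cab; case: tpermP => [->|->|].
have xS : x \in S by rewrite /x (perm_closed _ (tperm_on _ _ k2S kS)) fS'.
have cx : c x = c j by rewrite /x c_tperm.
have xk : x != k.
  by rewrite /x -{2}(tpermL k2 k) (inj_eq perm_inj) fpf'.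
have s0S : perm_on S s0 by rewrite perm_onM // tperm_on.
have cs0 i : c (s0 i) = c i by rewrite permM !c_tperm.
have s0k2 : s0 k2 = k by rewrite permM tpermL tpermD // eq_sym.
have s0fk2 : s0 (f' k2) = j by rewrite permM -/x tpermL.
have s0Vk : (s0^-1 k)%g = k2 by rewrite -s0k2 permK.
have s0Vj : (s0^-1 j)%g = f' k2 by rewrite -s0fk2 permK.
have s0VS := perm_onV s0S.
pose f2 i := s0 (f' (s0^-1 i)%g).
have f2k : f2 k = j by rewrite /f2 s0Vk s0fk2.
have f2j : f2 j = k by rewrite /f2 s0Vj inv' // s0k2.
have mf2 : matching_on S f2.
  split=> i iS; rewrite /f2.
  - by rewrite (perm_closed _ s0S) fS' // (perm_closed _ s0VS).
  - by rewrite permK inv' ?permKV // (perm_closed _ s0VS).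
  by rewrite -{2}(permKV s0 i) (inj_eq perm_inj) fpf' // (perm_closed _ s0VS).
have mfD := matching_onD mf kS; have := matching_onD mf2 kS; rewrite f2k => mf2D.
have jSk : j \in S :\ k by rewrite !inE jS eq_sym kj.
have [||s1 [s1S cs1 com1]] := IH (S :\ k :\ j) f2 _ mfD mf2D.
- have := cardsD1 k S; rewrite kS add1n => cardS; rewrite cardS in ltS.
  by have := cardsD1 j (S :\ k); rewrite jSk add1n => cardSk; rewrite cardSk ltnS in ltS; apply: ltnW.
- move=> a b; have := eq_count a b; rewrite -(pair_count_conj f' s0S cs0) -/f2.
  rewrite (pair_countD1 f _ _ kS) (pair_countD1 f2 _ _ kS) f2k => /addnI.
  rewrite (pair_countD1 f _ _ jSk) (pair_countD1 f2 _ _ jSk) f2j inv // => /addnI.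
  by [].
have sub i : i \in S :\ k :\ j -> i \in S by rewrite !inE => /and3P[].
have s1k : s1 k = k by rewrite (out_perm s1S) // !inE eqxx andbF.
have s1j : s1 j = j by rewrite (out_perm s1S) // !inE eqxx.
exists (s1 * s0^-1)%g; split=> [|i|i iS].
- rewrite perm_onM //; apply: subset_trans s1S _; apply/subsetP; exact: sub.
- by rewrite permM -cs0 permKV cs1.
rewrite !permM; have [->|ik] := eqVneq i k; first by rewrite s1k s0Vk -/j s1j s0Vj.
have [->|ij] := eqVneq i j; first by rewrite s1j s0Vj inv' // inv // s1k s0Vk.
have iD : i \in S :\ k :\ j by rewrite !inE ij ik.
by apply: (@perm_inj _ s0); rewrite permKV -com1.
Qed.

End ColoredMatchings.

(** * Matchings not killed by the symmetrizer *)

Section Admissible.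
Variables (K : numFieldType) (N l : nat) (T : eqType) (e : 'I_N -> T) (od : pred T).
Implicit Types (tau s : 'S_N) (k j : 'I_N).
Local Notation symm := (symm (K := K) (l := l) e od).
Local Notation chi := (chi K e od).

(** With the tail as an even color, these conditions amount to compatibility of M together with the
    rule that decides which diagonal pairs are split through infinity. *)
Definition admissible tau :=
  [/\ fpf_involution tau, forall k, e k = e (tau k) -> od (e k)
    & forall k j, e k = e j -> e (tau k) = e (tau j) -> od (e k) -> ~~ od (e (tau k)) -> k = j].

(** s acts on the tensor by its sign and on the symmetrization by [chi s]; as these are opposite,
    twice the symmetrization vanishes. *)
Lemma symm_T_inv0 tau s : fpf_involution tau -> young e s ->
  (forall k, s (tau k) = tau (s k)) -> chi s = - (-1) ^+ s -> symm (T_inv K l tau) = 0.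
Proof.
move=> ft Ys com chi_s; have := @symm_perm K N l T e od s (T_inv K l tau) Ys.
rewrite T_inv_commuting // linearZ chi_s scaleNr => /eqP.
rewrite -subr_eq0 opprK -mulr2n -scaler_nat scalerA => /eqP E.
apply/eqP; have /eqP := E; rewrite scaler_eq0 mulf_eq0 signr_eq0 pnatr_eq0 /=.
by [].
Qed.

Lemma young_tperm k j : e k = e j -> young e (tperm k j).
Proof. by move=> ekj; apply/youngP => i; case: tpermP => [->|->|]. Qed.

Lemma tperm_commute tau k i : involutive tau ->
  tperm k (tau k) (tau i) = tau (tperm k (tau k) i).
Proof. by move=> inv; rewrite (inj_tperm _ _ _ (@perm_inj _ tau)) inv tpermC. Qed.

(** Witnesses for [symm_T_inv0]: a chord within an even color is reversed by a transposition of sign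
    -1 and [chi] 1; two parallel chords from an odd to an even color are exchanged by two
    transpositions, of total sign 1 and [chi] -1. *)
Lemma symm_neq0_admissible tau : fpf_involution tau -> symm (T_inv K l tau) != 0 ->
  admissible tau.
Proof.
move=> ft nz; have inv : involutive tau by move=> k; case: (ft k).
have fpf k : tau k != k by apply/eqP; case: (ft k).
split=> // [k ek|k j ekj etkj odk odtk].
  apply: contraNT nz => odk; apply/eqP.
  apply: (symm_T_inv0 ft (young_tperm ek)) => [i|]; first exact: tperm_commute.
  rewrite odd_tperm eq_sym fpf opprK chi_fix // => i; rewrite inE => odi.
  by rewrite tpermD //; apply: contraNneq odk => def_i; rewrite -def_i // -ek in odi.
apply/eqP; apply: contraNT nz => kj; apply/eqP.
have tkj : tau k != tau j by rewrite (inj_eq perm_inj).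
have odN a b : od (e a) -> ~~ od (e b) -> a != b.
  by move=> oa; apply: contraNneq => <-.
have odj : od (e j) by rewrite -ekj.
have odtj : ~~ od (e (tau j)) by rewrite -etkj.
apply: (symm_T_inv0 (s := (tperm k j * tperm (tau k) (tau j))%g) ft) => [|i|].
- by apply: youngM; apply: young_tperm.
- have aE h : tperm k j (tau h) = tau (tperm (tau k) (tau j) h).
    by rewrite (inj_tperm _ _ _ (@perm_inj _ tau)) !inv.
  have bE h : tperm (tau k) (tau j) (tau h) = tau (tperm k j h).
    by rewrite (inj_tperm _ _ _ (@perm_inj _ tau)).
  rewrite !permM aE bE (inj_tperm _ _ _ (@perm_inj _ (tperm k j))).
  have -> : tperm k j (tau k) = tau k by rewrite tpermD // odN.
  by have -> : tperm k j (tau j) = tau j by rewrite tpermD // odN.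
rewrite odd_permM !odd_tperm kj tkj chiM ?young_tperm //.
rewrite (@chi_on_odd K N T e od [set k; j]) ?odd_tperm ?kj; last first.
- apply/subsetP => i; rewrite !inE; apply: contraR; rewrite negb_or => /andP[ik ij].
  by rewrite tpermD // eq_sym.
- by apply/subsetP => i; rewrite !inE => /orP[] /eqP ->.
rewrite chi_fix ?mulr1 // => i; rewrite inE => odi.
by rewrite tpermD // eq_sym odN.
Qed.

End Admissible.

(** * Multiplicities of the multiset with infinity *)

Section MsetCounts.
Local Open Scope mset_scope.
Variable (W : set nat).
Implicit Types (M : {mset nat * nat}) (i j : nat).

Lemma fixed_pointsE M i j : fixed_points W M (i, j) =
  if i == j then (if i \in W then nat_of_bool (odd (M (i, i))) else M (i, i)) else 0%N.
Proof.
rewrite /fixed_points fsfunE /=; case: eqP => [->|_]; last by rewrite if_same.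
rewrite msuppE in_mset; case: (posnP (M (j, j))) => [->|//].
by rewrite if_same.
Qed.

Lemma fixed_points_le M i j : (fixed_points W M (i, j) <= M (i, j))%N.
Proof.
rewrite fixed_pointsE; case: eqP => [->|//]; case: ifP => // _.
by case: (M (j, j)) => [|n] //; case: (odd _).
Qed.

Definition hat_count M (x y : option nat) : nat :=
  match x, y with
  | Some i, Some j => M (i, j) - fixed_points W M (i, j)
  | Some i, None | None, Some i => fixed_points W M (i, i)
  | None, None => 0
  end.

Lemma count_diag (A : {mset nat * nat}) i : (forall p, p \in A -> p.1 = p.2) ->
  (count (fun p => p.1 == i) A = A (i, i)) * (count (fun p => p.2 == i) A = A (i, i)).
Proof.
move=> diag; rewrite -count_mem_mset; split; apply: eq_in_count => -[a c] /diag /= ->;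
  by rewrite xpair_eqE andbb.
Qed.

Lemma mhatE M x y : mhat W M (x, y) = hat_count M x y.
Proof.
set F := fixed_points W M.
have diag p : p \in F -> p.1 = p.2.
  case: p => a c; rewrite in_mset fixed_pointsE /=.
  by case: eqP => [->|].
have count0 (a : pred (nat * nat)) r : a =1 pred0 -> count a r = 0%N.
  by move=> a0; rewrite (eq_count a0) count_pred0.
rewrite /mhat -/F !msetE2 !mset_seqE !count_map.
have -> : count (preim (fun p : nat * nat => (Some p.1, Some p.2)) (pred1 (x, y))) (M `\` F)
    = if (x, y) is (Some i, Some j) then (M `\` F) (i, j) else 0%N.
  case: x y => [i|] [j|]; last 3 first.
  - by apply: count0 => p; rewrite /= xpair_eqE andbF.
  - by apply: count0 => p.
  - by apply: count0 => p.
  by rewrite -count_mem_mset; apply: eq_count; case.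
have -> : count (preim (fun p : nat * nat => (Some p.1, None)) (pred1 (x, y))) F
    = if (x, y) is (Some i, None) then F (i, i) else 0%N.
  case: x y => [i|] [j|].
  - by apply: count0 => p; rewrite /= xpair_eqE andbF.
  - by rewrite -(count_diag i diag).1; apply: eq_count => p; rewrite /= xpair_eqE andbT.
  - by apply: count0 => p.
  - by apply: count0 => p.
have -> : count (preim (fun p : nat * nat => (None, Some p.2)) (pred1 (x, y))) F
    = if (x, y) is (None, Some j) then F (j, j) else 0%N.
  case: x y => [i|] [j|].
  - by apply: count0 => p.
  - by apply: count0 => p.
  - by rewrite -(count_diag j diag).2; apply: eq_count => p.
  - by apply: count0 => p; rewrite /= xpair_eqE andbF.
by case: x y => [i|] [j|]; rewrite /= ?msetE2 ?addn0.
Qed.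

End MsetCounts.

(** * Admissible matchings and symmetric multisets *)

Section Profile.
Local Open Scope mset_scope.
Variables (N : nat) (W : set nat) (nu : seq nat) (b : nat).
Hypothesis sN : (sumn nu + b = N)%N.
Implicit Types (tau s : 'S_N) (k : 'I_N) (M : {mset nat * nat}) (i j : nat).
Local Notation e := (@color N nu).
Local Notation od := (odd_color W).
Local Notation adm := (admissible e od).

Definition cnt tau x y := pair_count e [set: 'I_N] tau x y.

Lemma cntE tau x y : cnt tau x y = count (fun k => (e k == x) && (e (tau k) == y)) (enum 'I_N).
Proof.
rewrite /cnt /pair_count -size_filter cardsE cardE; congr size.
rewrite {1}/enum_mem enumT; apply: eq_filter => k.
by rewrite /= unfold_in in_setT.
Qed.

Lemma realizesP tau M : realizes W nu tau M <->
  fpf_involution tau /\ forall x y, hat_count W M x y = cnt tau x y.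
Proof.
have cE x y : cnt tau x y = seq_mset [seq (e k, e (tau k)) | k <- enum 'I_N] (x, y).
  by rewrite mset_seqE count_map cntE; apply: eq_count => k; rewrite /= xpair_eqE.
split=> [[ft hatM]|[ft eqc]]; split=> //.
  by move=> x y; rewrite cE -hatM mhatE.
by apply/msetP => -[x y]; rewrite mhatE eqc cE.
Qed.

Definition cnum k := if e k is Some i then i else 0%N.
Definition cpart tau k := if e (tau k) is Some j then j else cnum k.

(* The multiset M realized by tau: a position k matched with infinity is read as
   the fixed point (cnum k, cnum k), hence the default value in cpart. *)
Definition profile tau : {mset nat * nat} :=
  seq_mset [seq (cnum k, cpart tau k) | k <- enum 'I_N & e k].

Lemma someE (T : eqType) (x y : T) : (Some x == Some y) = (x == y).
Proof. by []. Qed.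

Lemma profileE tau i j :
  profile tau (i, j) = (cnt tau (Some i) (Some j) + (i == j) * cnt tau (Some i) None)%N.
Proof.
rewrite mset_seqE count_map count_filter !cntE.
have [<-|ij] := eqVneq i j.
  rewrite mul1n -[RHS]count_predUI [X in (_ + X)%N](eq_count (a2 := pred0)).
    rewrite count_pred0 addn0; apply: eq_count => k /=.
    rewrite xpair_eqE /cpart /cnum; case: (e k) => [a|]; last by rewrite andbF.
    case: (e (tau k)) => [c|]; rewrite /= ?someE ?andbT ?andbF ?orbF //.
    by rewrite andbb.
  by move=> k /=; case: (e k) (e (tau k)) => [a|] [c|]; rewrite ?andbF.
rewrite mul0n addn0; apply: eq_count => k /=.
rewrite xpair_eqE /cpart /cnum; case: (e k) => [a|]; last by rewrite andbF.
case: (e (tau k)) => [c|]; rewrite /= ?someE ?andbT ?andbF //.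
by case: eqVneq => // ->; rewrite (negbTE ij).
Qed.

Lemma cnt_sym tau x y : fpf_involution tau -> cnt tau x y = cnt tau y x.
Proof.
move=> ft; rewrite /cnt /pair_count -(card_imset _ (@perm_inj _ tau)).
have inv k : tau (tau k) = k by case: (ft k).
apply: eq_card => k; rewrite -[k in LHS]inv mem_imset; last exact: perm_inj.
by rewrite !inE inv /= andbC.
Qed.

(** A chord with both ends of color x is counted from each end. *)
Lemma cnt_even tau x : fpf_involution tau -> ~~ odd (cnt tau x x).
Proof.
move=> ft; have mt : matching setT tau by apply/matchingT.
have inv := matchingK mt.
have [A tA] : exists A, orbit_reps setT tau A by eexists; apply: orbit_reps_lt.
set D := [set k in setT | (e k == x) && (e (tau k) == x)].
have -> : cnt tau x x = #|D| by [].
have Dt k : (tau k \in D) = (k \in D) by rewrite !inE inv /= andbC.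
rewrite -(cardsID A D).
have -> : D :\: A = tau @: (D :&: A).
  apply/setP => k; rewrite -[k in RHS]inv mem_imset; last exact: perm_inj.
  by rewrite in_setD in_setI Dt (orbit_reps_tau mt tA) ?inE // andbC.
by rewrite card_imset ?addnn ?odd_double //; apply: perm_inj.
Qed.

Lemma card_color i : #|[set k : 'I_N | e k == Some i]| = nth 0%N nu i.
Proof.
rewrite -(card_block i sN); apply: eq_card => k.
by rewrite [LHS]inE colorP.
Qed.

Lemma card_color_None : #|[set k : 'I_N | e k == None]| = b.
Proof.
have -> : [set k : 'I_N | e k == None] = ~: [set k : 'I_N | (k < sumn nu)%N].
  by apply/setP => k; rewrite !inE color_None leqNgt.
have := cardsC [set k : 'I_N | (k < sumn nu)%N]; rewrite card_ord -[in RHS]sN.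
suff -> : #|[set k : 'I_N | (k < sumn nu)%N]| = sumn nu by move/addnI.
have le : (sumn nu <= N)%N by rewrite -sN leq_addr.
have w_inj : injective (widen_ord le) by move=> x y [/val_inj].
rewrite -[RHS]card_ord -(card_imset _ w_inj); apply: eq_card => k.
rewrite inE; apply/idP/imsetP => [lt|[j _ ->]]; last exact: (ltn_ord j).
by exists (Ordinal lt) => //; apply: val_inj.
Qed.

Lemma admissible_counts tau : adm tau ->
  [/\ cnt tau None None = 0%N,
      forall i, i \notin W -> cnt tau (Some i) (Some i) = 0%N
    & forall x y, od x -> ~~ od y -> (cnt tau x y <= 1)%N].
Proof.
move=> [ft sam mix]; split=> [|i iW|x y ox oy].
- apply/eqP; rewrite cards_eq0; apply/eqP/setP => k; rewrite !inE /=.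
  apply/negP => /andP[/eqP ek /eqP etk].
  by have := sam k; rewrite ek etk => /(_ erefl).
- apply/eqP; rewrite cards_eq0; apply/eqP/setP => k; rewrite !inE /=.
  apply/negP => /andP[/eqP ek /eqP etk].
  by have := sam k; rewrite ek etk => /(_ erefl) /=; apply/negP.
apply/card_le1_eqP => k j; rewrite !inE /= => /andP[/eqP ek /eqP etk] /andP[/eqP ej /eqP etj].
by apply: mix; rewrite ?ek ?etk ?ej ?etj.
Qed.

Lemma counts_admissible tau : fpf_involution tau -> cnt tau None None = 0%N ->
  (forall i, i \notin W -> cnt tau (Some i) (Some i) = 0%N) ->
  (forall x y, od x -> ~~ od y -> (cnt tau x y <= 1)%N) -> adm tau.
Proof.
move=> ft c0 ci c1; split=> // [k ek|k j ek etk ok otk].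
  have := ek; case: {2 3}(e k) (erefl (e k)) => [i|] eki eti /=; last first.
    move/eqP: c0; rewrite cards_eq0 => /eqP/setP/(_ k).
    by rewrite !inE eki -eti.
  apply/negPn/negP; rewrite eki /= => iW.
  move/eqP: (ci i iW); rewrite cards_eq0 => /eqP/setP/(_ k).
  by rewrite !inE eki -eti eqxx.
have /card_le1_eqP := c1 (e k) (e (tau k)) ok otk.
by apply; rewrite !inE /= -?ek -?etk !eqxx.
Qed.

(** For an even color, all diagonal pairs come from chords to infinity. For an odd color, inner
    chords contribute an even number and at most one chord goes to infinity, so parity detects
    it. *)
Lemma admissible_fixed tau i j : adm tau ->
  fixed_points W (profile tau) (i, j) = ((i == j) * cnt tau (Some i) None)%N.
Proof.
move=> adm_t; have [_ c0 c1] := admissible_counts adm_t.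
have [ft _ _] := adm_t.
rewrite fixed_pointsE !profileE eqxx mul1n; case: eqP => // _.
case: ifP => iW; last by rewrite c0 ?iW // mul1n.
rewrite oddD (negbTE (cnt_even _ ft)) /= mul1n.
by have := c1 (Some i) None iW isT; case: (cnt _ _ _) => [|[]].
Qed.

Lemma admissible_realizes tau : adm tau -> realizes W nu tau (profile tau).
Proof.
move=> adm_t; have [ft _ _] := adm_t; have [cN _ _] := admissible_counts adm_t.
apply/realizesP; split=> // -[i|] [j|] /=; rewrite ?cN // ?admissible_fixed // ?eqxx ?mul1n //.
  by rewrite profileE addnK.
by rewrite cnt_sym.
Qed.

Lemma admissible_MSW tau : adm tau -> MSW W nu b (profile tau).
Proof.
move=> adm_t; have [ft _ _] := adm_t; have [cN _ c1] := admissible_counts adm_t.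
split.
- by move=> i j; rewrite !profileE cnt_sym // eq_sym; case: eqP => // ->.
- move=> i j ij; rewrite profileE; have [eij|_] := eqVneq i j; first by rewrite eij eqxx in ij.
  rewrite mul0n addn0; have [iW|iW] := boolP (i \in W).
    by apply: c1 => //=; move: ij; rewrite iW; case: (j \in W).
  by rewrite cnt_sym //; apply: c1 => //=; move: ij; rewrite (negbTE iW); case: (j \in W).
- move=> i; have /seq.permP -> := perm_eq_seq_mset [seq (cnum k, cpart tau k) | k <- enum 'I_N & e k].
  rewrite count_map count_filter -card_color -size_filter cardE; congr size.
  rewrite {2}/enum_mem enumT; apply: eq_filter => k.
  by rewrite /= inE /cnum; case: (e k) => [a|]; rewrite ?andbT ?andbF.
have -> : fixed_points W (profile tau) =
    seq_mset [seq (cnum k, cnum k) | k <- enum 'I_N & e (tau k) == None].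
  apply/msetP => -[i j]; rewrite admissible_fixed // mset_seqE count_map count_filter cntE.
  have [->|ij] := eqVneq i j.
    rewrite mul1n; apply: eq_count => k /=; rewrite xpair_eqE andbb.
    rewrite /cnum; case ek: (e k) => [a|] //=.
    case: (e (tau k) =P None) => [etk|]; last by rewrite andbF.
    move: cN => /eqP; rewrite cards_eq0 => /eqP/setP/(_ k).
    by rewrite !inE ek etk.
  rewrite mul0n; apply/esym/eqP; rewrite -leqn0 leqNgt -has_count; apply/hasP => -[k _] /=.
  by rewrite xpair_eqE => /andP[/andP[/eqP -> /eqP ij']]; rewrite ij' eqxx in ij.
have /perm_size -> := perm_eq_seq_mset [seq (cnum k, cnum k) | k <- enum 'I_N & e (tau k) == None].
rewrite size_map -card_color_None -(card_imset _ (@perm_inj _ tau)) cardE; congr size.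
rewrite {2}/enum_mem enumT; apply: eq_filter => k.
have inv (j : 'I_N) : tau (tau j) = j by case: (ft j).
by rewrite /= -[k in RHS]inv mem_imset ?inE //; apply: perm_inj.
Qed.

(** The multiset determines all color counts, so [tau] inherits admissibility from compatibility,
    and its profile merges the split fixed points again. *)
Lemma realizes_profile tau M : MSW W nu b M -> realizes W nu tau M ->
  adm tau /\ profile tau = M.
Proof.
move=> [symM comM _ _] /realizesP[ft hatM].
have PM : profile tau = M.
  apply/msetP => -[i j]; rewrite profileE -!hatM /=.
  case: eqP => [->|/eqP ij]; first by rewrite mul1n subnK // fixed_points_le.
  by rewrite mul0n addn0 fixed_pointsE (negbTE ij) subn0.
split=> //; apply: counts_admissible => // [|i iW|].
- by rewrite -hatM.
- by rewrite -hatM /= fixed_pointsE eqxx (negbTE iW) subnn.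
case=> [i|//] [j|] iW jW; rewrite -hatM /=.
  apply: leq_trans (leq_subr _ _) _; apply: comM.
  by move: iW jW => /= -> /negbTE ->.
by rewrite fixed_pointsE eqxx ifT //; case: (odd _).
Qed.

(** The source of well-definedness up to sign: two choices of matching for M differ by a Young
    element, which changes the symmetrized tensor by a sign. *)
Lemma realizes_conj tau tau' M : realizes W nu tau M -> realizes W nu tau' M ->
  exists2 s, young e s & tau' = (tau ^ s)%g.
Proof.
move=> /realizesP[ft hat] /realizesP[ft' hat'].
have [||x y|s [_ es com]] := @matching_conj N _ e setT tau tau'.
- by apply: matching_on_fpf => // k _; rewrite inE.
- by apply: matching_on_fpf => // k _; rewrite inE.
- by rewrite -[LHS]hat hat'.
exists s; first by apply/youngP.
by apply/permP => k; rewrite -(permKV s k) com ?inE // conj_permE.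
Qed.

End Profile.

(** * Straightening *)

Section Chains.
Variable (W : set nat).
Implicit Types (p q : nat * nat) (M : {mset nat * nat}%mset).

Lemma dec_step_trans : transitive (dec_step W).
Proof.
move=> q p r /and4P[pq1 qp2 w1 w2] /and4P[qr1 rq2 w3 w4].
rewrite /dec_step (leq_trans pq1 qr1) (leq_trans rq2 qp2) /=.
apply/andP; split; apply/implyP => /eqP pr.
  have /eqP pq : p.1 == q.1 by rewrite eqn_leq pq1 pr.
  by apply: (implyP w1); rewrite pq.
have /eqP pq : p.2 == q.2 by rewrite eqn_leq qp2 -pr andbT in rq2 *.
by apply: (implyP w2); rewrite pq.
Qed.

Definition comparable_pts p q := dec_step W p q || dec_step W q p.

Lemma comparable_ptsC p q : comparable_pts p q = comparable_pts q p.
Proof. exact: orbC. Qed.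

Lemma pairwise_neq (T : eqType) (r : rel T) (s : seq T) : pairwise r s ->
  {in s &, forall x y, x != y -> r x y || r y x}.
Proof.
elim: s => [//|z s IH] /= /andP[/allP rz pw] x y; rewrite !inE.
case/predU1P => [->|xs] /predU1P[->|ys] nxy; first by rewrite eqxx in nxy.
- by rewrite rz.
- by rewrite rz ?orbT.
exact: IH.
Qed.

Lemma pairwise_count (T : eqType) (r : rel T) (s : seq T) x : pairwise r s ->
  (1 < count_mem x s)%N -> r x x.
Proof.
elim: s => [//|z s IH] /= /andP[/allP rz pw]; case: eqP => [<-|_]; last exact: IH.
by rewrite add1n ltnS -has_count has_pred1; apply: rz.
Qed.

Lemma ell_dec_max M m : has_decreasing W M m -> (m <= ell_dec W M)%N.
Proof. by move=> decm; rewrite /ell_dec; case: ex_maxnP => x _; apply. Qed.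

Lemma ell_decP M : exists2 s, decreasing_in W M s & size s = ell_dec W M.
Proof.
by rewrite /ell_dec; case: ex_maxnP => x /asboolP[s [decs sz]] _; exists s.
Qed.

Variables (I : finType) (D : pred I) (pt : I -> nat * nat) (M : {mset nat * nat}%mset).
Hypothesis defM : M = seq_mset [seq pt k | k <- enum I & D k].

(** Multiplicity is carried by distinct positions over one point; these are comparable only if both
    coordinates lie in W, the condition for repeating an element of a decreasing sequence. *)
Definition dec_chain (X : {set I}) :=
  {in X, forall k, D k} /\ {in X &, forall k j, k != j -> comparable_pts (pt k) (pt j)}.

(** A decreasing sequence respects multiplicities, hence lifts to distinct positions; transitivity
    makes all its members comparable, not only neighbors. *)
Lemma dec_chain_ex : exists2 X, dec_chain X & #|X| = ell_dec W M.
Proof.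
have [s [sorted_s sub_s] <-] := ell_decP M.
have /count_subseqP[s' s's2 perm_s] :
    forall x, (count_mem x s <= count_mem x [seq pt k | k <- enum I & D k])%N.
  by move=> x; rewrite -!mset_seqE -defM; apply: (msubsetP sub_s).
have [m sz_m def_s'] := subseqP s's2; rewrite -map_mask in def_s'.
set r := mask m _ in def_s'.
have ur : uniq r by rewrite mask_uniq // filter_uniq // enum_uniq.
exists [set k in r].
  split=> [k|k j]; rewrite !inE; first by move/mem_mask; rewrite mem_filter => /andP[].
  move=> kr jr kj; have pw : pairwise (dec_step W) s.
    by rewrite -(sorted_pairwise dec_step_trans).
  have mem_s i : i \in r -> pt i \in s.
    by move=> ir; rewrite (perm_mem perm_s) def_s' map_f.
  have [eqpt|neqpt] := eqVneq (pt k) (pt j); last exact: (pairwise_neq pw (mem_s _ kr) (mem_s _ jr)).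
  rewrite /comparable_pts eqpt orbb; apply: (pairwise_count pw).
  have /seq.permP -> := perm_s; rewrite def_s' count_map.
  have /seq.permP -> : perm_eq r [:: k, j & rem j (rem k r)].
    rewrite (perm_trans (perm_to_rem kr)) // perm_cons perm_to_rem //.
    by rewrite mem_rem_uniq // !inE eq_sym kj.
  by rewrite /= eqpt !eqxx.
by rewrite cardsE (card_uniqP ur) (perm_size perm_s) def_s' size_map.
Qed.

(** The chain is sorted by the reflexive closure of [dec_step]; distinctness of positions then
    recovers [dec_step] itself. *)
Lemma dec_chain_le X : dec_chain X -> (#|X| <= ell_dec W M)%N.
Proof.
move=> [XD cmp]; apply: ell_dec_max; apply/asboolP.
pose le k j := (k == j) || dec_step W (pt k) (pt j).
have le_trans : transitive le.
  move=> j k i /predU1P[->//|kj] /predU1P[<-|ji]; first by rewrite /le kj orbT.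
  by rewrite /le (dec_step_trans kj ji) orbT.
have le_tot : {in X &, total le}.
  move=> k j kX jX; rewrite /le; have [->//|kj] := eqVneq k j.
  by apply: cmp.
have sX : sorted le (sort le (enum X)).
  by apply: (sort_sorted_in le_tot); apply/allP => k; rewrite mem_enum.
exists [seq pt k | k <- sort le (enum X)]; split; last by rewrite size_map size_sort cardE.
split.
  apply: pairwise_sorted; rewrite pairwise_map.
  have : pairwise [rel k j | le k j && (k != j)] (sort le (enum X)).
    have -> : pairwise [rel k j | le k j && (k != j)] (sort le (enum X)) =
       pairwise le (sort le (enum X)) && pairwise [rel x y | x != y] (sort le (enum X)).
      by rewrite -pairwise_relI.
    by rewrite -uniq_pairwise sort_uniq enum_uniq andbT -(sorted_pairwise le_trans).
  apply: sub_pairwise => k j /= /andP[+ kj]; by rewrite /le (negbTE kj).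
apply/msubsetP => x; rewrite defM !mset_seqE !count_map.
have /seq.permP -> : perm_eq (sort le (enum X)) (enum X) by rewrite perm_sort.
have -> : enum X = [seq k <- enum I | k \in X] by rewrite {1}/enum_mem enumT.
rewrite !count_filter; apply: sub_count => k /= /andP[/andP[e kX] kI]; by rewrite e kI (XD _ kX).
Qed.

End Chains.

(** * The rearrangement inequality by counting quadrants *)

Section Dominance.
Variables (I : finType) (Y : {set I}) (u v v' : I -> nat).

(* The sum of (u k + 1)(v k + 1) counts the points of all the quadrants, and each
   quadrant contains the fewest points when u and v are oppositely sorted. *)
Definition dom (v : I -> nat) i j := #|[set k in Y | (i <= u k)%N && (j <= v k)%N]|.

Hypothesis v_v' : forall j, #|[set k in Y | (j <= v k)%N]| = #|[set k in Y | (j <= v' k)%N]|.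
Hypothesis antisorted : {in Y &, forall k k', (u k < u k')%N -> (v k' <= v k)%N}.

(** If some k lies below both bounds, antisortedness empties the quadrant of v. Otherwise the two
    half-planes cover Y, and inclusion-exclusion with equal marginals gives the bound. *)
Lemma dom_le i j : (dom v i j <= dom v' i j)%N.
Proof.
pose A := [set k in Y | (i <= u k)%N].
pose B (x : I -> nat) := [set k in Y | (j <= x k)%N].
have domE x : dom x i j = #|A :&: B x|.
  by apply: eq_card => k; rewrite !inE andbACA andbb.
have cAB x : (#|A| + #|B x| = #|A :|: B x| + dom x i j)%N by rewrite domE cardsUI.
have [/existsP[k /andP[/andP[kY kA] kB]]|none] :=
    boolP [exists k, (k \in Y) && (u k < i)%N && (v k < j)%N].
  rewrite (_ : dom v i j = 0%N) //; apply/eqP; rewrite cards_eq0; apply/eqP/setP => k'.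
  rewrite !inE; apply/negP => /and3P[k'Y ik' jk'].
  have := antisorted kY k'Y (leq_trans kA ik').
  by rewrite leqNgt (leq_trans kB jk').
have le : (#|A :|: B v'| <= #|A :|: B v|)%N.
  have -> : A :|: B v = Y.
    apply/setP => k; rewrite !inE -andb_orr; case kY: (k \in Y) => //=.
    rewrite negb_exists in none; have := forallP none k.
    by rewrite kY /= negb_and -!leqNgt.
  by apply: subset_leq_card; apply/subsetP => k; rewrite !inE -andb_orr => /andP[].
by rewrite -(leq_add2l #|A :|: B v|) -cAB [#|B v|]v_v' -/(B v') cAB leq_add2r.
Qed.

Lemma sum_leq_ord n m : (m < n)%N -> (\sum_(i < n) (i <= m) = m.+1)%N.
Proof.
move=> mn; transitivity (\sum_(i < n | (i < m.+1)%N) 1)%N.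
  by rewrite [RHS]big_mkcond; apply: eq_bigr => i _; rewrite ltnS; case: (_ <= _)%N.
by rewrite -(big_ord_widen n (fun _ => 1%N) mn) sum_nat_const card_ord muln1.
Qed.

Lemma sum_dom (x : I -> nat) n : {in Y, forall k, (u k < n)%N && (x k < n)%N} ->
  (\sum_(k in Y) (u k).+1 * (x k).+1 = \sum_(i < n) \sum_(j < n) dom x i j)%N.
Proof.
move=> ltn; transitivity (\sum_(k in Y) \sum_(i < n) \sum_(j < n) (i <= u k) * (j <= x k))%N.
  apply: eq_bigr => k kY; have /andP[un xn] := ltn k kY.
  rewrite -(sum_leq_ord un) -(sum_leq_ord xn) big_distrl; apply: eq_bigr => i _.
  by rewrite big_distrr.
rewrite exchange_big; apply: eq_bigr => i _; rewrite exchange_big; apply: eq_bigr => j _ /=.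
rewrite /dom -sum1_card; rewrite [RHS](eq_bigl (fun k => (k \in Y) && ((i <= u k)%N && (j <= x k)%N))).
  by rewrite big_mkcondr; apply: eq_bigr => k _; case: (i <= u k)%N; case: (j <= x k)%N.
by move=> k; rewrite inE.
Qed.

Lemma dom_sum_le n : {in Y, forall k, [&& u k < n, v k < n & v' k < n]%N} ->
  (\sum_(k in Y) (u k).+1 * (v k).+1 <= \sum_(k in Y) (u k).+1 * (v' k).+1)%N.
Proof.
move=> ltn; rewrite !(@sum_dom _ n).
- by apply: leq_sum => i _; apply: leq_sum => j _; apply: dom_le.
- by move=> k /ltn /and3P[-> _ ->].
- by move=> k /ltn /and3P[-> -> _].
Qed.

(** Equal sums force equal counts in every quadrant, and the count over a single point is a second
    difference of these. *)
Lemma dom_sum_eq n : {in Y, forall k, [&& u k < n, v k < n & v' k < n]%N} ->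
  (\sum_(k in Y) (u k).+1 * (v k).+1 = \sum_(k in Y) (u k).+1 * (v' k).+1)%N ->
  forall i j, #|[set k in Y | (u k == i) && (v k == j)]| =
              #|[set k in Y | (u k == i) && (v' k == j)]|.
Proof.
move=> ltn eq_sum.
have eq_dom i j : dom v i j = dom v' i j.
  have dom0 x h h' : {in Y, forall k, (u k < h)%N || (x k < h')%N} -> dom x h h' = 0%N.
    move=> lt; apply/eqP; rewrite cards_eq0; apply/eqP/setP => k; rewrite !inE.
    by apply/negP => /and3P[/lt + hu hx]; rewrite !ltnNge hu hx.
  have [i_n|n_i] := ltnP i n; last first.
    by rewrite !dom0 // => k /ltn /and3P[uk _ _]; rewrite (leq_trans uk n_i).
  have [j_n|n_j] := ltnP j n; last first.
    by rewrite !dom0 // => k /ltn /and3P[_ vk v'k]; rewrite ?(leq_trans vk) ?(leq_trans v'k) ?orbT.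
  move: eq_sum; rewrite !(@sum_dom _ n); last 2 first.
  - by move=> k /ltn /and3P[-> _ ->].
  - by move=> k /ltn /and3P[-> -> _].
  have leq_ij (h h' : 'I_n) : true -> (dom v h h' <= dom v' h h' ?= iff (dom v h h' == dom v' h h'))%N.
    by move=> _; split=> //; apply: dom_le.
  have [_ E] := leqif_sum (fun h (_ : true) => leqif_sum (leq_ij h)).
  move=> /eqP; rewrite E => /forallP/(_ (Ordinal i_n))/= /forallP/(_ (Ordinal j_n)).
  by move=> /eqP.
have card_sum (P : pred I) : (#|[set k in Y | P k]| = \sum_(k in Y) P k)%N.
  rewrite -sum1_card (eq_bigl (fun k => (k \in Y) && P k)) => [|k]; last by rewrite inE.
  by rewrite big_mkcondr; apply: eq_bigr => k _; case: (P k).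
have count_dom x h h' : (#|[set k in Y | (u k == h) && (x k == h')]| + dom x h.+1 h' + dom x h h'.+1
   = dom x h h' + dom x h.+1 h'.+1)%N.
  rewrite /dom !card_sum -!big_split; apply: eq_bigr => k _ /=.
  by case: (ltngtP (u k) h); case: (ltngtP (x k) h').
move=> i j; apply/eqP.
rewrite -(eqn_add2r (dom v i.+1 j + dom v i j.+1)) addnA count_dom.
by rewrite !eq_dom [X in _ == X]addnA count_dom.
Qed.

End Dominance.

(** There are only 2l letters, so at each coordinate two positions of S carry the same letter, and
    their transposition pairs terms of opposite sign. *)
Lemma antisymmetrizer0 (K : numFieldType) N l (S : {set 'I_N}) (t : tensor K N l) :
  (l + l < #|S|)%N -> \sum_(s | perm_on S s) (-1) ^+ s *: perm_act s^-1%g t = 0.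
Proof.
move=> lt_S; apply/ffunP => w; rewrite sum_ffunE [RHS]ffunE.
have /dinjectivePn[k kS [j /andP[jk jS] wkj]] : ~~ dinjectiveb (w : 'I_N -> _) (mem S).
  apply: contraL lt_S => /dinjectiveP w_inj; rewrite -leqNgt -(card_in_imset w_inj).
  by rewrite -[X in (_ <= X)%N]card_ord max_card.
set p := tperm k j; have pS : perm_on S p.
  apply/subsetP => i; rewrite inE; apply: contraR => iS.
  by rewrite tpermD //; apply: contraNneq iS => <-.
have wp : wperm w p = w.
  by apply/ffunP => i; rewrite ffunE; case: tpermP => [->|->|].
set X := LHS; suff : X = - X.
  by move=> /eqP; rewrite -subr_eq0 opprK -mulr2n mulrn_eq0 /= => /eqP.
rewrite -[RHS]sumrN {1}/X (reindex_inj (mulIg p)); apply: eq_big => [s|s Ss].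
  apply/idP/idP => [Ssp|Ss]; last exact: perm_onM.
  by rewrite -(mulgK p s) perm_onM // perm_onV.
rewrite !ffunE !perm_actE !invgK wpermM wp odd_permM odd_tperm eq_sym jk addbT.
by rewrite signrN scaleNr.
Qed.

(** * The straightening relation *)

Section Straightening.
Variables (K : numFieldType) (N l : nat) (W : set nat) (nu : seq nat).
Implicit Types (tau s : 'S_N) (k j : 'I_N) (X Y S : {set 'I_N}).
Local Notation e := (@color N nu).
Local Notation od := (odd_color W).
Local Notation adm := (admissible e od).
Local Notation symm := (symm (K := K) (l := l) e od).
Local Notation cpart := (@cpart N nu).
Local Notation cnum := (@cnum N nu).
Local Notation profile := (@profile N nu).

(** The reflection of points in the diagonal, lifted to positions: a chord to infinity is read as a
    point (i, i), its own mirror image. *)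
Definition partner tau k := if e (tau k) == None then k else tau k.

Definition pnt tau k := (cnum k, cpart tau k).

Definition weight tau := (\sum_(k : 'I_N | e k) (cnum k).+1 * (cpart tau k).+1)%N.

Lemma cnumE k : e k -> e k = Some (cnum k).
Proof. by rewrite /cnum; case: (e k). Qed.

Lemma cnum_inj k j : e k -> e j -> cnum k = cnum j -> e k = e j.
Proof. by move=> /cnumE -> /cnumE -> ->. Qed.

Lemma oddE k : e k -> od (e k) = (cnum k \in W).
Proof. by move=> /cnumE ->. Qed.

Lemma cpartE tau k : cpart tau k = cnum (partner tau k).
Proof.
rewrite /cpart /partner /cnum; case E: (e (tau k)) => [j|] /=; last by [].
by rewrite E.
Qed.

Lemma partner_nt tau k : e k -> e (partner tau k).
Proof. by rewrite /partner; case E: (e (tau k)) => [j|] //=; rewrite E. Qed.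

Lemma partnerK tau k : fpf_involution tau -> e k -> partner tau (partner tau k) = k.
Proof.
move=> ft ek; have inv j : tau (tau j) = j by case: (ft j).
rewrite {2}/partner; case: eqP => [tk|_]; first by rewrite /partner tk.
by rewrite /partner inv; case: eqP ek => // ->.
Qed.

Lemma pnt_partner tau k : fpf_involution tau -> e k ->
  pnt tau (partner tau k) = ((pnt tau k).2, (pnt tau k).1).
Proof. by move=> ft ek; rewrite /pnt !cpartE partnerK. Qed.

Lemma comparable_swap p q : comparable_pts W (p.2, p.1) (q.2, q.1) = comparable_pts W p q.
Proof.
have E (p' q' : nat * nat) : dec_step W (p'.2, p'.1) (q'.2, q'.1) = dec_step W q' p'.
  rewrite /dec_step /= [q'.1 == _]eq_sym [q'.2 == _]eq_sym.
  rewrite andbCA; congr [&& _, _ & _]; rewrite andbC.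
  by congr andb; case: eqP => //= ->.
by rewrite /comparable_pts !E orbC.
Qed.

Local Notation chain tau := (dec_chain W (fun k => e k : bool) (pnt tau)).

Lemma chain_partner tau X : fpf_involution tau -> chain tau X ->
  chain tau (partner tau @: X).
Proof.
move=> ft [Xe cmp]; split=> [_ /imsetP[k kX ->]|_ _ /imsetP[k kX ->] /imsetP[j jX ->] neq].
  by apply: partner_nt; apply: Xe.
have kj : k != j by apply: contraNneq neq => ->.
by rewrite !pnt_partner ?Xe // comparable_swap cmp.
Qed.

Lemma same_color_odd tau k : adm tau -> e k -> partner tau k != k ->
  cnum k = cpart tau k -> cnum k \in W.
Proof.
move=> [_ sam _] ek; rewrite cpartE => pk ck.
have := partner_nt tau ek; move: pk ck; rewrite /partner.
have [_|_ _ ck etk] := eqVneq (e (tau k)) None; first by rewrite eqxx.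
by rewrite -oddE //; apply: (sam k); apply: cnum_inj.
Qed.

(** Comparable diagonal points are equal with color in W, and an odd color has at most one chord to
    infinity. *)
Lemma two_fixed tau k j : adm tau -> e (tau k) = None -> e (tau j) = None ->
  e k -> e j -> k != j -> comparable_pts W (pnt tau k) (pnt tau j) -> False.
Proof.
move=> [_ _ mix] tk tj ek ej kj cmp; case/negP: kj.
have pk : pnt tau k = (cnum k, cnum k) by rewrite /pnt cpartE /partner tk.
have pj : pnt tau j = (cnum j, cnum j) by rewrite /pnt cpartE /partner tj.
have [eqc cW] : cnum k = cnum j /\ cnum k \in W.
  move: cmp; rewrite pk pj /comparable_pts /dec_step /= => /orP[] /and4P[le1 le2 w1 _].
    have eqc : cnum k = cnum j by apply/eqP; rewrite eqn_leq le1.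
    by split=> //; apply: (implyP w1); rewrite eqc.
  have eqc : cnum k = cnum j by apply/eqP; rewrite eqn_leq le2.
  by split=> //; move: w1; rewrite eqc eqxx.
apply/eqP; apply: mix; rewrite ?tk ?tj ?oddE //; exact: cnum_inj.
Qed.

(** If (a, c) and (a', c') are comparable with a <= c and a' <= c', then a <= c' and a' <= c, so (a,
    c) precedes the mirror image (c', a'); an equality here forces one already covered by the
    W-conditions. For a diagonal point against its own image, admissibility puts the color in W. *)
Lemma chain_symmetrize tau X : adm tau -> chain tau X ->
  {in X, forall k, cnum k <= cpart tau k}%N ->
  chain tau (X :|: partner tau @: X).
Proof.
move=> adm_t chX up; have [Xe cmp] := chX; have [ft _ _] := adm_t.
have [Pe cmpP] := chain_partner ft chX.
have mixed k j : k \in X -> j \in X -> k != partner tau j ->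
    comparable_pts W (pnt tau k) (pnt tau (partner tau j)).
  move=> kX jX neq; rewrite pnt_partner ?Xe //.
  have [eqkj|kj] := eqVneq k j.
    have leX := up k kX; rewrite -eqkj /comparable_pts /dec_step /= in neq *.
    rewrite leX /= eq_sym; case: eqP => //= eqc; rewrite eqc.
    by rewrite (same_color_odd adm_t (Xe k kX)) // eq_sym.
  have lek := up k kX; have lej := up j jX.
  have := cmp k j kX jX kj; rewrite /comparable_pts /dec_step /=.
  set a := cnum k in lek *; set c := cpart tau k in lek *.
  set a' := cnum j in lej *; set c' := cpart tau j in lej *.
  case/orP => /and4P[le1 le2 w1 w2]; apply/orP; left.
    rewrite (leq_trans le1 lej) (leq_trans lej le2) /=.
    apply/andP; split; apply/implyP => /eqP E.
      have E2 : a = a' by apply/eqP; rewrite eqn_leq le1 E lej.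
      by apply: (implyP w1); rewrite E2.
    have E2 : c = c' by apply/eqP; rewrite eqn_leq le2 andbT E lej.
    by apply: (implyP w2); rewrite E2.
  rewrite (leq_trans lek le2) (leq_trans le1 lek) /=.
  apply/andP; split; apply/implyP => /eqP E.
    have E2 : c' = c by apply/eqP; rewrite eqn_leq le2 andbT -E lek.
    by rewrite E; apply: (implyP w2); rewrite E2.
  have E2 : a' = a by apply/eqP; rewrite eqn_leq le1 -E lek.
  by rewrite E; apply: (implyP w1); rewrite E2.
split=> [k|k j]; rewrite !in_setU; first by case/orP => [/Xe|/Pe].
case/orP => [kX|kP] /orP[jX|jP] kj; first exact: cmp.
- by case/imsetP: jP kj => i iX ->; apply: mixed.
- case/imsetP: kP kj => i iX ->; rewrite eq_sym comparable_ptsC; exact: mixed.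
exact: cmpP.
Qed.

(** Up to reflection, at least as many points lie above the diagonal as below; those below are
    replaced by the images of those above. The diagonal points of a chain all coincide, and are
    replaced by a set stable under [partner]. *)
Lemma symmetric_chain tau X : adm tau -> chain tau X ->
  exists Y, [/\ chain tau Y, {in Y, forall k, partner tau k \in Y} & (#|X| <= #|Y|)%N].
Proof.
move=> adm_t; have [ft _ _] := adm_t.
pose above X := [set k in X | (cnum k < cpart tau k)%N].
pose below X := [set k in X | (cpart tau k < cnum k)%N].
wlog le_ab : X / (#|below X| <= #|above X|)%N => [hwlog chX|chX].
  have [le|/ltnW le] := leqP #|below X| #|above X|; first exact: hwlog le chX.
  have [Xe _] := chX.
  have pinj : {in X &, injective (partner tau)}.
    by move=> k j kX jX eqp; rewrite -(partnerK ft (Xe k kX)) eqp partnerK // Xe.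
  have pE k : k \in X ->
      (cnum (partner tau k) = cpart tau k) * (cpart tau (partner tau k) = cnum k).
    by move=> kX; case: (pnt_partner ft (Xe k kX)) => -> ->.
  have [|Y [chY fY leY]] := hwlog _ _ (chain_partner ft chX).
    have bE : below (partner tau @: X) = partner tau @: above X.
      apply/setP => k; apply/idP/imsetP => [|[j]]; rewrite inE => /andP[].
        move=> /imsetP[j jX ->]; rewrite (pE j jX).1 (pE j jX).2 => lt.
        by exists j; rewrite // inE jX.
      by move=> jX lt ->; rewrite inE (pE j jX).1 (pE j jX).2 imset_f.
    have aE : above (partner tau @: X) = partner tau @: below X.
      apply/setP => k; apply/idP/imsetP => [|[j]]; rewrite inE => /andP[].
        move=> /imsetP[j jX ->]; rewrite (pE j jX).1 (pE j jX).2 => lt.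
        by exists j; rewrite // inE jX.
      by move=> jX lt ->; rewrite inE (pE j jX).1 (pE j jX).2 imset_f.
    rewrite bE aE !card_in_imset //.
      by move=> k j; rewrite !inE => /andP[kX _] /andP[jX _]; apply: pinj.
    by move=> k j; rewrite !inE => /andP[kX _] /andP[jX _]; apply: pinj.
  by exists Y; split=> //; rewrite -(card_in_imset pinj).
have [Xe cmp] := chX; pose X0 := [set k in X | cnum k == cpart tau k].
have [D [chU fD D0 DX0]] : exists D, [/\ chain tau (above X :|: D),
    {in D, forall k, partner tau k \in D},
    {in D, forall k, cnum k = cpart tau k} & (#|X0| <= #|D|)%N].
  have [X00|[k0 k0X0]] := set_0Vmem X0.
    exists set0; rewrite X00 setU0; split=> // [|k|k]; rewrite ?inE //.
    split=> [k|k j]; rewrite !inE; first by case/andP => /Xe.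
    by move=> /andP[kX _] /andP[jX _]; apply: cmp.
  have [k0X /eqP ck0] : k0 \in X /\ cnum k0 == cpart tau k0 by move: k0X0; rewrite inE => /andP[].
  (* In W, all positions over the diagonal point can be taken, and they form a stable set. Outside W
     the chain has only [k0] there, and admissibility forces it to be matched with infinity, hence
     to be its own partner. *)
  pose D := if cnum k0 \in W then [set k | e k && (pnt tau k == pnt tau k0)] else [set k0].
  have De k : k \in D -> e k /\ pnt tau k = pnt tau k0.
    rewrite /D; case: ifP => _; rewrite !inE; first by case/andP => ek /eqP.
    by move=> /eqP ->; split; first exact: Xe.
  have cD k : k \in D -> (cnum k = cnum k0) * (cpart tau k = cnum k0).
    by case/De => _ [-> ->]; rewrite ck0.
  have X0D k : k \in X0 -> k \in D.
    rewrite inE => /andP[kX /eqP ck]; have [->|neq] := eqVneq k k0.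
      by rewrite /D; case: ifP => _; rewrite !inE ?eqxx ?andbT ?Xe.
    have := cmp k k0 kX k0X neq; rewrite /comparable_pts /dec_step /= -ck -ck0.
    have main : (cnum k <= cnum k0)%N -> (cnum k0 <= cnum k)%N ->
        ((cnum k == cnum k0) ==> (cnum k0 \in W)) -> k \in D.
      move=> le1 le2; have eqc : cnum k = cnum k0 by apply/eqP; rewrite eqn_leq le1.
      by rewrite eqc eqxx /= /D => ->; rewrite inE Xe //= /pnt -ck -ck0 eqc.
    case/orP => /and4P[le1 le2 w1 w2]; apply: main => //.
      by apply/implyP => /eqP E; rewrite E eqxx in w1.
    by apply/implyP => /eqP E; rewrite E eqxx in w1.
  exists D; split=> [|k kD|k kD|]; last first.
  - by apply: subset_leq_card; apply/subsetP => k; apply: X0D.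
  - by rewrite !cD.
  - have [ek _] := De k kD.
    have := pnt_partner ft ek; rewrite /pnt /= => -[E1 E2].
    move: (kD); rewrite /D; case: ifP => k0W; rewrite !inE.
      by move=> _; rewrite partner_nt // /pnt E1 E2 (cD k kD).1 (cD k kD).2 -ck0 eqxx.
    move=> /eqP def_k; apply: contraFT k0W => neq.
    by rewrite -(cD k kD).1; apply: (same_color_odd adm_t ek); [rewrite {2}def_k | rewrite !cD].
  have mixed k j : k \in above X -> j \in D -> comparable_pts W (pnt tau k) (pnt tau j).
    rewrite inE => /andP[kX lt] /De[_ ->]; apply: cmp => //.
    by apply: contraTneq lt => ->; rewrite ck0 ltnn.
  split=> [k|k j]; rewrite !in_setU.
    by case/orP => [|/De[]//]; rewrite inE => /andP[/Xe].
  case/orP => [kA|kD] /orP[jA|jD] neq.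
  - by move: kA jA; rewrite !inE => /andP[kX _] /andP[jX _]; apply: cmp.
  - exact: mixed.
  - by rewrite comparable_ptsC; apply: mixed.
  move: kD jD neq; rewrite /D; case: ifP => k0W; rewrite !inE.
    move=> /andP[_ /eqP ->] /andP[_ /eqP ->] _.
    by rewrite /comparable_pts /dec_step !leqnn /= -ck0 k0W !implybT.
  by move=> /eqP -> /eqP ->; rewrite eqxx.
set U := above X :|: D in chU; have [Ue _] := chU.
have upU : {in U, forall k, cnum k <= cpart tau k}%N.
  by move=> k; rewrite !inE => /orP[/andP[_ /ltnW]//|/D0 ->].
exists (U :|: partner tau @: U); split.
- exact: chain_symmetrize.
- move=> k /setUP[kU|/imsetP[j jU ->]]; apply/setUP; first by right; apply: imset_f.
  by left; rewrite partnerK //; apply: Ue.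
have pinj : {in above X &, injective (partner tau)}.
  have ab_e k : k \in above X -> e k by move=> kA; apply: Ue; rewrite inE kA.
  by move=> k j kA jA eqp; rewrite -(partnerK ft (ab_e k kA)) eqp partnerK // ab_e.
have sub : (U :|: partner tau @: above X) \subset (U :|: partner tau @: U).
  by rewrite setUS // imsetS // subsetUl.
apply: leq_trans (subset_leq_card sub).
have disj (A B : {set 'I_N}) : (forall k, k \in A -> k \in B -> False) -> #|A :|: B| = (#|A| + #|B|)%N.
  move=> dAB; rewrite -cardsUI (_ : A :&: B = set0) ?cards0 ?addn0 //.
  by apply/setP => k; rewrite !inE; apply/negP => /andP[kA kB]; apply: (dAB k).
rewrite disj; last first.
  move=> i iU /imsetP[k kA def_i]; have := upU _ iU; rewrite def_i.
  have ek : e k by apply: Ue; rewrite inE kA.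
  have := pnt_partner ft ek; rewrite /pnt /= => -[-> ->].
  by move: kA; rewrite inE => /andP[_ lt]; rewrite leqNgt lt.
rewrite [#|U|]disj; last first.
  by move=> k; rewrite inE => /andP[_ lt] /D0 E; rewrite E ltnn in lt.
rewrite (card_in_imset pinj) addnC addnA.
have XE : #|X| = #|(above X :|: below X) :|: X0|.
  by apply: eq_card => k; rewrite !inE; case: (k \in X) => //=; case: ltngtP.
rewrite XE; apply: leq_trans (leq_card_setU _ _) _; apply: leq_add => //.
by apply: leq_trans (leq_card_setU _ _) _; rewrite leq_add2l.
Qed.

Lemma profile_card tau (i j : nat) :
  profile tau (i, j) = #|[set k | e k && (pnt tau k == (i, j))]|.
Proof.
rewrite mset_seqE count_map count_filter -size_filter cardE; congr size.
rewrite {2}/enum_mem enumT; apply: eq_filter => k.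
by rewrite /= inE andbC.
Qed.

Lemma card_in_involution (Y : {set 'I_N}) (f : 'I_N -> 'I_N) (P : pred 'I_N) :
  {in Y, forall k, f k \in Y} -> {in Y, forall k, f (f k) = k} ->
  #|[set k in Y | P (f k)]| = #|[set k in Y | P k]|.
Proof.
move=> fY fK; have f_inj : {in [set k in Y | P (f k)] &, injective f}.
  move=> k j; rewrite !inE => /andP[kY _] /andP[jY _] eqf.
  by rewrite -(fK k kY) eqf fK.
rewrite -(card_in_imset f_inj); apply: eq_card => k; apply/imsetP/idP.
  by case=> j; rewrite !inE => /andP[jY Pfj] ->; rewrite fY.
rewrite inE => /andP[kY Pk]; exists (f k); last by rewrite fK.
by rewrite inE fY // fK.
Qed.

Lemma fpf_conj tau s : fpf_involution tau -> fpf_involution (tau ^ s)%g.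
Proof.
move=> /matchingT mt; apply/matchingT; apply: matchingJ mt.
by apply/subsetP => k; rewrite inE.
Qed.

(* The points over the chain Y are sorted in opposite directions by their two
   coordinates, so that this is an instance of the rearrangement inequality. *)
Lemma weight_conj tau Y s (S := Y :|: tau @: Y) : adm tau -> chain tau Y ->
    {in Y, forall k, partner tau k \in Y} -> perm_on S s -> fpf_involution (tau ^ s)%g ->
  (weight tau <= weight (tau ^ s)%g)%N /\
  (weight tau = weight (tau ^ s)%g -> profile (tau ^ s)%g = profile tau).
Proof.
move=> adm_t [Ye cmp] pY Ss ft'; have [ft _ _] := adm_t.
set tau' := (tau ^ s)%g in ft' *; have tauK k : tau (tau k) = k by case: (ft k).
have SY k : k \in S -> e k -> k \in Y.
  rewrite in_setU => /orP[//|/imsetP[j jY ->]] etj.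
  have := pY j jY; rewrite /partner; case: eqP => [E|//].
  by rewrite E in etj.
have tS k : (tau k \in S) = (k \in S).
  have tS1 j : j \in S -> tau j \in S.
    rewrite !in_setU => /orP[jY|/imsetP[i iY ->]]; first by rewrite imset_f ?orbT.
    by rewrite tauK iY.
  by apply/idP/idP => [/tS1|/tS1//]; rewrite tauK.
have t'S k : (tau' k \in S) = (k \in S).
  by rewrite /tau' conjgE !permM (perm_closed _ Ss) tS (perm_closed _ (perm_onV Ss)).
have t'O k : k \notin S -> tau' k = tau k.
  move=> kS; rewrite /tau' conjgE !permM (out_perm (perm_onV Ss) kS) (out_perm Ss) //.
  by rewrite tS.
have pY' : {in Y, forall k, partner tau' k \in Y}.
  move=> k kY; rewrite /partner; case: eqP => // /eqP ek; apply: SY.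
    by rewrite t'S in_setU kY.
  by case: (e _) ek.
have YS k : e k -> k \notin Y -> k \notin S by move=> ek; apply: contra => /SY; apply.
have cO k : e k -> k \notin Y -> cpart tau' k = cpart tau k.
  by move=> ek kY; rewrite /cpart t'O ?YS.
pose n := (\max_k cnum k).+1; have ltn k : (cnum k < n)%N by rewrite ltnS leq_bigmax.
(* Both matchings permute Y through [partner], so the second coordinates have the same
   distribution. *)
have eq_marg (j : nat) : #|[set k in Y | (j <= cpart tau k)%N]| = #|[set k in Y | (j <= cpart tau' k)%N]|.
  have E x : fpf_involution x -> {in Y, forall k, partner x k \in Y} ->
      #|[set k in Y | (j <= cpart x k)%N]| = #|[set k in Y | (j <= cnum k)%N]|.
    move=> fx pxY; rewrite -(card_in_involution (fun k => j <= cnum k)%N pxY).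
      by apply: eq_card => k; rewrite !inE cpartE.
    by move=> k kY; rewrite partnerK // Ye.
  by rewrite !E.
have anti : {in Y &, forall k k', (cnum k < cnum k')%N -> (cpart tau k' <= cpart tau k)%N}.
  move=> k k' kY k'Y lt; have neq : k != k' by apply: contraTneq lt => ->; rewrite ltnn.
  have := cmp k k' kY k'Y neq; rewrite /comparable_pts /dec_step /=.
  by case/orP => /and4P[le1 le2 _ _] //; rewrite leqNgt lt in le1.
have lt3 : {in Y, forall k, [&& cnum k < n, cpart tau k < n & cpart tau' k < n]%N}.
  by move=> k _; rewrite !cpartE !ltn.
have wE x : weight x = (\sum_(k in Y) (cnum k).+1 * (cpart x k).+1 +
    \sum_(k | e k && (k \notin Y)) (cnum k).+1 * (cpart x k).+1)%N.
  rewrite /weight (bigID (mem Y)) /=; congr addn; apply: eq_bigl => k.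
  by case kY: (k \in Y); rewrite ?andbF // Ye.
have wO : (\sum_(k | e k && (k \notin Y)) (cnum k).+1 * (cpart tau' k).+1 =
    \sum_(k | e k && (k \notin Y)) (cnum k).+1 * (cpart tau k).+1)%N.
  by apply: eq_bigr => k /andP[ek kY]; rewrite cO.
rewrite !wE wO; split; first by rewrite leq_add2r (dom_sum_le eq_marg anti lt3).
move=> /addIn eq_sum; have eqY := dom_sum_eq eq_marg anti lt3 eq_sum.
apply/msetP => -[i j]; rewrite !profile_card.
rewrite -(cardsID Y) -[RHS](cardsID Y); congr addn.
  have E x : [set k | e k && (pnt x k == (i, j))] :&: Y =
      [set k in Y | (cnum k == i) && (cpart x k == j)].
    apply/setP => k; rewrite !inE xpair_eqE.
    by case kY: (k \in Y); rewrite ?andbF // Ye // andbT.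
  by rewrite !E -eqY.
apply: eq_card => k; rewrite !inE; case kY: (k \in Y) => //=.
by case ek: (isSome (e k)) => //=; rewrite /pnt cO // kY.
Qed.

Lemma straighten tau (U : {vspace tensor K N l}) : adm tau ->
    (l + l < ell_dec W (profile tau))%N ->
    (forall tau', adm tau' -> (weight tau < weight tau')%N -> symm (T_inv K l tau') \in U) ->
  symm (T_inv K l tau) \in U.
Proof.
move=> adm_t lt_ell IH; have [ft _ _] := adm_t.
have [X chX cardX] := @dec_chain_ex W _ (fun k => e k : bool) (pnt tau) (profile tau) erefl.
have [Y [chY pY leXY]] := symmetric_chain adm_t chX; have [Ye cmp] := chY.
have tauK k : tau (tau k) = k by case: (ft k).
(* The tail positions matched into the chain are added, so that S is stable under [tau] and
   conjugation by permutations of S changes no other chord. *)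
pose S := Y :|: tau @: Y.
have lt_S : (l + l < #|S|)%N.
  rewrite (leq_trans lt_ell) // -cardX (leq_trans leXY) //.
  by rewrite subset_leq_card // subsetUl.
have SY k : k \in S -> e k -> k \in Y.
  rewrite in_setU => /orP[//|/imsetP[j jY ->]] etj.
  have := pY j jY; rewrite /partner; case: eqP => [E|//].
  by rewrite E in etj.
have tS k : (tau k \in S) = (k \in S).
  have tS1 j : j \in S -> tau j \in S.
    rewrite !in_setU => /orP[jY|/imsetP[i iY ->]]; first by rewrite imset_f ?orbT.
    by rewrite tauK iY.
  by apply/idP/idP => [/tS1|/tS1//]; rewrite tauK.
(* Inside a block, comparability of two points with the same first coordinate needs the color in W;
   two tail positions would give two comparable fixed points. This makes [chi] the sign on Young
   elements supported on S. *)
have S_odd k j : k \in S -> j \in S -> k != j -> e k = e j -> od (e k).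
  move=> kS jS kj ekj; case ek: (isSome (e k)); last first.
    have tail i : i \in S -> ~~ e i -> tau i \in Y.
      rewrite in_setU => /orP[/Ye ->//|/imsetP[h hY ->]] _; by rewrite tauK.
    have [tkY tjY] : tau k \in Y /\ tau j \in Y by rewrite !tail // -?ekj ?ek.
    have none i : ~~ e i -> e (tau (tau i)) = None by rewrite tauK; case: (e i).
    have tkj : tau k != tau j by rewrite (inj_eq perm_inj).
    case: (@two_fixed tau (tau k) (tau j)); rewrite ?none -?ekj ?ek ?Ye //.
    exact: cmp.
  have kY := SY k kS ek; have jY : j \in Y by apply: SY; rewrite -?ekj.
  rewrite oddE //; have eqc : cnum k = cnum j by rewrite /cnum ekj.
  have := cmp k j kY jY kj; rewrite /comparable_pts /dec_step /= eqc !eqxx /=.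
  by case/orP => /and4P[].
have chi_S s : perm_on S s -> young e s -> chi K e od s = (-1) ^+ s.
  move=> Ss /youngP Ys; apply: (@chi_on_odd K N _ e od (oddset e od)) => //.
  apply/subsetP => k; rewrite !inE => sk; have kS : k \in S.
    by apply: contraR sk => kS; rewrite (out_perm Ss).
  by rewrite -Ys; apply: (S_odd _ k); rewrite ?(perm_closed _ Ss).
pose term s := (-1) ^+ s *: symm (perm_act s^-1%g (T_inv K l tau)).
have main s : perm_on S s -> term s = symm (T_inv K l tau) \/ term s \in U.
  move=> Ss; have ft' := fpf_conj s ft; set tau' := (tau ^ s)%g in ft'.
  have [eps Eeps] := T_inv_perm K l s ft; rewrite /term Eeps linearZ /= -/tau'.
  have [->|nz] := eqVneq (symm (T_inv K l tau')) 0.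
    by right; rewrite !scaler0 mem0v.
  have adm' := symm_neq0_admissible ft' nz.
  have [le_w eq_w] := weight_conj adm_t chY pY Ss ft'; rewrite -/tau' in le_w eq_w.
  move: le_w; rewrite leq_eqVlt => /predU1P[/eq_w eq_prof|lt_w]; last first.
    by right; rewrite !memvZ // IH.
  left; have eq_cnt x y : cnt nu tau x y = cnt nu tau' x y.
    have /realizesP[_ <-] := admissible_realizes adm_t.
    by rewrite -eq_prof; have /realizesP[_ <-] := admissible_realizes adm'.
  have t'S k : (tau' k \in S) = (k \in S).
    by rewrite /tau' conjgE !permM (perm_closed _ Ss) tS (perm_closed _ (perm_onV Ss)).
  have t'O k : k \notin S -> tau' k = tau k.
    move=> kS; rewrite /tau' conjgE !permM (out_perm (perm_onV Ss) kS) (out_perm Ss) //.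
    by rewrite tS.
  (* The multisets and the chords off S agree, so a Young element r supported on S conjugates one
     matching to the other. Then s = c r with c commuting with [tau], and the signs of c and r each
     occur twice. *)
  have [||x y|r [Sr er comr]] := @matching_conj N _ e S tau tau'.
  - by apply: matching_on_fpf => // k kS; rewrite tS.
  - by apply: matching_on_fpf => // k kS; rewrite t'S.
  - have := eq_cnt x y; rewrite /cnt /pair_count.
    rewrite -(cardsID S) -[RHS](cardsID S).
    have -> : [set k in setT | (e k == x) && (e (tau' k) == y)] :\: S =
              [set k in setT | (e k == x) && (e (tau k) == y)] :\: S.
      by apply/setP => k; rewrite !in_setD; have [//|kS] := boolP (k \in S); rewrite /= !inE t'O.
    move=> /addIn E; rewrite (_ : [set _ in S | _] = [set k in setT | (e k == x) && (e (tau k) == y)] :&: S).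
      rewrite E; apply: eq_card => k; by rewrite !inE /= andbC.
    by apply/setP => k; rewrite !inE /= andbC.
  have Yr : young e r by apply/youngP.
  have Srv := perm_onV Sr; pose c := (s * r^-1)%g.
  have com_c k : c (tau k) = tau (c k).
    rewrite /c !permM -(conj_permE tau s k) -/tau'.
    have [kS|kS] := boolP (k \in S).
      apply: (@perm_inj _ r); rewrite permKV -comr ?permKV //.
      by rewrite (perm_closed _ Srv) (perm_closed _ Ss).
    rewrite (out_perm Ss kS) (t'O _ kS) (out_perm Srv kS) (out_perm Srv) //.
    by rewrite tS.
  have com_cV k : c^-1%g (tau k) = tau (c^-1%g k).
    by apply: (@perm_inj _ c); rewrite permKV com_c permKV.
  have def_s : s = (c * r)%g by rewrite /c mulgKV.
  rewrite -[_ *: symm _]linearZ /= -Eeps def_s invMg perm_actM T_inv_commuting //.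
  rewrite perm_actZ linearZ /= symm_perm ?youngV // chi_S ?youngV //.
  rewrite !scalerA odd_permM !odd_permV -!signr_addb.
  by case: (odd_perm c); case: (odd_perm r); rewrite /= expr0 scale1r.
pose P s := perm_on S s && (term s == symm (T_inv K l tau)).
have := @antisymmetrizer0 K N l S (T_inv K l tau) lt_S.
move=> /(congr1 symm); rewrite linear0 linear_sum /=.
have -> : \sum_(s | perm_on S s) symm ((-1) ^+ s *: perm_act s^-1 (T_inv K l tau)) =
    \sum_(s | perm_on S s) term s.
  by apply: eq_bigr => s _; rewrite linearZ.
rewrite (bigID (fun s => term s == symm (T_inv K l tau))) /=.
rewrite (eq_bigr (fun _ => symm (T_inv K l tau))); last by move=> s /andP[_ /eqP].
rewrite sumr_const => /eqP; rewrite addr_eq0 => /eqP E.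
(* The terms equal to the tensor itself include the one of the identity, so their number can be
   divided out. *)
have memU : symm (T_inv K l tau) *+ #|P| \in U.
  rewrite E memvN; apply: memv_suml => s /andP[Ss neq].
  by case: (main s Ss) => // eqs; rewrite eqs eqxx in neq.
have P_gt0 : (0 < #|P|)%N.
  apply/card_gt0P; exists 1%g; rewrite unfold_in perm_on1 /= /term.
  by rewrite invg1 perm_act1 odd_perm1 scale1r.
have P_neq0 : #|P|%:R != 0 :> K by rewrite pnatr_eq0 -lt0n.
rewrite -[symm _]scale1r -(mulVf P_neq0) -scalerA scaler_nat memvZ //.
Qed.

End Straightening.

(** * Linear independence *)

(** The difference of the two sides is (c - a)(h - d). *)
Lemma mul_exchange (a c d h : nat) : (a <= c)%N -> (d <= h)%N ->
  (h * a + d * c <= h * c + d * a)%N /\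
  ((h * a + d * c = h * c + d * a)%N -> a = c \/ d = h).
Proof.
move=> /subnKC <- /subnKC <-; move: (c - a)%N (h - d)%N => x y; split; first by nia.
by case: x => [|x]; [left; rewrite addn0|case: y => [|y]; [right; rewrite addn0|nia]].
Qed.

Lemma addn_shuffle (a c d h x : nat) : (a + (c + x) + (d + h) = a + c + (d + (h + x)))%N.
Proof. by lia. Qed.

Lemma add_exchange (x a c y w : nat) : (x + a = c + y)%N -> (c <= a)%N -> (y <= w)%N ->
  (x <= w)%N /\ (x = w -> c = a /\ y = w).
Proof. by lia. Qed.

(* Transport with supermodular cost: g is optimal among the V-admissible
   assignments because it never leaves an exchange that would improve it. *)
Lemma max_assignment (I : finType) (T : eqType) (C : I -> T) (z : I -> nat) (V : rel I)
    (Q : {set I}) (g g' : I -> I) :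
    (forall p p' q, V p q -> V p' q -> z p = z p' -> C p = C p') ->
    (forall p q q', V p q -> V p q' -> z q = z q' -> C q = C q') ->
    (forall p p' q q', V p q -> V p' q -> V p q' -> (z p' <= z p)%N -> V p' q') ->
    {in Q &, injective g} -> {in Q &, injective g'} -> {in Q, forall q, g' q \in g @: Q} ->
    {in Q, forall q, V (g q) q} -> {in Q, forall q, V (g' q) q} ->
    {in Q &, forall q q2, V (g q2) q -> (z (g q) < z (g q2))%N -> (z q <= z q2)%N} ->
  (\sum_(q in Q) z q * z (g' q) <= \sum_(q in Q) z q * z (g q))%N /\
  ((\sum_(q in Q) z q * z (g' q) = \sum_(q in Q) z q * z (g q))%N ->
    forall x y, #|[set q in Q | (C q == x) && (C (g' q) == y)]| =
                #|[set q in Q | (C q == x) && (C (g q) == y)]|).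
Proof.
move=> C1 C2 V1; have [n] := ubnP #|Q|.
elim: n => // n IH in Q g' *; move=> ltQ gI gI' gQ' Vg Vg' opt.
have [Q0|[q0 q0Q]] := set_0Vmem Q.
  rewrite Q0 !big_set0; split=> // _ x y.
  by apply: eq_card => q; rewrite !inE.
(* Extremal choice: q has the largest value, and among such elements its partner p under g has the
   largest value. Optimality then bounds the partner of q under g' by p. *)
pose q1 := [arg max_(q > q0 in Q) z q].
have [q1Q q1max] : q1 \in Q /\ {in Q, forall q, (z q <= z q1)%N}.
  by rewrite /q1; case: arg_maxnP => // q qQ qmax; split=> // i /qmax.
pose q := [arg max_(q > q1 | (q \in Q) && (z q == z q1)) z (g q)].
have [qQ zq qmax] : [/\ q \in Q, z q = z q1 &
    forall i, i \in Q -> z i = z q1 -> (z (g i) <= z (g q))%N].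
  rewrite /q; case: arg_maxnP => [|i /andP[iQ /eqP zi] imax]; first by rewrite q1Q eqxx.
  by split=> // j jQ zj; apply: imax; rewrite jQ zj eqxx.
set p := g q; set p' := g' q.
have imE : g' @: Q = g @: Q.
  apply/eqP; rewrite eqEcard !card_in_imset // leqnn andbT.
  by apply/subsetP => _ /imsetP[i iQ ->]; apply: gQ'.
have [q' q'Q def_p] : exists2 q', q' \in Q & p = g' q'.
  by apply/imsetP; rewrite imE imset_f.
have [q2 q2Q def_p'] : exists2 q2, q2 \in Q & p' = g q2 by apply/imsetP; apply: gQ'.
have le_p : (z p' <= z p)%N.
  rewrite leqNgt; apply/negP => lt; have Vp'q : V (g q2) q by rewrite -def_p'; apply: Vg'.
  have le := opt q q2 qQ q2Q Vp'q; rewrite -/p -def_p' in le; have {}le := le lt.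
  have zq2 : z q2 = z q1 by apply/eqP; rewrite eqn_leq q1max //= -zq.
  by have := qmax q2 q2Q zq2; rewrite -def_p' -/p leqNgt lt.
have le_q : (z q' <= z q)%N by rewrite zq q1max.
have Vpq : V p q by apply: Vg.
have Vp'q : V p' q by apply: Vg'.
have Vpq' : V p q' by rewrite def_p; apply: Vg'.
have Vp'q' : V p' q' by apply: V1 Vpq Vp'q Vpq' le_p.
(* The partners of q and q' under g' are exchanged, so that q is matched with p as under g and can
   be removed. *)
pose g2 i := if i == q' then p' else g' i.
have sub1 i : i \in Q :\ q -> i \in Q by rewrite inE => /andP[].
have p'p i : i \in Q :\ q -> i = q' -> p' != p.
  rewrite !inE => /andP[iq iQ] eqi; rewrite def_p /p'; apply: contraNneq iq.
  by move=> /(gI' _ _ qQ q'Q) eqq; rewrite eqi eqq.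
have [|i j /sub1 iQ /sub1 jQ|i j iQ jQ|i iQ|i /sub1 iQ|i /sub1 iQ|i j /sub1 iQ /sub1 jQ|le eqc] :=
    IH (Q :\ q) g2.
- by have := cardsD1 q Q; rewrite qQ add1n => cardQ; rewrite cardQ in ltQ.
- exact: gI.
- have g2N h : h \in Q :\ q -> h != q' -> g' h != p'.
    by rewrite !inE => /andP[hq hQ] _; apply: contraNneq hq => /gI' ->.
  rewrite /g2; case: (eqVneq i q') => [->|iq']; case: (eqVneq j q') => [->|jq'] //.
  + by move=> e; have := g2N j jQ jq'; rewrite -e eqxx.
  + by move=> e; have := g2N i iQ iq'; rewrite e eqxx.
  by apply: gI'; apply: sub1.
- have [r rQ def_r] : exists2 r, r \in Q & g2 i = g r.
    rewrite /g2; case: eqP => _; first by exists q2.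
    by apply/imsetP; apply: gQ'; apply: sub1.
  apply/imsetP; exists r => //; rewrite !inE rQ andbT; apply/eqP => rq.
  move: def_r; rewrite rq -/p /g2; have [eqi|iq'] := eqVneq i q'.
    by move=> e; have := p'p i iQ eqi; rewrite e eqxx.
  rewrite def_p => /gI' e; case/eqP: iq'; apply: e => //; exact: sub1.
- exact: Vg.
- by rewrite /g2; case: eqP => [->|_] //; apply: Vg'.
- exact: opt.
have sumD (f : I -> I) : (\sum_(i in Q) z i * z (f i) = z q * z (f q) +
    \sum_(i in Q :\ q) z i * z (f i))%N by rewrite (big_setD1 q).
have exch : (z q * z p' + z q' * z p <= z q * z p + z q' * z p')%N.
  exact: (mul_exchange le_p le_q).1.
pose ct (f : I -> I) (S : {set I}) x y := #|[set i in S | (C i == x) && (C (f i) == y)]|.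
have ctD f (S : {set I}) i x y : i \in S -> ct f S x y = ((C i == x) && (C (f i) == y) + ct f (S :\ i) x y)%N.
  move=> iS; rewrite /ct (cardsD1 i) inE iS; congr addn.
  by apply: eq_card => h; rewrite !inE andbA.
have g2E (S : {set I}) : q' \notin S -> {in S, g2 =1 g'}.
  by move=> q'S i iS; rewrite /g2; case: eqP => // eqi; rewrite -eqi iS in q'S.
have eq_ct (S : {set I}) x y : q' \notin S -> ct g2 S x y = ct g' S x y.
  move=> q'S; apply: eq_card => i; rewrite !inE; case iS: (i \in S) => //=.
  by rewrite (g2E S).
have eq_sum (S : {set I}) : q' \notin S -> (\sum_(i in S) z i * z (g2 i) = \sum_(i in S) z i * z (g' i))%N.
  by move=> q'S; apply: eq_bigr => i iS; rewrite (g2E S).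
have [sum'E ct'E] : (\sum_(i in Q) z i * z (g' i) + (z q * z p + z q' * z p') =
    z q * z p' + z q' * z p + (z q * z p + \sum_(i in Q :\ q) z i * z (g2 i)))%N /\
    forall x y, (ct g' Q x y + ((C q == x) && (C p == y) + (C q' == x) && (C p' == y)) =
    ((C q == x) && (C p' == y) + (C q' == x) && (C p == y)) + ((C q == x) && (C p == y) + ct g2 (Q :\ q) x y))%N.
  rewrite (sumD g') -/p'; have [eqq|neqq] := eqVneq q' q.
    have q'S : q' \notin Q :\ q by rewrite eqq !inE eqxx.
    have eqp : p' = p by rewrite def_p eqq.
    split=> [|x y]; first by rewrite eq_sum // eqp eqq addnC.
    by rewrite (ctD g' _ _ _ _ qQ) -/p' eq_ct // eqp eqq addnC.
  have q'Q1 : q' \in Q :\ q by rewrite !inE neqq.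
  have q'S : q' \notin Q :\ q :\ q' by rewrite !inE eqxx.
  have g2q' : g2 q' = p' by rewrite /g2 eqxx.
  split=> [|x y].
    by rewrite (big_setD1 q') //= [in RHS](big_setD1 q') //= g2q' -def_p eq_sum //; apply: addn_shuffle.
  rewrite (ctD g' _ _ _ _ qQ) (ctD g' _ _ _ _ q'Q1) (ctD g2 _ _ _ _ q'Q1) g2q' -def_p -/p' eq_ct //.
  exact: addn_shuffle.
have [le_sum eq_sum2] := add_exchange sum'E exch (leq_add (leqnn (z q * z p)%N) le).
split=> [|eqS x y]; first by rewrite (sumD g).
have [eq_exch /eqc eq_ct1] : (z q * z p' + z q' * z p = z q * z p + z q' * z p')%N /\
    (\sum_(i in Q :\ q) z i * z (g2 i) = \sum_(i in Q :\ q) z i * z (g i))%N.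
  by move: eqS; rewrite (sumD g) => /eq_sum2[-> /addnI].
have E1 : ct g (Q :\ q) x y = ct g2 (Q :\ q) x y by apply/esym; apply: eq_ct1.
suff: ct g' Q x y = ct g Q x y by [].
rewrite [RHS](ctD g _ _ _ _ qQ) -/p E1; move: (ct'E x y).
(* Equality in the exchange gives two partners of a common element the same value, hence the same
   C. *)
have [eqp|eqq] := (mul_exchange le_p le_q).2 eq_exch.
  by rewrite (C1 _ _ _ Vp'q Vpq eqp) addnC => /addnI.
by rewrite (C2 _ _ _ Vpq' Vpq eqq) [X in (_ = X + _)%N]addnC addnC => /addnI.
Qed.

(** * Signs of Young elements commuting with a matching *)

Section CommutingSign.
Variables (K : numFieldType) (N : nat) (W : set nat) (nu : seq nat).
Local Notation e := (@color N nu).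
Local Notation od := (odd_color W).

(** The tail ranks above all blocks, since its positions come last. *)
Definition rank_color (c : option nat) := if c is Some i then i else size nu.

Lemma rank_color_inj (k j : 'I_N) : rank_color (e k) = rank_color (e j) -> e k = e j.
Proof.
have lt i h : e i = Some h -> (h < size nu)%N.
  by move/eqP; rewrite colorP => /block_lt[].
case ek: (e k) => [a|]; case ej: (e j) => [c|] //= eq; first by rewrite eq.
  by have := lt _ _ ek; rewrite eq ltnn.
by have := lt _ _ ej; rewrite -eq ltnn.
Qed.

(** The claim is that s is even on the even positions. Those matched with an odd color are fixed,
    being the only ones for their pair of colors; the remaining chords join different colors, so
    their ends of smaller rank form a transversal preserved by s and [even_commuting] applies. *)
Lemma chi_commuting (tau s : 'S_N) : admissible e od tau -> young e s ->
  (forall k, s (tau k) = tau (s k)) -> chi K e od s = (-1) ^+ s.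
Proof.
move=> [ft sam mix] Ys com; have inv : involutive tau by move=> k; case: (ft k).
have es := youngP _ _ Ys.
pose O := oddset e od; pose s1 := restr_perm O s; pose s2 := restr_perm (~: O) s.
have OE k : (k \in O) = od (e k) by rewrite inE.
have sO : s \in 'N(O | 'P)%g by apply: young_stab.
have sO' : s \in 'N(~: O | 'P)%g.
  by apply/stabP => k; rewrite !inE es.
have s1E k : k \in O -> s1 k = s k by move=> kO; rewrite /s1 restr_permE.
have s1O k : k \notin O -> s1 k = k.
  by move=> kO; rewrite (out_perm (restr_perm_on _ _) kO).
have s2E k : k \notin O -> s2 k = s k.
  by move=> kO; rewrite /s2 restr_permE // inE.
have s2O k : k \in O -> s2 k = k.
  by move=> kO; rewrite (out_perm (restr_perm_on _ _)) // inE negbK.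
have def_s : s = (s1 * s2)%g.
  apply/permP => k; rewrite permM; have [kO|kO] := boolP (k \in O).
    by rewrite s1E // s2O // OE es -OE.
  by rewrite s1O // s2E.
suff even2 : odd_perm s2 = false by rewrite /chi -/O {2}def_s odd_permM even2 addbF.
pose r k := rank_color (e k).
pose A := [set k | [&& k \notin O, tau k \notin O & (r k < r (tau k))%N]].
have fix_mixed k : k \notin O -> tau k \in O -> s k = k.
  rewrite !OE => kO tkO; apply: (@perm_inj _ tau); apply/esym.
  by apply: mix; rewrite ?inv -?com ?es.
have rs k : r (s k) = r k by rewrite /r es.
apply: (@even_commuting _ setT tau A) => //.
- apply/pred0P => k /=; apply/negP => /andP[+ /imsetP[j + def_k]].
  by rewrite def_k !inE inv => /and3P[_ _ lt] /and3P[_ _ /ltnW]; rewrite leqNgt lt.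
- move=> k; have [kO|kO] := boolP (k \in O); first by rewrite s2O.
  by rewrite s2E // /A !inE -com !es rs /r es.
- move=> k; have [kO|kO] := boolP (k \in O).
    rewrite (s2O k) //; have [tkO|tkO] := boolP (tau k \in O); first by rewrite s2O.
    by rewrite s2E // fix_mixed // inv.
  rewrite (s2E k) //; have [tkO|tkO] := boolP (tau k \in O); last by rewrite s2E // com.
  by rewrite s2O // fix_mixed.
move=> k; have [kO|kO] := boolP (k \in O); first by rewrite s2O.
rewrite s2E // !inE inv; have [tkO|tkO] := boolP (tau k \in O); first by rewrite fix_mixed.
move: (kO) (tkO); rewrite !OE => -> -> /=; rewrite -!leqNgt => le1 le2.
have /rank_color_inj/sam : r k = r (tau k) by apply/eqP; rewrite eqn_leq le1 le2.
by rewrite -OE (negbTE kO).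
Qed.

End CommutingSign.

Lemma omegaE (K : fieldType) l (x y : 'I_(l + l)) :
  omega K l x y = (val y == val x + l)%:R - (val x == val y + l)%:R.
Proof.
rewrite /omega; case: (split_ordP x) => i ->; case: (split_ordP y) => j ->;
  rewrite ?(block_mxEul, block_mxEur, block_mxEdl, block_mxEdr) !mxE /=.
- have := ltn_ord i; have := ltn_ord j => hj hi.
  have -> : (j == i + l :> nat)%N = false by apply/negP => /eqP; lia.
  have -> : (i == j + l :> nat)%N = false by apply/negP => /eqP; lia.
  by rewrite subrr.
- have -> : (i == l + j + l :> nat)%N = false by apply/negP => /eqP; have := ltn_ord i; lia.
  by rewrite subr0 addnC eqn_add2r eq_sym.
- have -> : (j == l + i + l :> nat)%N = false by apply/negP => /eqP; have := ltn_ord j; lia.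
  by rewrite sub0r addnC eqn_add2r.
have -> : (l + j == l + i + l :> nat)%N = false.
  by apply/negP => /eqP; have := ltn_ord j; lia.
have -> : (l + i == l + j + l :> nat)%N = false.
  by apply/negP => /eqP; have := ltn_ord i; lia.
by rewrite subrr.
Qed.

Lemma leq_half_union (a c r n : nat) : (a <= n + n)%N -> (c <= 1)%N ->
  (a + c = r + r)%N -> (r <= n)%N.
Proof. by lia. Qed.

Lemma dec_step_anti (W : set nat) p q : dec_step W p q -> dec_step W q p -> p = q.
Proof.
case: p q => [a c] [a' c'] /and4P[/= le1 le2 _ _] /and4P[/= le3 le4 _ _].
by congr pair; apply/eqP; rewrite eqn_leq ?le1 ?le2 ?le3 ?le4.
Qed.

(** * Heights in a finite strict order *)

Section Heights.
Variables (I : finType) (lt : rel I) (A : {set I}).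
Hypotheses (lt_irr : irreflexive lt) (lt_trans : transitive lt).

Definition lt_chain (X : {set I}) :=
  (X \subset A) && [forall x in X, forall y in X, (x != y) ==> lt x y || lt y x].

Definition chain_below k (X : {set I}) := lt_chain X && [forall x in X, lt x k].

Definition height k := \max_(X : {set I} | chain_below k X) #|X|.

Lemma chain_belowU k X : k \in A -> chain_below k X -> lt_chain (k |: X) /\ #|k |: X| = #|X|.+1.
Proof.
move=> kA /andP[/andP[XA /forall_inP chX] /forall_inP ltk]; split.
  apply/andP; split; first by rewrite subUset sub1set kA.
  apply/forall_inP => x; rewrite in_setU1 => xX; apply/forall_inP => y; rewrite in_setU1 => yX.
  apply/implyP; case/predU1P: xX => [->|xX]; case/predU1P: yX => [->|yX].
  - by rewrite eqxx.
  - by rewrite ltk ?orbT.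
  - by rewrite ltk.
  by move/forall_inP: (chX x xX) => /(_ y yX)/implyP.
rewrite cardsU1 (_ : k \notin X) //; apply/negP => /ltk.
by rewrite lt_irr.
Qed.

Lemma height_lt k j : k \in A -> j \in A -> lt k j -> (height k < height j)%N.
Proof.
move=> kA jA ltkj; have below X : chain_below k X -> (#|X| < height j)%N.
  move=> bX; have [ch <-] := chain_belowU kA bX.
  apply: (leq_bigmax_cond (F := fun X : {set I} => #|X|)); rewrite /chain_below ch /=.
  apply/forall_inP => x; rewrite in_setU1 => /predU1P[->//|xX].
  have /andP[_ /forall_inP ltX] := bX.
  exact: lt_trans (ltX x xX) ltkj.
have b0 : chain_below k set0.
  rewrite /chain_below /lt_chain sub0set /=.
  by apply/andP; split; apply/forall_inP => x; rewrite inE.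
rewrite -(prednK (leq_ltn_trans (leq0n _) (below _ b0))) ltnS.
by apply/bigmax_leqP => X /below; case: (height j).
Qed.

Lemma height_bound k n : k \in A -> (forall X, lt_chain X -> #|X| <= n)%N -> (height k < n)%N.
Proof.
move=> kA le_n; have below X : chain_below k X -> (#|X| < n)%N.
  by move=> bX; have [ch <-] := chain_belowU kA bX; apply: le_n.
have b0 : chain_below k set0.
  rewrite /chain_below /lt_chain sub0set /=.
  by apply/andP; split; apply/forall_inP => x; rewrite inE.
rewrite -(prednK (leq_ltn_trans (leq0n _) (below _ b0))) ltnS.
by apply/bigmax_leqP => X /below; case: n {le_n below}.
Qed.

End Heights.

(** * A word detecting each standard multiset *)

Section Independence.
Variables (K : numFieldType) (N l : nat) (W : set nat) (nu : seq nat).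
Implicit Types (tau s : 'S_N) (k j : 'I_N).
Local Notation e := (@color N nu).
Local Notation od := (odd_color W).
Local Notation adm := (admissible e od).
Local Notation symm := (symm (K := K) (l := l) e od).
Local Notation cpart := (@cpart N nu).
Local Notation cnum := (@cnum N nu).
Local Notation profile := (@profile N nu).
Local Notation pnt := (@pnt N nu).
Local Notation partner := (@partner N nu).
Local Notation rk k := (rank_color nu (e k)).

Lemma rank_mono k j : (k <= j)%N -> (rk k <= rk j)%N.
Proof.
move=> kj; rewrite /rank_color; case ej: (e j) => [c|].
  case ek: (e k) => [a|].
    move/eqP: ej; move/eqP: ek; rewrite !colorP !inE => /andP[k1 _] /andP[_ j2].
    rewrite leqNgt; apply/negP => ca.
    have := leq_trans j2 (leq_trans (leq_sumn_take nu ca) k1).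
    by rewrite ltnNge kj.
  have /eqP := ek; rewrite color_None leqNgt => /negP[].
  by move/eqP: ej; rewrite colorP => /block_lt[+ _]; apply: leq_ltn_trans.
case ek: (e k) => [a|] //.
by move/eqP: ek; rewrite colorP => /block_lt[_ /ltnW].
Qed.

Lemma rankE k : e k -> rk k = cnum k.
Proof. by move=> /cnumE ->. Qed.

Definition openers tau := [set k : 'I_N | (k < tau k)%N].

(** Nesting of chords. Chords over one point with both coordinates in W precede each other under
    [dec_step]; the positions break the tie and make the relation strict. *)
Definition outside tau k j :=
  ((pnt tau k != pnt tau j) || (k < j)%N) && dec_step W (pnt tau k) (pnt tau j).

Lemma outside_irr tau : irreflexive (outside tau).
Proof. by move=> k; rewrite /outside eqxx ltnn. Qed.

Lemma outside_trans tau : transitive (outside tau).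
Proof.
move=> j k i /andP[kj dkj] /andP[ji dji]; rewrite /outside (dec_step_trans dkj dji) andbT.
have [eqki|//] := eqVneq (pnt tau k) (pnt tau i); rewrite -eqki in dji.
have eqkj := dec_step_anti dkj dji; move: kj ji; rewrite -eqki eqkj eqxx /=.
exact: ltn_trans.
Qed.

Section Fixed.
Variable tau : 'S_N.
Hypothesis adm_t : adm tau.
Hypothesis ell_le : (ell_dec W (profile tau) <= l + l)%N.
Local Notation A := (openers tau).
Local Notation ht := (height (outside tau) A).

Let ft : fpf_involution tau. Proof. by case: adm_t. Qed.
Let tauK k : tau (tau k) = k. Proof. by case: (ft k). Qed.
Let tau_neq k : tau k != k. Proof. by apply/eqP; case: (ft k). Qed.

Lemma openers_tau k : (tau k \in A) = (k \notin A).
Proof.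
rewrite !inE tauK -leqNgt [RHS]leq_eqVlt (_ : (tau k == k :> nat) = false) //.
by apply/negbTE; exact: tau_neq.
Qed.

Lemma openers_colored k : k \in A -> e k.
Proof.
rewrite inE => lt; have [_ sam _] := adm_t; case ek: (isSome (e k)) => //.
have ekN : e k = None by case: (e k) ek.
have etN : e (tau k) = None.
  apply/eqP; rewrite color_None; apply: leq_trans (ltnW lt).
  by rewrite -color_None ekN.
by have := sam k; rewrite ekN etN => /(_ erefl).
Qed.

Lemma openers_up k : k \in A -> (cnum k <= cpart tau k)%N.
Proof.
move=> kA; have ek := openers_colored kA; rewrite /cpart.
case et: (e (tau k)) => [c|//]; rewrite -(rankE ek).
have := rank_mono (ltnW (_ : (k < tau k)%N)); rewrite inE in kA; move=> /(_ kA).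
by rewrite et.
Qed.

(** Openers lie on or above the diagonal, so X together with its mirror image is a chain of at most
    2l positions. The two halves share at most one position, a fixed point, so 2|X| <= 2l + 1, which
    still gives l. *)
Lemma lt_chain_card X : lt_chain (outside tau) A X -> (#|X| <= l)%N.
Proof.
move=> /andP[/subsetP XA /forall_inP chX].
have chX' : dec_chain W (fun k => e k : bool) (pnt tau) X.
  split=> [k /XA|k j kX jX kj]; first exact: openers_colored.
  have /forall_inP/(_ j jX)/implyP/(_ kj) := chX k kX.
  by rewrite /comparable_pts; case/orP => /andP[_ ->]; rewrite ?orbT.
have up : {in X, forall k, cnum k <= cpart tau k}%N by move=> k /XA/openers_up.
have chY := chain_symmetrize adm_t chX' up.
have le := leq_trans (dec_chain_le erefl chY) ell_le.
have [Xe cmp] := chX'.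
have fixE k : k \in X :&: partner tau @: X -> e (tau k) = None.
  rewrite in_setI => /andP[kX /imsetP[j jX]]; rewrite /partner.
  case: eqP => [tj -> //|_ def_k].
  by have := openers_tau j; rewrite -def_k !XA.
have le1 : (#|X :&: partner tau @: X| <= 1)%N.
  apply/card_le1_eqP => j k jXX kXX; apply/eqP/negPn/negP => kj.
  have [kX jX] : k \in X /\ j \in X by move: kXX jXX; rewrite !in_setI => /andP[-> _] /andP[-> _].
  exact: (two_fixed adm_t (fixE k kXX) (fixE j jXX) (Xe k kX) (Xe j jX) kj (cmp k j kX jX kj)).
have pinj : {in X &, injective (partner tau)}.
  by move=> k j kX jX eqp; rewrite -(partnerK ft (Xe k kX)) eqp partnerK // Xe.
have := cardsUI X (partner tau @: X); rewrite (card_in_imset pinj).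
exact: leq_half_union le le1.
Qed.

Definition level k := if k \in A then ht k else ht (tau k).

Lemma level_tau k : level (tau k) = level k.
Proof. by rewrite /level openers_tau tauK; case: (k \in A). Qed.

Lemma level_lt k : (level k < l)%N.
Proof.
have lt j : j \in A -> (ht j < l)%N.
  move=> jA; apply: height_bound => // [|X]; first exact: outside_irr.
  exact: lt_chain_card.
rewrite /level; case: ifP => kA; apply: lt => //.
by rewrite openers_tau kA.
Qed.

Lemma outside_level k j : k \in A -> j \in A -> outside tau k j -> level k = level j -> False.
Proof.
move=> kA jA out; rewrite /level kA jA => eqh.
have := height_lt (@outside_irr tau) (@outside_trans tau) kA jA out.
by rewrite eqh ltnn.
Qed.

(* A chord of nesting height h carries e_h at its left end and e_(-h) at its right
   end; heights stay below l because reflecting a nested family of chords in the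
   diagonal yields a decreasing sequence of about twice the length. *)
Definition letters w :=
  forall k, val (w k : 'I_(l + l)) = (if k \in A then level k else l + level k)%N.

Lemma letters_ex : exists w : word N l, letters w.
Proof.
have letter k : exists a : 'I_(l + l), val a = (if k \in A then level k else l + level k)%N.
  have lt : ((if k \in A then level k else l + level k) < l + l)%N.
    by have := level_lt k; case: ifP => _ ?; rewrite ?ltn_add2l // ltn_addr.
  by exists (Ordinal lt).
have [f fE] := fin_all_exists letter.
by exists [ffun k => f k] => k; rewrite ffunE.
Qed.

(** Infinity gets the least value here although its rank is the greatest: a chord to infinity is
    ordered as the point (i, i), and i <= c whenever its opener could be matched with a closer of
    color c. *)
Definition zval k := if e k is Some i then i.+1 else 0%N.

(* The leading part key1 is largest when every opener is matched with a position
   that is not of a smaller color; key2 is the cost of max_assignment. *)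
Definition key1 x := (\sum_k minn (rk k) (rk ((x : 'S_N) k)))%N.
Definition key2 x := (\sum_k zval k * zval ((x : 'S_N) k))%N.
Definition key x := (key1 x * (N * size nu ^ 2).+1 + key2 x)%N.

Lemma zval_color k j : zval k = zval j -> e k = e j.
Proof. by rewrite /zval; case: (e k) => [a|]; case: (e j) => [c|] // [->]. Qed.

Lemma zval_le k : (zval k <= size nu)%N.
Proof.
rewrite /zval; case ek: (e k) => [a|] //.
by move/eqP: ek; rewrite colorP => /block_lt[].
Qed.

(** The multiplier in [key] comes from this bound, so that [key] compares lexicographically, [key1]
    first. *)
Lemma key2_lt x : (key2 x < (N * size nu ^ 2).+1)%N.
Proof.
rewrite ltnS; apply: leq_trans (_ : \sum_(k < N) size nu ^ 2 <= _)%N.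
  by apply: leq_sum => k _; rewrite leq_mul ?zval_le.
by rewrite sum_nat_const card_ord.
Qed.

Lemma key_lt x y : (key1 x <= key1 y)%N -> (key1 x = key1 y -> key2 x < key2 y)%N ->
  (key x < key y)%N.
Proof.
rewrite leq_eqVlt => /predU1P[eq1|lt1] lt2; first by rewrite /key eq1 ltn_add2l lt2.
rewrite /key; apply: leq_trans (leq_addr _ _).
by apply: leq_trans (leq_mul lt1 (leqnn _)); rewrite mulSn addnC ltn_add2r key2_lt.
Qed.

Lemma key_conj x s : young e s -> key (x ^ s)%g = key x.
Proof.
move=> /youngP es; rewrite /key /key1 /key2; congr (_ * _ + _)%N;
  rewrite [LHS](reindex_inj (@perm_inj _ s)); apply: eq_bigr => k _;
  by rewrite conj_permE /zval !es.
Qed.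

Lemma admissible_conj x s : young e s -> adm x -> adm (x ^ s)%g.
Proof.
move=> Ys [fx sam mix]; have es := youngP _ _ Ys; have esV := youngP _ _ (youngV Ys).
have xE k : e ((x ^ s)%g k) = e (x (s^-1 k)%g) by rewrite conjgE !permM es.
split=> [|k|k j]; first exact: fpf_conj.
  by rewrite xE -(esV k) => /sam.
rewrite !xE -(esV k) -(esV j) => e1 e2 o1 o2.
by apply: (@perm_inj _ s^-1%g); apply: mix.
Qed.

Lemma profile_conj x s : young e s -> profile (x ^ s)%g = profile x.
Proof.
move=> Ys; have es := youngP _ _ Ys; have esV := youngP _ _ (youngV Ys).
have cE a c : cnt nu (x ^ s)%g a c = cnt nu x a c.
  rewrite /cnt -(@pair_count_conj _ _ e setT x s) //.
    by apply: eq_card => k; rewrite !inE conjgE !permM.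
  by apply/subsetP => k; rewrite inE.
by apply/msetP => -[i j]; rewrite !profileE !cE.
Qed.

Section Compatible.
Variable w : word N l.
Hypothesis lw : letters w.

Lemma letter_inj k j : (k \in A) = (j \in A) -> level k = level j -> w k = w j.
Proof. by move=> eqA eql; apply: val_inj; rewrite /= !lw eqA eql. Qed.

Lemma T_inv_word : T_inv K l tau w = 1.
Proof.
rewrite T_invE big1 // => k lt; have kA : k \in A by rewrite inE.
have tkA : tau k \notin A by rewrite openers_tau kA.
rewrite omegaE /= !lw kA (negbTE tkA) level_tau [(l + level k)%N]addnC eqxx.
rewrite (_ : (level k == level k + l + l)%N = false) ?subr0 //.
by apply/negP => /eqP E; have := level_lt k; lia.
Qed.

(** An entry of J is nonzero only between e_h and e_(-h), and these letters record the level and the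
    side of a chord. *)
Lemma word_compatible x : fpf_involution x -> T_inv K l x w != 0 ->
  forall k, ((x k \in A) = (k \notin A)) * (level (x k) = level k).
Proof.
move=> fx nz; have xK k : x (x k) = k by case: (fx k).
have main k : (k < x k)%N -> ((x k \in A) = (k \notin A)) * (level (x k) = level k).
  move=> lt; have : omega K l (w k) (w (x k)) != 0.
    by apply: contraNneq nz => om0; rewrite T_invE (bigD1 k) //= om0 mul0r.
  rewrite omegaE /= !lw; have := level_lt k; have := level_lt (x k).
  case: (k \in A); case: (x k \in A); move: (level k) (level (x k)) => a c lt1 lt2.
  - rewrite (_ : (c == a + l)%N = false) 1?(_ : (a == c + l)%N = false) ?subrr ?eqxx //;
      by apply/negP => /eqP; lia.
  - rewrite (_ : (a == l + c + l)%N = false); last by apply/negP => /eqP; lia.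
    rewrite addnC eqn_add2r; have [->//|_] := eqVneq c a; by rewrite subrr eqxx.
  - rewrite (_ : (c == l + a + l)%N = false); last by apply/negP => /eqP; lia.
    rewrite [(l + a)%N]addnC eqn_add2r; have [->//|_] := eqVneq a c; by rewrite subrr eqxx.
  rewrite (_ : (l + c == l + a + l)%N = false) 1?(_ : (l + a == l + c + l)%N = false) ?subrr ?eqxx //;
    by apply/negP => /eqP; lia.
move=> k; have [lt|gt|/val_inj eqk] := ltngtP k (x k); first exact: main.
  by have := main (x k); rewrite xK => /(_ gt)[-> ->]; rewrite negbK.
by case: (fx k) => _; rewrite -eqk.
Qed.

Lemma sum_half (B : {set 'I_N}) x (F : 'I_N -> 'I_N -> nat) : fpf_involution x ->
  (forall k, (x k \in B) = (k \notin B)) -> (forall k j, F k j = F j k) ->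
  (\sum_k F k (x k) = (\sum_(k in B) F k (x k)).*2)%N.
Proof.
move=> fx xB symF; rewrite (bigID (mem B)) /= -addnn; congr addn.
rewrite (reindex_inj (@perm_inj _ x)); apply: eq_big => k.
  by rewrite /= xB negbK.
by move=> _; rewrite symF; case: (fx k) => ->.
Qed.

(** [key1] is maximal at [tau], whose openers never have a larger color than their partners. If x
    ties, it has this property too, and [max_assignment] on the closers compares [key2]. Equality
    there gives equal counts of pairs of color and letter, hence a conjugation fixing w. *)
Lemma key_compatible x : adm x -> T_inv K l x w != 0 ->
  (key x < key tau)%N \/
  exists s, [/\ young e s, forall k, w (s k) = w k & x = (tau ^ s)%g].
Proof.
move=> adm_x nz; have [fx samx _] := adm_x; have [_ sam _] := adm_t.
have xK k : x (x k) = k by case: (fx k).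
have comp := word_compatible fx nz.
have xA k := (comp k).1; have xlev k := (comp k).2.
have AE k : k \in A -> (k < tau k)%N by rewrite inE.
have key1E y : fpf_involution y -> (forall k, (y k \in A) = (k \notin A)) ->
    key1 y = (\sum_(k in A) minn (rk k) (rk (y k))).*2.
  move=> fy yA; rewrite /key1 (sum_half (F := fun k j => minn (rk k) (rk j)) fy yA) // => k j.
  exact: minnC.
have key1T : key1 tau = (\sum_(k in A) rk k).*2.
  rewrite (key1E _ ft openers_tau); congr double; apply: eq_bigr => k kA.
  by apply/minn_idPl; apply: rank_mono; apply: ltnW; apply: AE.
have leif : (\sum_(k in A) minn (rk k) (rk (x k)) <= \sum_(k in A) rk k
    ?= iff [forall (k | k \in A), minn (rk k) (rk (x k)) == rk k])%N.
  by apply: leqif_sum => k _; split=> //; apply: geq_minl.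
have [lt1|] := boolP (key1 x < key1 tau)%N.
  by left; apply: key_lt (ltnW lt1) _ => eq1; rewrite eq1 ltnn in lt1.
rewrite -leqNgt key1T (key1E _ fx xA) leq_double => le1.
have eq1 : key1 x = key1 tau.
  by rewrite key1T (key1E _ fx xA); congr double; apply/eqP; rewrite eqn_leq le1 leif.1.
have up k : k \in A -> (rk k <= rk (x k))%N.
  move=> kA; have /eqP : (\sum_(k in A) minn (rk k) (rk (x k)) == \sum_(k in A) rk k)%N.
    by rewrite eqn_leq le1 leif.1.
  by move=> /eqP; rewrite leif.2 => /forall_inP/(_ k kA)/eqP/minn_idPl.
pose C k := (e k, w k).
(* Both matchings satisfy V once [key1] ties; its color condition is what orders a chord to infinity
   against another chord below. *)
pose V p q := [&& p \in A, q \notin A, level p == level q &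
  [|| e q == None, rk p < rk q | (rk p == rk q) && od (e q)]%N].
have Cc (k j : 'I_N) : (k \in A) = (j \in A) -> level k = level j -> zval k = zval j -> C k = C j.
  by move=> eqA eql /zval_color eqe; rewrite /C eqe (letter_inj eqA eql).
have zrk k : e k -> zval k = (rk k).+1 by rewrite /zval; case: (e k).
have Ve k : k \in A -> e k by apply: openers_colored.
have rk_eq k j : rk k = rk j -> e k = e j by apply: rank_color_inj.
have key2E y : fpf_involution y -> (forall k, (y k \in A) = (k \notin A)) ->
    key2 y = (\sum_(k in ~: A) zval k * zval (y k)).*2.
  move=> fy yA; rewrite /key2 (sum_half (B := ~: A) (F := fun k j => zval k * zval j)%N fy) //.
    by move=> k; rewrite !in_setC yA.
  by move=> k j; apply: mulnC.
have [|||||||||le2 eq2] := @max_assignment _ _ C zval V (~: A) tau x.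
- move=> p p' q /and4P[pA _ /eqP lp _] /and4P[p'A _ /eqP lp' _]; apply: Cc; first by rewrite pA p'A.
  by rewrite lp lp'.
- move=> p q q' /and4P[_ qA /eqP lp _] /and4P[_ q'A /eqP lp' _]; apply: Cc.
    by rewrite (negbTE qA) (negbTE q'A).
  by rewrite -lp -lp'.
- move=> p p' q q' /and4P[pA qA /eqP lp _] /and4P[p'A _ /eqP lp' _] /and4P[_ q'A /eqP lpq' cond].
  rewrite !zrk ?Ve // ltnS => le; rewrite /V p'A q'A lp' -lp lpq' eqxx /=.
  move: le; rewrite leq_eqVlt => /predU1P[->//|lt].
  case/or3P: cond => [->//|lt2|/andP[/eqP <- _]]; first by rewrite (ltn_trans lt lt2) orbT.
  by rewrite lt orbT.
- by move=> q q' _ _; apply: perm_inj.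
- by move=> q q' _ _; apply: perm_inj.
- move=> q; rewrite in_setC => qA; apply/imsetP; exists (tau (x q)); last by rewrite tauK.
  by rewrite in_setC openers_tau xA qA.
- move=> q; rewrite in_setC => qA; rewrite /V openers_tau qA level_tau eqxx /=.
  have le : (rk (tau q) <= rk q)%N.
    by apply: rank_mono; rewrite -{2}(tauK q); apply/ltnW/AE; rewrite openers_tau.
  move: le; rewrite leq_eqVlt => /predU1P[eqr|->]; last by rewrite orbT.
  by rewrite eqr eqxx ltnn (sam q (rk_eq _ _ (esym eqr))) orbT.
- move=> q; rewrite in_setC => qA; rewrite /V xA qA xlev eqxx /=.
  have le : (rk (x q) <= rk q)%N by have := up (x q); rewrite xA xK; apply.
  move: le; rewrite leq_eqVlt => /predU1P[eqr|->]; last by rewrite orbT.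
  by rewrite eqr eqxx ltnn (samx q (rk_eq _ _ (esym eqr))) orbT.
(* A failure of optimality would put the chord of q outside the chord of q2, against their equal
   level. *)
- move=> q q2; rewrite !in_setC => qA q2A /and4P[kA _ /eqP lev cond] ltz.
  have pA : tau q \in A by rewrite openers_tau.
  rewrite leqNgt; apply/negP => lt_z.
  apply: (outside_level pA kA); last by rewrite level_tau lev.
  have [ep ek] := (Ve _ pA, Ve _ kA); rewrite !zrk // ltnS in ltz.
  have eq : e q by move: lt_z; rewrite /zval; case: (e q).
  have cp : cpart tau (tau q) = cnum q.
    by rewrite /cpart tauK (cnumE eq).
  rewrite !rankE // in ltz.
  have dec : dec_step W (pnt tau (tau q)) (pnt tau (tau q2)).
    rewrite /dec_step /= cp (ltnW ltz) (ltn_eqF ltz) /=.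
    case e2: (e q2) => [c|].
      have -> : cpart tau (tau q2) = c by rewrite /cpart tauK e2.
      have lt : (c < cnum q)%N by move: lt_z; rewrite (zrk q) // rankE // /zval e2 ltnS.
      by rewrite (ltnW lt) eq_sym (ltn_eqF lt).
    have -> : cpart tau (tau q2) = cnum (tau q2) by rewrite /cpart tauK e2.
    move: cond; rewrite !rankE //; case: eqP => [eN|_]; first by rewrite eN in eq.
    move=> /= /orP[lt|/andP[/eqP ckq ok]]; first by rewrite (ltnW lt) eq_sym (ltn_eqF lt).
    by rewrite ckq leqnn eqxx /= -oddE.
  rewrite /outside dec andbT; apply/orP; left.
  by apply: contraTneq ltz => -[-> _]; rewrite ltnn.
move: le2; rewrite leq_eqVlt => /predU1P[eqs|lt2]; last first.
  left; apply: key_lt; rewrite ?eq1 // => _.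
  by rewrite (key2E _ fx xA) (key2E _ ft openers_tau) ltn_double.
right; have cnts := eq2 eqs.
have pcE y c1 c2 : fpf_involution y -> (forall k, (y k \in A) = (k \notin A)) ->
    pair_count C setT y c1 c2 =
    (#|[set q in ~: A | (C q == c1) && (C (y q) == c2)]| +
     #|[set q in ~: A | (C q == c2) && (C (y q) == c1)]|)%N.
  move=> fy yA; have yK k : y (y k) = k by case: (fy k).
  rewrite /pair_count -[LHS](cardsID A) [LHS]addnC; congr addn.
    by apply: eq_card => k; rewrite in_setD [X in _ && X = _]in_set [RHS]in_set in_setC in_setT.
  rewrite -(card_imset _ (@perm_inj _ y)); apply: eq_card => k.
  rewrite -[k in LHS]yK mem_imset; last exact: perm_inj.
  by rewrite in_setI yA [X in X && _ = _]in_set [RHS]in_set in_setC in_setT yK /= andbC [X in _ && X]andbC.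
have [||c1 c2|s [_ sC com]] := @matching_conj N _ C setT tau x.
- by apply: matching_on_fpf => // k _; rewrite inE.
- by apply: matching_on_fpf => // k _; rewrite inE.
- by rewrite (pcE _ _ _ ft openers_tau) (pcE _ _ _ fx xA) !cnts.
exists s; split.
- by apply/youngP => k; case: (sC k).
- by move=> k; case: (sC k).
by apply/permP => k; rewrite -(permKV s k) com ?inE // conj_permE.
Qed.

(** Equal letters make both positions openers, or both closers, of one level. A shared coordinate in
    W makes the chords nested, against the equal levels; the exception is a common even color at the
    other ends, where admissibility leaves a single chord. *)
Lemma odd_letters k j : e k = e j -> od (e k) -> w k = w j -> k = j.
Proof.
have [_ _ mix] := adm_t.
wlog kj : k j / (k < j)%N => [hwlog ekj ok wkj|ekj ok wkj].
  have [lt|gt|/val_inj //] := ltngtP k j; first exact: hwlog.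
  by apply/esym; apply: hwlog => //; rewrite -ekj.
have ek : e k by case: (e k) ok.
have ej : e j by rewrite -ekj.
have eqc : cnum k = cnum j by rewrite /cnum ekj.
have cW : cnum k \in W by rewrite -oddE.
have eqA : (k \in A) = (j \in A) /\ level k = level j.
  have := congr1 val wkj; rewrite /= !lw; have := level_lt k; have := level_lt j.
  by case: (k \in A); case: (j \in A) => h1 h2 h3; split=> //; lia.
have [{}eqA eql] := eqA.
have no_out p q : p \in A -> q \in A -> level p = level q -> cnum p = cnum q ->
    cnum p \in W -> cpart tau p = cpart tau q.
  move=> pA qA lpq cpq pW; apply/eqP/negPn/negP => neq.
  have dec p' q' : p' \in A -> q' \in A -> cnum p' = cnum q' -> cnum p' \in W ->
      level p' = level q' -> (cpart tau q' < cpart tau p')%N -> False.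
    move=> p'A q'A c' W' l' lt; apply: (outside_level p'A q'A) l'.
    rewrite /outside /dec_step /= c' leqnn eqxx -c' W' (ltnW lt) (gtn_eqF lt) /= andbT.
    by apply/orP; left; apply: contraTneq lt => -[_ ->]; rewrite ltnn.
  case: (ltngtP (cpart tau p) (cpart tau q)) neq => // lt _.
    by apply: (dec q p) lt; rewrite -?cpq.
  exact: (dec p q) lt.
have no_out2 p q : p \in A -> q \in A -> level p = level q -> cpart tau p = cpart tau q ->
    cpart tau p \in W -> cnum p = cnum q.
  move=> pA qA lpq cpq pW; apply/eqP/negPn/negP => neq.
  have dec p' q' : p' \in A -> q' \in A -> cpart tau p' = cpart tau q' -> cpart tau p' \in W ->
      level p' = level q' -> (cnum p' < cnum q')%N -> False.
    move=> p'A q'A c' W' l' lt; apply: (outside_level p'A q'A) l'.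
    rewrite /outside /dec_step /= (ltnW lt) (ltn_eqF lt) c' leqnn eqxx -c' W' /= andbT.
    by apply/orP; left; apply: contraTneq lt => -[-> _]; rewrite ltnn.
  case: (ltngtP (cnum p) (cnum q)) neq => // lt _; first exact: (dec p q) lt.
  by apply: (dec q p) lt; rewrite -?cpq.
have same p q : p \in A -> q \in A -> level p = level q -> cnum p = cnum q ->
    cpart tau p = cpart tau q -> cnum p \in W -> cpart tau p \in W -> p = q.
  move=> pA qA lpq c1 c2 W1 W2; apply: val_inj; apply/eqP/negPn/negP => neq.
  have dec p' q' : p' \in A -> q' \in A -> pnt tau p' = pnt tau q' -> cnum p' \in W ->
      cpart tau p' \in W -> level p' = level q' -> (p' < q')%N -> False.
    move=> p'A q'A c' W1' W2' l' lt; apply: (outside_level p'A q'A) l'.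
    by rewrite /outside lt orbT /dec_step -c' !leqnn !eqxx /= W1' W2'.
  case: (ltngtP (val p) (val q)) neq => // lt _.
    by apply: (dec p q) lt; rewrite // /pnt c1 c2.
  by apply: (dec q p) lt; rewrite -?c1 -?c2 // /pnt c1 c2.
have [kA|kA] := boolP (k \in A).
  have jA : j \in A by rewrite -eqA.
  have eqp := no_out k j kA jA eql eqc cW.
  have [pW|pW] := boolP (cpart tau k \in W); first exact: same.
  have pE i : cnum i \in W -> cpart tau i \notin W -> e (tau i) = Some (cpart tau i).
    by move=> iW; rewrite /cpart; case: (e (tau i)) => // /negP.
  apply: mix => //; first by rewrite !pE -?eqp -?eqc.
  by rewrite pE.
have jA : j \notin A by rewrite -eqA.
have [tkA tjA] : tau k \in A /\ tau j \in A by rewrite !openers_tau.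
have cE i : e i -> cpart tau (tau i) = cnum i by move=> ei; rewrite /cpart tauK (cnumE ei).
have eqt : cnum (tau k) = cnum (tau j).
  by apply: no_out2 => //; rewrite ?level_tau ?cE // -?eqc.
have [tkW|tkW] := boolP (cnum (tau k) \in W).
  by apply: (@perm_inj _ tau); apply: same => //; rewrite ?level_tau ?cE.
apply: mix => //; first exact: cnum_inj (openers_colored tkA) (openers_colored tjA) eqt.
by rewrite oddE // openers_colored.
Qed.

Lemma perm_act_word x s : fpf_involution x -> perm_act s (T_inv K l x) w != 0 ->
  T_inv K l (x ^ s^-1)%g w != 0.
Proof.
move=> fx; have [eps] := T_inv_perm K l s^-1%g fx; rewrite invgK => ->.
by rewrite ffunE; apply: contraNneq => ->; rewrite scaler0.
Qed.

Lemma symmE t : symm t w = \sum_(s | young e s) chi K e od s * perm_act s t w.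
Proof. by rewrite /symm sum_ffunE; apply: eq_bigr => s _; rewrite ffunE. Qed.

Lemma symm_word x : adm x -> symm (T_inv K l x) w != 0 ->
  (key x < key tau)%N \/ profile x = profile tau.
Proof.
move=> adm_x; have [fx _ _] := adm_x; rewrite symmE => nz.
have [s Ys nzs] : exists2 s, young e s & perm_act s (T_inv K l x) w != 0.
  apply/exists2P; apply: contraNP nz => none; apply/eqP; apply: big1 => s Ys.
  have [->|nzs] := eqVneq (perm_act s (T_inv K l x) w) 0; first exact: mulr0.
  by case: none; exists s.
have YV := youngV Ys; have := key_compatible (admissible_conj YV adm_x) (perm_act_word fx nzs).
rewrite key_conj // => -[lt|[r [Yr _ def_x]]]; first by left.
by right; rewrite -(profile_conj x YV) def_x profile_conj.
Qed.

(** Every nonzero term at w equals 1: s splits into a factor fixing w, trivial on odd positions by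
    [odd_letters], and a factor commuting with [tau], on which [chi] is the sign. The identity
    contributes, so the coordinate is a positive integer. *)
Lemma symm_self : symm (T_inv K l tau) w != 0.
Proof.
have term s : young e s -> perm_act s (T_inv K l tau) w != 0 ->
    chi K e od s * perm_act s (T_inv K l tau) w = 1.
  move=> Ys nzs; have YV := youngV Ys.
  have := key_compatible (admissible_conj YV adm_t) (perm_act_word ft nzs).
  rewrite key_conj // ltnn => -[//|[r [Yr wr def_t]]].
  pose c := (s^-1 * r^-1)%g.
  have com_c k : c (tau k) = tau (c k).
    by rewrite /c !permM -(conj_permE tau s^-1%g k) def_t conjgE !permM permK.
  have com_cV k : c^-1%g (tau k) = tau (c^-1%g k).
    by apply: (@perm_inj _ c); rewrite permKV com_c permKV.
  have Yc : young e c by rewrite youngM ?youngV.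
  have def_s : s = (r^-1 * c^-1)%g by rewrite /c invMg !invgK mulKg.
  rewrite def_s perm_actM T_inv_commuting // perm_actZ ffunE.
  rewrite chiM ?youngV // [chi K e od c^-1](chi_commuting _ adm_t) ?youngV //.
  rewrite [chi K e od r^-1]chi_fix ?mul1r; last first.
    move=> k; rewrite inE => ok; have er := youngP _ _ (youngV Yr).
    by apply: odd_letters; rewrite ?er // -[in RHS](permKV r k) wr.
  rewrite perm_actE invgK.
  have -> : wperm w r = w by apply/ffunP => k; rewrite ffunE wr.
  by rewrite T_inv_word -[_ *: _]/(_ * _) mulr1 -signr_addb addbb.
rewrite symmE (bigID (fun s => perm_act s (T_inv K l tau) w != 0)) /=.
rewrite [X in _ + X]big1 => [|s /andP[_]]; last by rewrite negbK => /eqP ->; apply: mulr0.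
rewrite addr0 (eq_bigr (fun _ => 1)) => [|s /andP[]]; last exact: term.
rewrite sumr_const pnatr_eq0 -lt0n; apply/card_gt0P; exists 1%g.
by rewrite unfold_in young1 perm_act1 T_inv_word oner_neq0.
Qed.

End Compatible.

End Fixed.

End Independence.

(** * The basis *)

(** In a vanishing combination, an index of least weight among the nonzero coefficients is isolated
    by its w, since any other term seen there would have smaller weight. *)
Lemma free_triangular (K : fieldType) (N l : nat) (I : eqType) (f : I -> tensor K N l)
    (wt : I -> nat) (r : seq I) : uniq r ->
    (forall i, i \in r -> exists w, f i w != 0 /\
       forall j, j \in r -> f j w != 0 -> (wt j < wt i)%N \/ j = i) ->
  free [seq f i | i <- r].
Proof.
move=> ur tri; set X := map f r; suff : free (in_tuple X) by [].
apply/freeP => c; rewrite /= => sum0 i0; apply/eqP/negPn/negP => ci0.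
have sX : size X = size r by rewrite size_map.
have /hasP[x0 _ _] : has predT r.
  by rewrite has_predT -sX; apply: leq_trans (ltn_ord i0).
have XE (i : 'I_(size X)) : X`_i = f (nth x0 r i) by rewrite (nth_map x0) // -sX.
have mem (i : 'I_(size X)) : nth x0 r i \in r by rewrite mem_nth // -sX.
pose i := [arg min_(i < i0 | c i != 0) wt (nth x0 r i)].
have [ci imin] : c i != 0 /\ forall j, c j != 0 -> (wt (nth x0 r i) <= wt (nth x0 r j))%N.
  by rewrite /i; case: arg_minnP.
have [w [fw lw]] := tri _ (mem i).
have := congr1 (fun t : tensor K N l => t w) sum0; rewrite sum_ffunE ffunE.
rewrite (bigD1 i) //= big1 => [|j ji].
  rewrite addr0 ffunE XE => /eqP; rewrite mulf_eq0 (negbTE ci) /=.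
  by rewrite (negbTE fw).
rewrite ffunE XE; have [->|cj] := eqVneq (c j) 0; first exact: mul0r.
have [->|fj] := eqVneq (f (nth x0 r j) w) 0; first exact: mulr0.
have [lt|eqij] := lw _ (mem j) fj; first by rewrite ltnNge imin in lt.
case/eqP: ji; apply: val_inj; apply/eqP.
by rewrite -(nth_uniq x0 _ _ ur); [apply/eqP | rewrite -sX; apply: ltn_ord | rewrite -sX; apply: ltn_ord].
Qed.

Lemma tensor_pow_is_linear (K : fieldType) N l (U : 'M[K]_(l + l)) :
  linear (@tensor_pow K N l U).
Proof.
move=> a t t'; rewrite /tensor_pow scaler_sumr -big_split.
by apply: eq_bigr => w _; rewrite !ffunE scalerDl scalerA.
Qed.
HB.instance Definition _ (K : fieldType) N l (U : 'M[K]_(l + l)) :=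
  GRing.isLinear.Build K (tensor K N l)
  (tensor K N l) _ (@tensor_pow K N l U) (@tensor_pow_is_linear K N l U).

Section Basis.
Variables (K : numClosedFieldType) (N l : nat) (W : set nat) (nu : seq nat) (b : nat).
Variable tau : {mset nat * nat}%mset -> 'S_N.
Hypothesis sN : (sumn nu + b = N)%N.
Hypothesis realize : forall M, MSW W nu b M -> realizes W nu (tau M) M.
Local Notation e := (@color N nu).
Local Notation od := (odd_color W).
Local Notation adm := (admissible e od).
Local Notation symm := (symm (K := K) (l := l) e od).
Local Notation T := (T_inv K l).

Definition standard M := MSW W nu b M /\ (ell_dec W M <= 2 * l)%N.

(** Finiteness of the index set: a multiset in [MSW] is the profile of a matching realizing it, so
    it occurs among the profiles of permutations. *)
Definition standard_seq :=
  undup [seq M <- [seq profile nu x | x <- enum 'S_N] | `[< standard M >]].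

Lemma standard_seqP M : M \in standard_seq <-> standard M.
Proof.
rewrite mem_undup mem_filter; split=> [/andP[/asboolP]//|stM].
apply/andP; split; first exact/asboolP.
apply/mapP; exists (tau M); first by rewrite mem_enum.
by have [_ ->] := realizes_profile stM.1 (realize stM.1).
Qed.

Lemma symm_conj_mem x s (U : {vspace tensor K N l}) : fpf_involution x -> young e s ->
  symm (T x) \in U -> symm (T (x ^ s)%g) \in U.
Proof.
move=> fx Ys xU; have [eps E] := T_inv_perm K l s fx.
have -> : T (x ^ s)%g = (-1) ^+ eps *: perm_act s^-1%g (T x).
  by rewrite E scalerA -signr_addb addbb scale1r.
by rewrite linearZ memvZ //= symm_perm ?youngV // memvZ.
Qed.

(** Downward induction on the weight, which is bounded over the finite group; straightening produces
    only larger weights. *)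
Lemma admissible_span x : adm x ->
  symm (T x) \in <<[seq symm (T (tau M)) | M <- standard_seq]>>%VS.
Proof.
set U := <<_>>%VS; pose bound := \max_(y : 'S_N) weight nu y.
have [m] := ubnP (bound - weight nu x)%N; elim: m => // m IH in x *.
move=> lt_m adm_x; have [fx _ _] := adm_x.
have [le|lt] := leqP (ell_dec W (profile nu x)) (l + l)%N.
  set M := profile nu x in le; have MS : MSW W nu b M by apply: admissible_MSW.
  have stM : standard M by split; rewrite // mul2n -addnn.
  have [s Ys ->] := realizes_conj (realize MS) (admissible_realizes adm_x).
  apply: symm_conj_mem => //; first by case: (realize MS).
  by apply: memv_span; apply/mapP; exists M => //; apply/standard_seqP.
apply: (@straighten K N l W nu x U adm_x lt) => y adm_y lt_w; apply: IH adm_y.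
have le_b : (weight nu y <= bound)%N by apply: leq_bigmax.
rewrite ltnS in lt_m; apply: leq_trans lt_m.
by rewrite ltn_sub2l // (leq_trans lt_w).
Qed.

Lemma standard_free : free [seq symm (T (tau M)) | M <- standard_seq].
Proof.
apply: (free_triangular (wt := fun M => key nu (tau M))); first exact: undup_uniq.
move=> M /standard_seqP[MS le]; have [adm_M prof_M] := realizes_profile MS (realize MS).
have le' : (ell_dec W (profile nu (tau M)) <= l + l)%N by rewrite prof_M addnn -mul2n.
have [w lw] := letters_ex adm_M le'.
exists w; split; first exact: (symm_self K adm_M le' lw).
move=> M' /standard_seqP[MS' _] nz.
have [adm_M' prof_M'] := realizes_profile MS' (realize MS').
by have [|eqp] := symm_word adm_M le' lw adm_M' nz; [left|right; rewrite -prof_M -prof_M'].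
Qed.

Lemma standard_span t : t \in <<[seq symm (T (tau M)) | M <- standard_seq]>>%VS <->
  exists2 u, invariants K N l u & symm u = t.
Proof.
split=> [|[u inv_u <-]]; last first.
  move: u {inv_u} (invariants_span inv_u); apply: span_preserved => x /mapP[y].
  rewrite mem_enum => /matchingT fy ->; rewrite /=.
  have [->|nz] := eqVneq (symm (T y)) 0; first exact: mem0v.
  exact/admissible_span/(symm_neq0_admissible fy nz).
move=> t_span; pose X := [seq symm (T (tau M)) | M <- standard_seq].
have sX : size X = size standard_seq by rewrite size_map.
have := coord_span (X := in_tuple X) t_span.
set c := fun i => coord (in_tuple X) i t; move=> def_t.
(* The same coefficients on the unsymmetrized matching tensors, which are invariant, give a
   preimage. *)
pose u := \sum_(i < size X) c i *: T (tau (nth mset0 standard_seq i)).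
exists u.
  move=> g Sg; rewrite /u linear_sum; apply: eq_bigr => i _; rewrite linearZ /=.
  have /standard_seqP[MS _] : nth mset0 standard_seq i \in standard_seq.
    by rewrite mem_nth // -sX.
  by rewrite T_inv_invariant //; case: (realize MS).
rewrite /u linear_sum def_t; apply: eq_bigr => i _; rewrite linearZ /=; congr (_ *: _).
by rewrite /= (nth_map mset0) // -sX.
Qed.

End Basis.

Local Close Scope ring_scope.

Theorem theorem8p8 (R : realType) (W : set nat) (l b n : nat) (nu : seq nat)
    (tau : {mset nat * nat}%mset -> 'S_(2 * n)) :
  sumn nu + b = 2 * n ->
  (forall M, MSW W nu b M -> realizes W nu (tau M) M) ->
  basis_family
    [set M | MSW W nu b M /\ ell_dec W M <= 2 * l]%classic
    (fun M => T_mset R[i]%C l W nu b (tau M))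
    (gr_act (PiS R[i]%C (2 * n) W nu b) @` invariants R[i]%C (2 * n) l)%classic.
Proof.
move=> sN realize; have actE t : gr_act (PiS R[i]%C (2 * n) W nu b) t =
    symm (color nu) (odd_color W) t.
  by rewrite (PiSE _ _ sN) gr_act_youngsum.
exists (standard_seq (2 * n) l W nu b).
have -> : [seq T_mset R[i]%C l W nu b (tau M) | M <- standard_seq (2 * n) l W nu b] =
    [seq symm (color nu) (odd_color W) (T_inv R[i]%C l (tau M)) | M <- standard_seq (2 * n) l W nu b].
  by apply: eq_map => M; rewrite /T_mset actE.
split.
- exact: undup_uniq.
- exact: (standard_seqP l realize).
- exact: (standard_free _ _ realize).
move=> x; rewrite (standard_span sN realize); split=> [[u inv_u <-]|[u inv_u <-]].
  by exists u => //; rewrite actE.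
by exists u => //; rewrite actE.
Qed.
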